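(* Let $k(u_1,u_2,u_3,v_1,v_2,v_3,x)$ be an interaction rate of type 1 (three-dimensional) and assume $k(u_1,\dots,v_3,x)\ge k_1(x)(u_1+u_2+u_3+v_1+v_2+v_3)^\alpha$ for some $\alpha\in[0,1]$ and some $k_1\in L^\infty(\mathbb{T}^3)$ with $\operatorname{ess\,inf}k_1>0$. Let $0\le u_{0,i},v_{0,i}\in L^\infty(\mathbb{T}^3)$, $M:=\max_i\{\|u_{0,i}\|_{L^\infty},\|v_{0,i}\|_{L^\infty}\}$, and assume $m_\infty:=\frac16\int_{\mathbb{T}^3}\sum_i(u_{0,i}+v_{0,i})dx>0$. Let $(u_i,v_i)$ be the weak solution of the three-dimensional system with these data. Then there exist positive constants $\tilde\Lambda_\alpha$ (depending only on $M,m_\infty,c$) and $\tilde\lambda_\alpha$ (depending only on $M,m_\infty,c,\alpha$, $\operatorname{ess\,inf}k_1$ and the bound $\kappa_1(M)$ of $k$) such that for all $t\ge0$ $$\sum_{i=1}^3\int_{\mathbb{T}^3}\big[(u_i(t)-m_\infty)^2+(v_i(t)-m_\infty)^2\big]dx\le\tilde\Lambda_\alpha e^{-2\tilde\lambda_\alpha t}\sum_{i=1}^3\int_{\mathbb{T}^3}\big[(u_{0,i}-m_\infty)^2+(v_{0,i}-m_\infty)^2\big]dx.$$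
   Context: $\mathbb{T}^3=\mathbb{R}^3/\mathbb{Z}^3$ with Lebesgue measure of total mass $1$; $c>0$ fixed; $\rho:=\sum_{i=1}^3(u_i+v_i)$. The three-dimensional system is $\partial_t u_i+c\partial_{x_i}u_i=k(\rho-6u_i)$, $\partial_t v_i-c\partial_{x_i}v_i=k(\rho-6v_i)$, $i=1,2,3$, with initial data $u_{0,i},v_{0,i}$. A weak solution is a family of nonnegative $u_i,v_i\in L^\infty([0,T)\times\mathbb{T}^3)\cap C([0,T];L^p(\mathbb{T}^3))$ for all $T,p\in[1,\infty)$ satisfying, for all $\psi\in C_c^\infty([0,\infty)\times\mathbb{T}^3)$, $\int_0^\infty\!\int u_i(\partial_t\psi+c\partial_{x_i}\psi)+\int\psi(0)u_{0,i}+\int_0^\infty\!\int k(\rho-6u_i)\psi=0$ and the analogous identity for $v_i$ with $-c\partial_{x_i}$ and $k(\rho-6v_i)$. An interaction rate is a nonnegative measurable $k$ on $[0,\infty)^6\times\mathbb{T}^3$; it is of type 1 if for every $\gamma>0$ there is $\kappa_1(\gamma)>0$ with $k\le\kappa_1(\gamma)$ whenever $0\le u_i,v_i\le\gamma$ for all $i$. Known fact (Lions–Toscani): for $k$ of type 1 and nonnegative $L^\infty$ data there is a unique weak solution, and it satisfies $0\le u_i(t),v_i(t)\le M$ for all $t\ge0$. *)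

(* Defs.v *)
From HB Require Import structures.
From mathcomp Require Import all_boot all_order all_algebra.
From mathcomp Require Import all_classical all_reals all_analysis.
From mathcomp Require Import ess_sup_inf.
Set Implicit Arguments. Unset Strict Implicit. Unset Printing Implicit Defensive.
Import Order.TTheory GRing.Theory Num.Theory.
Import numFieldNormedType.Exports.
Local Open Scope classical_set_scope.
Local Open Scope ring_scope.

Section Defs.
Context {R : realType}.

(** A point x = (x1,(x2,x3)) of R^3, representative of a point of T^3. *)
Definition pt := (R * (R * R))%type.

Definition leb : {measure set _ -> \bar R} := (@lebesgue_measure R).
Definition mu3 : {measure set _ -> \bar R} := (leb \x^ (leb \x^ leb))%E.
Definition mu4 : {measure set _ -> \bar R} := (leb \x^ mu3)%E.

(** the fundamental cell [0,1)^3 of T^3 = R^3/Z^3 *)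
Definition cube : set pt := `[0%R, 1%R[ `*` (`[0%R, 1%R[ `*` `[0%R, 1%R[).

Lemma measurable_cube : measurable cube.
Proof. by apply: measurableX; [|apply: measurableX]; exact: measurable_itv. Qed.

Definition muT : {measure set _ -> \bar R} := mrestr mu3 measurable_cube.

Definition stdom : set (R * pt) := `[0%R, +oo[ `*` cube.

Definition esssup_abs (f : pt -> R) : \bar R := ess_sup muT (fun x => (`|f x|)%:E).
Definition essinf (f : pt -> R) : \bar R := ess_inf muT (fun x => (f x)%:E).

Definition Linf (f : pt -> R) : Prop :=
  measurable_fun cube f /\ (esssup_abs f < +oo)%E.

Definition shiftx (i : 'I_3) (s : R) (x : pt) : pt :=
  match val i with
  | 0%N => (x.1 + s, x.2)
  | 1%N => (x.1, (x.2.1 + s, x.2.2))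
  | _ => (x.1, (x.2.1, x.2.2 + s))
  end.

Definition dt (F : R -> pt -> R) : R -> pt -> R :=
  fun t x => derive1 (fun s => F s x) t.
Definition dx (i : 'I_3) (F : R -> pt -> R) : R -> pt -> R :=
  fun t x => derive1 (fun s => F t (shiftx i s x)) 0.

Definition dir (j : 'I_4) (F : R -> pt -> R) : R -> pt -> R :=
  match val j with
  | 0%N => dt F
  | 1%N => dx (@Ordinal 3 0 isT) F
  | 2%N => dx (@Ordinal 3 1 isT) F
  | _ => dx (@Ordinal 3 2 isT) F
  end.
Definition derivable_dir (j : 'I_4) (F : R -> pt -> R) (t : R) (x : pt) : Prop :=
  match val j with
  | 0%N => derivable (fun s => F s x) t 1
  | 1%N => derivable (fun s => F t (shiftx (@Ordinal 3 0 isT) s x)) 0 1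
  | 2%N => derivable (fun s => F t (shiftx (@Ordinal 3 1 isT) s x)) 0 1
  | _ => derivable (fun s => F t (shiftx (@Ordinal 3 2 isT) s x)) 0 1
  end.

Definition smooth (F : R -> pt -> R) : Prop :=
  forall js : seq 'I_4,
    let G := foldr dir F js in
    continuous (fun p : R * pt => G p.1 p.2) /\
    forall (j : 'I_4) t x, derivable_dir j G t x.

(** test functions: (restrictions to [0,oo) x T^3 of) C^oo functions on R x T^3
    (i.e. Z^3-periodic in x) with compact support in [0,oo) x T^3 *)
Definition test_fun (psi : R -> pt -> R) : Prop :=
  [/\ smooth psi,
      (forall (i : 'I_3) t x, psi t (shiftx i 1 x) = psi t x) &
      exists T : R, forall t x, T <= t -> psi t x = 0].

Definition sol_space (w : R -> pt -> R) : Prop :=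
  [/\ (forall T : R, 0 < T ->
         measurable_fun (`[0%R, T[ `*` cube) (fun p : R * pt => w p.1 p.2) /\
         exists C : R, {ae mu4, forall p : R * pt,
                          (`[0%R, T[ `*` cube) p -> `|w p.1 p.2| <= C}),
      {ae mu4, forall p : R * pt, stdom p -> 0 <= w p.1 p.2} &
      forall p : R, 1 <= p ->
        (forall t, 0 <= t -> measurable_fun cube (w t) /\
           (\int[mu3]_(x in cube) (`|w t x| `^ p)%:E < +oo)%E) /\
        (forall t0, 0 <= t0 -> forall eps : R, 0 < eps ->
           exists2 delta : R, 0 < delta & forall t, 0 <= t -> `|t - t0| < delta ->
             (\int[mu3]_(x in cube) (`|w t x - w t0 x| `^ p)%:E < eps%:E)%E)].

(** interaction rates k(u1,u2,u3,v1,v2,v3,x), written k((u1,(u2,u3)),(v1,(v2,v3)),x) *)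
Definition quadrant : set pt := `[0%R, +oo[ `*` (`[0%R, +oo[ `*` `[0%R, +oo[).
Definition box (g : R) : set pt := `[0%R, g] `*` (`[0%R, g] `*` `[0%R, g]).
Definition kdom : set (pt * pt * pt) := quadrant `*` quadrant `*` cube.

Definition interaction_rate (k : pt * pt * pt -> R) : Prop :=
  measurable_fun kdom k /\ forall z, kdom z -> 0 <= k z.

Definition type1 (k : pt * pt * pt -> R) : Prop :=
  forall g : R, 0 < g -> exists2 kappa : R, 0 < kappa &
    forall a b x, box g a -> box g b -> cube x -> k (a, b, x) <= kappa.

Definition sum3 (a : pt) : R := a.1 + a.2.1 + a.2.2.

Definition vec3 (w : 'I_3 -> R -> pt -> R) (t : R) (x : pt) : pt :=
  (w (@Ordinal 3 0 isT) t x, (w (@Ordinal 3 1 isT) t x, w (@Ordinal 3 2 isT) t x)).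

(** weak solution of
      d_t u_i + c d_{x_i} u_i = k (rho - 6 u_i),
      d_t v_i - c d_{x_i} v_i = k (rho - 6 v_i),  i = 1,2,3,
    with rho = sum_i (u_i + v_i) and initial data u0, v0 *)
Definition weak_solution (c : R) (k : pt * pt * pt -> R)
    (u0 v0 : 'I_3 -> pt -> R) (u v : 'I_3 -> R -> pt -> R) : Prop :=
  let rho t x := \sum_(i < 3) (u i t x + v i t x) in
  let kk t x := k (vec3 u t x, vec3 v t x, x) in
  (forall i, sol_space (u i) /\ sol_space (v i)) /\
  forall psi, test_fun psi -> forall i : 'I_3,
    (Rintegral mu4 stdom
        (fun p : R * pt => u i p.1 p.2 * (dt psi p.1 p.2 + c * dx i psi p.1 p.2))
     + Rintegral mu3 cube (fun x => psi 0 x * u0 i x)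
     + Rintegral mu4 stdom
        (fun p : R * pt => kk p.1 p.2 * (rho p.1 p.2 - 6 * u i p.1 p.2) * psi p.1 p.2)
     = 0) /\
    (Rintegral mu4 stdom
        (fun p : R * pt => v i p.1 p.2 * (dt psi p.1 p.2 - c * dx i psi p.1 p.2))
     + Rintegral mu3 cube (fun x => psi 0 x * v0 i x)
     + Rintegral mu4 stdom
        (fun p : R * pt => kk p.1 p.2 * (rho p.1 p.2 - 6 * v i p.1 p.2) * psi p.1 p.2)
     = 0).

End Defs.

(* Main.v *)
(** Testing the weak formulation against smooth functions transported with the speed of a
    density shows, through a pi-lambda argument, that each density satisfies Duhamel's formula
    along its characteristics. A chain rule for primitives of bounded functions then gives
    the balance [d/dt sum_a int Phi (w_a) = - 1/2 int k sum_ab (Phi' (w_a) - Phi' (w_b)) (w_a - w_b)].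
    The choices [(x - M)_+^2] and [(- x)_+^2] for [Phi] confine the densities to [[0, M]], and
    [(x - m)^2] gives the decay of the energy [E] with dissipation [int k sum_ab (w_a - w_b)^2].

    On [[0, 6 M]] the rate [k] dominates a multiple of [rho], and
    [(w_a^2 - w_b^2)^2 <= 2 M rho (w_a - w_b)^2]. So the dissipation during a window of length
    [L = 1 / (2 c)] bounds the distance between the squares [w_a^2] and [w_b^2], and the defect
    of [w_a^2] from being transported. Two opposite directions on one axis are displaced by one
    full period relative to each other during the window, so that each [w_a^2] is close to
    its translates and hence all of them are close to a common constant. Because the mass is
    positive this controls the distance of the [w_a] to [m], that is
    [L E(t) <= C (E(t) - E(t + L))], and the estimate is iterated. *)
Require Import Defs.
From HB Require Import structures.
From mathcomp Require Import all_boot all_order all_algebra.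
From mathcomp Require Import all_classical all_reals all_analysis.
From mathcomp Require Import ess_sup_inf measurable_realfun.
From mathcomp Require Import ring lra.
Set Implicit Arguments.
Unset Strict Implicit.
Unset Printing Implicit Defensive.
Import Order.TTheory GRing.Theory Num.Theory.
Import numFieldNormedType.Exports.
Local Open Scope classical_set_scope.
Local Open Scope ring_scope.

(** The rate may vanish with the total density, so the dissipation says nothing where that density
    is small, and no pointwise lower bound on the densities is at hand. Comparing squares fits this
    degeneracy, and the way back is [r ^ 2 (x - r) ^ 2 <= (x ^ 2 - r ^ 2) ^ 2] for nonnegative [x]
    and [r]: with [r = w_b(y)], averaged over [y] and summed over [b], the weight on the left is at
    least [6 m ^ 2], however the mass is distributed. No limit constant is identified; a double
    integral over two points takes its place. The exponent [alpha] enters through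
    [r / (1 + 6 M) <= r ^ alpha] on [[0, 6 M]]. The second obstacle is regularity. The densities are
    controlled on the cell, up to null sets, with continuity in time only in the mean, and [k] is
    measurable only on its domain. They are therefore traded for versions that are measurable,
    bounded and periodic everywhere. [bounded_meas] asks for measurability and a bound on the whole
    space, which makes the class stable under products, translations and sections, and makes every
    integral over a finite domain harmless. *)

Definition bounded_meas {d} {T : measurableType d} {R : realType} (f : T -> R) : Prop :=
  measurable_fun setT f /\ exists C : R, forall x, `|f x| <= C.

Definition finite_domain {d} {T : measurableType d} {R : realType}
    (mu : {measure set T -> \bar R}) (D : set T) : Prop :=
  measurable D /\ (mu D < +oo)%E.

(** * Bounded measurable functions and their integrals over sets of finite measure *)

Section BoundedMeasurable.
Context {d} {T : measurableType d} {R : realType}.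
Implicit Types f g : T -> R.

Lemma bmP f (C : R) : measurable_fun setT f -> (forall x, `|f x| <= C) -> bounded_meas f.
Proof. by move=> mf fC; split => //; exists C. Qed.

Lemma bm_cst (r : R) : bounded_meas (fun _ : T => r).
Proof. by apply: (@bmP _ `|r|) => //; exact: measurable_cst. Qed.

Lemma bmD f g : bounded_meas f -> bounded_meas g -> bounded_meas (fun x => f x + g x).
Proof.
move=> [mf [C fC]] [mg [B gB]]; apply: (@bmP _ (C + B)).
  exact: measurable_funD.
by move=> x; rewrite (le_trans (ler_normD _ _))// lerD.
Qed.

Lemma bmM f g : bounded_meas f -> bounded_meas g -> bounded_meas (fun x => f x * g x).
Proof.
move=> [mf [C fC]] [mg [B gB]]; apply: (@bmP _ (C * B)).
  exact: measurable_funM.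
by move=> x; rewrite normrM ler_pM.
Qed.

Lemma bmN f : bounded_meas f -> bounded_meas (fun x => - f x).
Proof.
move=> [mf [C fC]]; apply: (@bmP _ C); last by move=> x; rewrite normrN.
exact: measurableT_comp.
Qed.

Lemma bmB f g : bounded_meas f -> bounded_meas g -> bounded_meas (fun x => f x - g x).
Proof. by move=> hf hg; apply: bmD => //; exact: bmN. Qed.

Lemma bmX f n : bounded_meas f -> bounded_meas (fun x => f x ^+ n).
Proof.
move=> hf; elim: n => [|n IH].
  by under eq_fun do rewrite expr0; exact: bm_cst.
by under eq_fun do rewrite exprS; exact: bmM.
Qed.

Lemma bm_norm f : bounded_meas f -> bounded_meas (fun x => `|f x|).
Proof.
move=> [mf [C fC]]; apply: (@bmP _ C); last by move=> x; rewrite normr_id.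
exact: measurableT_comp.
Qed.

Lemma bm_sum (I : Type) (r : seq I) (F : I -> T -> R) :
  (forall i, bounded_meas (F i)) -> bounded_meas (fun x => \sum_(i <- r) F i x).
Proof.
move=> hF; elim: r => [|i r IH].
  by under eq_fun do rewrite big_nil; exact: bm_cst.
by under eq_fun do rewrite big_cons; exact: bmD.
Qed.

Lemma bm_indic (A : set T) : measurable A -> bounded_meas (\1_A : T -> R).
Proof.
move=> mA; apply: (@bmP _ 1); first exact: measurable_indic.
by move=> x; rewrite indicE; case: (_ \in _); rewrite ?normr1 ?normr0.
Qed.

End BoundedMeasurable.

Lemma bm_comp {d d'} {T : measurableType d} {T' : measurableType d'} {R : realType}
    (h : T' -> T) (f : T -> R) :
  bounded_meas f -> measurable_fun setT h -> bounded_meas (fun x => f (h x)).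
Proof. by move=> [mf [C fC]] mh; split; [exact: measurableT_comp|exists C]. Qed.

Lemma bm_comp_continuous {d} {T : measurableType d} {R : realType} (phi : R -> R) (f : T -> R) :
  continuous phi -> bounded_meas f -> bounded_meas (fun x => phi (f x)).
Proof.
move=> cphi [mf [C fC]]; split.
  by apply: measurableT_comp => //; exact: continuous_measurable_fun.
have : compact (phi @` `[- C, C]).
  apply: continuous_compact; last exact: segment_compact.
  exact: continuous_subspaceT.
move=> /compact_bounded[B [_ /(_ (B + 1))]]; rewrite ltrDl ltr01 => /(_ isT) h.
exists (B + 1) => x; apply: h; exists (f x) => //=.
by rewrite in_itv/= -ler_norml.
Qed.

Section FiniteDomainIntegral.
Context {d} {T : measurableType d} {R : realType}.
Variables (mu : {measure set T -> \bar R}) (D : set T).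
Hypothesis fD : finite_domain mu D.
Implicit Types f g : T -> R.
Let mD : measurable D := fD.1.

Lemma bm_integrable f : bounded_meas f -> mu.-integrable D (EFin \o f).
Proof.
move=> [mf [C fC]]; apply: measurable_bounded_integrable => //; first exact: fD.2.
  exact: measurable_funTS.
by exists C; split; [exact: num_real|move=> x Cx y _ /=; rewrite (le_trans (fC y))// ltW].
Qed.

Lemma bm_RintegralD f g : bounded_meas f -> bounded_meas g ->
  Rintegral mu D (fun x => f x + g x) = Rintegral mu D f + Rintegral mu D g.
Proof. by move=> hf hg; rewrite RintegralD//; exact: bm_integrable. Qed.

Lemma bm_RintegralB f g : bounded_meas f -> bounded_meas g ->
  Rintegral mu D (fun x => f x - g x) = Rintegral mu D f - Rintegral mu D g.
Proof. by move=> hf hg; rewrite RintegralB//; exact: bm_integrable. Qed.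

Lemma bm_RintegralZ r f : bounded_meas f ->
  Rintegral mu D (fun x => r * f x) = r * Rintegral mu D f.
Proof. by move=> hf; rewrite RintegralZl//; exact: bm_integrable. Qed.

Lemma bm_Rintegral_sum (I : Type) (r : seq I) (F : I -> T -> R) :
  (forall i, bounded_meas (F i)) ->
  Rintegral mu D (fun x => \sum_(i <- r) F i x) = \sum_(i <- r) Rintegral mu D (F i).
Proof.
move=> hF; elim: r => [|i r IH].
  rewrite big_nil; under eq_Rintegral do rewrite big_nil.
  by rewrite Rintegral_cst// mul0r.
rewrite big_cons; under eq_Rintegral do rewrite big_cons.
by rewrite bm_RintegralD ?IH//; exact: bm_sum.
Qed.

Lemma ae_le_Rintegral f g : bounded_meas f -> bounded_meas g ->
  {ae mu, forall x, D x -> f x <= g x} ->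
  Rintegral mu D f <= Rintegral mu D g.
Proof.
move=> hf hg fg; rewrite -subr_ge0 -bm_RintegralB//.
have hgf := bmB hg hf.
(* The difference agrees almost everywhere with its positive part, whose integral is nonnegative
   without any exceptional set. *)
rewrite (_ : Rintegral mu D _ = Rintegral mu D (fun x => Num.max 0 (g x - f x))).
  by apply: Rintegral_ge0 => x _; rewrite le_max lexx.
congr fine; apply: ae_eq_integral => //.
- by apply/measurable_EFinP/measurable_funTS; have [] := hgf.
- apply/measurable_EFinP/measurable_funTS; apply: measurable_maxr => //.
  by have [] := hgf.
apply: filterS fg => x fg Dx; congr EFin.
by apply/esym/max_idPr; rewrite subr_ge0 fg.
Qed.

Lemma bm_le_Rintegral f g : bounded_meas f -> bounded_meas g ->
  (forall x, D x -> f x <= g x) -> Rintegral mu D f <= Rintegral mu D g.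
Proof. by move=> hf hg fg; apply: ae_le_Rintegral => //; exact: aeW. Qed.

Lemma ae_eq_Rintegral f g : bounded_meas f -> bounded_meas g ->
  {ae mu, forall x, D x -> f x = g x} -> Rintegral mu D f = Rintegral mu D g.
Proof.
by move=> hf hg fg; apply/eqP; rewrite eq_le; apply/andP; split;
  apply: ae_le_Rintegral => //; apply: filterS fg => x h /h ->.
Qed.

Lemma bm_Rintegral_le f C : bounded_meas f -> (forall x, D x -> `|f x| <= C) ->
  `|Rintegral mu D f| <= C * fine (mu D).
Proof.
move=> hf fC; rewrite (le_trans (le_normr_Rintegral _ _))//; first exact: bm_integrable.
rewrite -(Rintegral_cst mu mD); apply: bm_le_Rintegral => //.
- exact: bm_norm.
- exact: bm_cst.
Qed.

Lemma bm_fine f : bounded_meas f ->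
  (\int[mu]_(x in D) (f x)%:E)%E = (Rintegral mu D f)%:E.
Proof.
move=> hf; rewrite /Rintegral fineK//; apply: integrable_fin_num => //.
exact: bm_integrable.
Qed.

(** The Cauchy-Schwarz inequality against the constant [1]: the quadratic polynomial
    [s -> int (s f - 1) ^ 2] is nonnegative, and the bound is its discriminant condition. *)
Lemma bm_Rintegral_sqr f : bounded_meas f ->
  (Rintegral mu D f) ^+ 2 <= fine (mu D) * Rintegral mu D (fun x => f x ^+ 2).
Proof.
move=> hf; set I := Rintegral mu D f; set V := fine (mu D); set J := Rintegral _ _ _.
have V0 : 0 <= V by rewrite fine_ge0.
have hf2 : bounded_meas (fun x => f x ^+ 2) by exact: bmX.
have key s : 0 <= J * s ^+ 2 - 2 * s * I + V.
  have : 0 <= Rintegral mu D (fun x => (s * f x - 1) ^+ 2).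
    by apply: Rintegral_ge0 => x _; exact: sqr_ge0.
  rewrite (_ : Rintegral _ _ _ = J * s ^+ 2 - 2 * s * I + V)//.
  transitivity (Rintegral mu D (fun x => s ^+ 2 * f x ^+ 2 - 2 * s * f x + 1)).
    by apply: eq_Rintegral => x _; ring.
  rewrite bm_RintegralD; [|by apply: bmB; apply: bmM => //; exact: bm_cst|exact: bm_cst].
  rewrite bm_RintegralB; [|by apply: bmM => //; exact: bm_cst..].
  rewrite !bm_RintegralZ// Rintegral_cst// -/I -/J -/V; ring.
have J0 : 0 <= J by apply: Rintegral_ge0 => x _; exact: sqr_ge0.
have [I0|In0] := eqVneq I 0; first by rewrite I0 expr0n/= mulr_ge0.
have [J1|Jn0] := eqVneq J 0.
  (* For [J = 0] the polynomial is affine in [s], and this value of [s] makes it equal to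
     [- V - 2 < 0]. *)
  have := key ((V + 1) / I); rewrite J1 mul0r sub0r.
  rewrite (_ : - _ + V = - V - 2); last by field.
  lra.
have Jp : 0 < J by rewrite lt_neqAle eq_sym Jn0.
(* The minimiser of the polynomial. *)
have := key (I / J).
rewrite (_ : _ - _ + V = (V * J - I ^+ 2) / J); last by field.
by rewrite pmulr_lge0 ?invr_gt0// subr_ge0.
Qed.

End FiniteDomainIntegral.

Section NullSets.
Import HBNNSimple.

(* A measurable representative computes the integral even when [f] itself is not measurable. *)
Lemma nullset_Rintegral d (T : measurableType d) (R : realType)
    (mu : {measure set T -> \bar R}) (D : set T) (f g : T -> R) (N : set T) :
  measurable D -> measurable N -> mu N = 0%E -> measurable_fun D g ->
  (forall x, D x -> ~ N x -> f x = g x) ->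
  Rintegral mu D f = Rintegral mu D g.
Proof.
move=> mD mN N0 mg fg; congr fine.
have key (u v : T -> \bar R) : measurable_fun setT v -> (forall x, (0 <= v x)%E) ->
    (forall x, (0 <= u x)%E) ->
    (forall x, ~ N x -> u x = v x) -> (\int[mu]_x u x = \int[mu]_x v x)%E.
  move=> mv v0 u0 uv.
  have mCN : measurable (~` N) by exact: measurableC.
  have uvC : (\int[mu]_(x in ~` N) u x = \int[mu]_(x in ~` N) v x)%E.
    by apply: eq_integral => x; rewrite inE => /uv.
  rewrite (ge0_negligible_integral mN _ mv)// setTD -uvC.
  rewrite !ge0_integralTE//.
  rewrite integral_mkcond ge0_integralTE; last by move=> x; exact: erestrict_ge0.
  apply/eqP; rewrite eq_le; apply/andP; split; last first.
    apply: ereal_sup_le => _ [h hu <-]; exists h => // x.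
    by rewrite (le_trans (hu x))// patchE; case: ifPn.
  apply: ge_ereal_sup => _ [h hu <-].
  (* A simple function below [u] keeps its integral when it is cut to zero on [N], and then lies
     below the restriction of [u]; no measurability of [u] is involved. *)
  pose k := proj_nnsfun h mCN.
  have kE x : k x = (h \_ (~` N)) x by rewrite (mrestrict h mCN).
  have : sintegral mu k = sintegral mu h.
    rewrite -!integralT_nnsfun.
    rewrite [RHS](ge0_negligible_integral mN)//; last 2 first.
      exact/measurable_EFinP.
      by move=> x _; rewrite lee_fin.
    rewrite [LHS](ge0_negligible_integral mN)//; last 2 first.
      exact/measurable_EFinP.
      by move=> x _; rewrite lee_fin.
    apply: eq_integral => x; rewrite inE => -[_ Nx].
    by rewrite kE patchE mem_set.
  move=> <-; apply: ereal_sup_ubound; exists k => // x.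
  rewrite kE !patchE; case: ifPn => // xN; exact: hu.
rewrite integralE [RHS]integralE.
have fgp x : ~ N x -> (((EFin \o f)^\+)%E \_ D) x = (((EFin \o g)^\+)%E \_ D) x.
  by move=> Nx; rewrite !patchE; case: ifPn => // /set_mem Dx; rewrite !funeposE /= fg.
have fgn x : ~ N x -> (((EFin \o f)^\-)%E \_ D) x = (((EFin \o g)^\-)%E \_ D) x.
  by move=> Nx; rewrite !patchE; case: ifPn => // /set_mem Dx; rewrite !funenegE /= fg.
congr (_ - _)%E; rewrite integral_mkcond [RHS]integral_mkcond; apply: key => //.
- by apply/(measurable_restrictT _ mD)/measurable_funepos/measurable_EFinP.
- by move=> x; apply: erestrict_ge0 => y _.
- by move=> x; apply: erestrict_ge0 => y _.
- by apply/(measurable_restrictT _ mD)/measurable_funeneg/measurable_EFinP.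
- by move=> x; apply: erestrict_ge0 => y _.
- by move=> x; apply: erestrict_ge0 => y _.
Qed.

End NullSets.

(** * Fubini for bounded functions *)

Section FubiniBounded.
Context {d1 d2} {T1 : measurableType d1} {T2 : measurableType d2} {R : realType}.
Variables (m1 : {sigma_finite_measure set T1 -> \bar R})
          (m2 : {sigma_finite_measure set T2 -> \bar R}).
Variables (D1 : set T1) (D2 : set T2).
Hypotheses (fD1 : finite_domain m1 D1) (fD2 : finite_domain m2 D2).

Lemma finite_domain_prod : finite_domain (m1 \x^ m2)%E (D1 `*` D2).
Proof.
have [mD1 f1] := fD1; have [mD2 f2] := fD2; split; first exact: measurableX.
by rewrite /= product_measure2E// lte_mul_pinfty// ge0_fin_numE.
Qed.

Lemma bm_Rintegral_section (F : T1 * T2 -> R) : bounded_meas F ->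
  bounded_meas (fun x => Rintegral m2 D2 (fun y => F (x, y))).
Proof.
move=> hF; have [mF [C FC]] := hF; have [mD2 f2] := fD2.
have hFx x : bounded_meas (fun y => F (x, y)).
  by apply: (bm_comp hF); exact: pair1_measurable.
split; last first.
  exists (C * fine (m2 D2)) => x; exact: (bm_Rintegral_le fD2 (hFx x)).
(* Adding [C] makes the integrand nonnegative, as Tonelli's measurability statement requires; the
   indicator restricts to [D2], and [C * fine (m2 D2)] is subtracted again below. *)
pose G (z : T1 * T2) := (F z + C) * \1_D2 z.2.
have mG : measurable_fun setT (EFin \o G).
  apply/measurable_EFinP/measurable_funM; first exact: measurable_funD.
  by apply: measurableT_comp => //; exact: measurable_indic.
have G0 z : (0 <= (EFin \o G) z)%E.
  rewrite lee_fin mulr_ge0 ?indicE//.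
  by have := FC z; rewrite ler_norml => /andP[]; lra.
have := measurable_fun_fubini_tonelli_F (m2 := m2) _ mG G0.
rewrite /fubini_F => mI.
rewrite (_ : (fun x => _) =
    (fun x => fine (\int[m2]_y (EFin \o G) (x, y))%E - C * fine (m2 D2))).
  by apply: measurable_funB => //; apply: measurableT_comp.
apply/funext => x.
rewrite (_ : (\int[m2]_y (EFin \o G) (x, y))%E = \int[m2]_(y in D2) (F (x, y) + C)%:E)%E.
  rewrite -[fine _]/(Rintegral m2 D2 _) bm_RintegralD//; last exact: bm_cst.
  by rewrite Rintegral_cst// addrK.
rewrite [RHS]integral_mkcond; apply: eq_integral => y _.
by rewrite /G/= patchE indicE; case: ifPn; rewrite ?mulr1 ?mulr0.
Qed.

Let prodH (F : T1 * T2 -> R) : bounded_meas F ->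
  (m1 \x m2)%E.-integrable setT ((EFin \o F) \_ (D1 `*` D2)).
Proof.
move=> hF; have [mD1 f1] := fD1; have [mD2 f2] := fD2.
apply/(integrable_mkcond _ (measurableX mD1 mD2)).
apply: bm_integrable => //; split; first exact: measurableX.
by rewrite /= product_measure1E// lte_mul_pinfty// ge0_fin_numE.
Qed.

Lemma Rintegral_prodE (F : T1 * T2 -> R) : bounded_meas F ->
  Rintegral (m1 \x^ m2)%E (D1 `*` D2) F =
  Rintegral m1 D1 (fun x => Rintegral m2 D2 (fun y => F (x, y))).
Proof.
move=> hF; rewrite {1}/Rintegral integral_mkcond.
rewrite -(integral12_prod_meas2 (prodH hF)) /Rintegral; congr fine.
rewrite [RHS]integral_mkcond; apply: eq_integral => x _; rewrite /fubini_F !patchE.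
case: ifPn => xD1; last first.
  apply: integral0_eq => y _; rewrite patchE; case: ifPn => //.
  by rewrite inE => -[/= D1x _]; move: xD1; rewrite notin_setE.
rewrite -[RHS]/((Rintegral m2 D2 (fun y => F (x, y)))%:E) -bm_fine//; last first.
  by apply: (bm_comp hF); exact: pair1_measurable.
rewrite [RHS]integral_mkcond; apply: eq_integral => y _; rewrite !patchE.
by rewrite in_setX /= xD1.
Qed.

Lemma Rintegral_swap (F : T1 * T2 -> R) : bounded_meas F ->
  Rintegral m1 D1 (fun x => Rintegral m2 D2 (fun y => F (x, y))) =
  Rintegral m2 D2 (fun y => Rintegral m1 D1 (fun x => F (x, y))).
Proof.
move=> hF; rewrite -Rintegral_prodE// {1}/Rintegral integral_mkcond.
rewrite -(integral21_prod_meas2 (prodH hF)) /Rintegral; congr fine.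
rewrite [RHS]integral_mkcond; apply: eq_integral => y _; rewrite /fubini_G !patchE.
case: ifPn => yD2; last first.
  apply: integral0_eq => x _; rewrite patchE; case: ifPn => //.
  by rewrite inE => -[/= _ D2y]; move: yD2; rewrite notin_setE.
rewrite -[RHS]/((Rintegral m1 D1 (fun x => F (x, y)))%:E) -bm_fine//; last first.
  by apply: (bm_comp hF); exact: pair2_measurable.
rewrite [RHS]integral_mkcond; apply: eq_integral => x _; rewrite !patchE.
by rewrite in_setX /= yD2 andbT.
Qed.

(** The diagonal products of two exhausting sequences cover everything because both sequences are
    nested. Sigma-finiteness of the product is what allows a further factor in the iterated products
    [mu3] and [mu4]. *)
Lemma product_measure2_sigma_finite : sigma_finite setT (m1 \x^ m2)%E.
Proof.
have /sigma_finiteP[F [FT ndF Ff]] := sigma_finiteT m1.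
have /sigma_finiteP[G [GT ndG Gf]] := sigma_finiteT m2.
exists (fun n => F n `*` G n) => [|n].
  apply/esym/seteqP; split => // -[x y] _.
  have [i _ Fi] : (\bigcup_i F i) x by rewrite -FT.
  have [j _ Gj] : (\bigcup_i G i) y by rewrite -GT.
  exists (maxn i j) => //; split => /=.
    by move: Fi; exact/subsetPset/ndF/leq_maxl.
  by move: Gj; exact/subsetPset/ndG/leq_maxr.
have [[mF fF] [mG fG]] := (Ff n, Gf n); split; first exact: measurableX.
by rewrite product_measure2E// lte_mul_pinfty// ge0_fin_numE.
Qed.

(** [\x^] integrates over the other family of sections, so the measure is first identified with [\x]
    by uniqueness of product measures; there the measure of [N] is the integral of that of its
    sections over [m1]. *)
Lemma ae_section (N : set (T1 * T2)) : measurable N -> (m1 \x^ m2)%E N = 0%E ->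
  {ae m1, forall x, m2 (xsection N x) = 0%E}.
Proof.
move=> mN N0.
have : ((m1 \x m2) N = 0)%E.
  rewrite (product_measure_unique (m' := (m1 \x^ m2)%E))//.
  by move=> A B mA mB; exact: product_measure2E.
rewrite /product_measure1 => /eqP i0.
have mX : measurable_fun setT (m2 \o xsection N) by exact: measurable_fun_xsection.
have : (\int[m1]_x `|(m2 \o xsection N) x| = 0)%E.
  by rewrite -[RHS](eqP i0); apply: eq_integral => x _; rewrite gee0_abs.
move/(ae_eq_integral_abs m1 measurableT mX); apply: filterS => x; exact.
Qed.

End FubiniBounded.

Section Domains.
Context {R : realType}.

Definition lebs : {sigma_finite_measure set (measurableTypeR R) -> \bar R} :=
  @lebesgue_measure R.

(** The measures nested in [mu3] and [mu4], repackaged together with their sigma-finiteness so that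
    Fubini's theorem applies to them. *)
Definition leb2 : {sigma_finite_measure set _ -> \bar R} :=
  HB.pack (lebs \x^ lebs)%E (Measure.on (lebs \x^ lebs)%E)
   (Measure_isSigmaFinite.Build _ _ _ _ (product_measure2_sigma_finite lebs lebs)).

Definition leb3 : {sigma_finite_measure set _ -> \bar R} :=
  HB.pack (lebs \x^ leb2)%E (Measure.on (lebs \x^ leb2)%E)
   (Measure_isSigmaFinite.Build _ _ _ _ (product_measure2_sigma_finite lebs leb2)).

End Domains.

(** * Integrals in time and over the periodicity cell *)

Section TimeIntegral.
Context {R : realType}.
Implicit Types (a b c s : R) (g : R -> R).

Definition tint a b g := Rintegral lebs `[a, b[ g.

Let lebs_itvE (i : interval R) : lebs [set` i] =
  (if i.1 < i.2 then (i.2 : \bar R) - i.1 else 0)%E.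
Proof. exact: lebesgue_measure_itv. Qed.

Lemma finite_domain_itv a b : finite_domain lebs (`[a, b[%classic : set (measurableTypeR R)).
Proof.
split; first exact: measurable_itv.
by rewrite [X in (X < _)%E]lebs_itvE/=; case: ifPn => _; rewrite -?EFinB ltry.
Qed.

Lemma lebs_itv a b : a <= b -> fine (lebs `[a, b[%classic) = b - a.
Proof.
rewrite lebs_itvE/= lte_fin.
by rewrite le_eqVlt => /predU1P[->|->//]; rewrite ltxx subrr.
Qed.

Lemma tint_cst a b r : a <= b -> tint a b (fun=> r) = r * (b - a).
Proof. by move=> ab; rewrite /tint Rintegral_cst ?lebs_itv.
Qed.

Lemma tint_split a b c g : bounded_meas g -> a <= b -> b <= c ->
  tint a c g = tint a b g + tint b c g.
Proof.
move=> hg ab bc; rewrite /tint (@itv_bndbnd_setU _ _ _ (BLeft b))//.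
rewrite Rintegral_setU//.
- rewrite -itv_bndbnd_setU//; exact: (bm_integrable (finite_domain_itv a c) hg).
- by apply/disj_setPS => y [/=]; rewrite 2!in_itv/= => /andP[_ yx] /andP[]; rewrite leNgt yx.
Qed.

Lemma eq_tint a b g h : (forall t, a <= t -> t < b -> g t = h t) -> tint a b g = tint a b h.
Proof.
move=> gh; apply: eq_Rintegral => t; rewrite inE/= in_itv/= => /andP[] *; exact: gh.
Qed.

Lemma measurable_shiftr s :
  measurable_fun setT (fun x : R => x + s).
Proof. by apply: measurable_funD => //; exact: measurable_cst. Qed.

(** Translation invariance comes from uniqueness of Lebesgue measure: its push-forward under a
    translation gives half-open intervals their length. *)
Lemma tint_shift a b s g : bounded_meas g ->
  tint a b (fun t => g (t + s)) = tint (a + s) (b + s) g.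
Proof.
move=> hg; pose phi : measurableTypeR R -> measurableTypeR R := fun x => x + s.
have mphi : measurable_fun setT phi := measurable_shiftr s.
have pre x y u v : phi @^-1` [set` Interval (BSide x u) (BSide y v)] =
    [set` Interval (BSide x (u - s)) (BSide y (v - s))].
  apply/seteqP; split => z /=; rewrite !in_itv/= /phi;
    case: x; case: y => /=; lra.
have mE A : measurable A -> lebs A = pushforward lebs phi A.
  apply: lebesgue_measure_unique => _ [[u v]] _ <-.
  transitivity (lebs [set` `]u - s, v - s]]); last exact: congr1 (esym (pre false false u v)).
  rewrite [LHS]lebs_itvE [RHS]lebs_itvE/= !lte_fin ltrD2r.
  by case: ifPn => // _; rewrite -!EFinB; congr EFin; ring.
rewrite /tint /Rintegral; congr fine.
have -> : `[a, b[%classic = phi @^-1` `[a + s, b + s[.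
  by rewrite (pre true true) !addrK.
have hgs : bounded_meas (g \o phi) by exact: bm_comp.
have mI := @measurable_itv R `[a + s, b + s[.
rewrite [RHS](eq_measure_integral (pushforward lebs phi)); last by move=> A mA _; exact: mE.
rewrite integral_pushforward//; first by apply/measurable_EFinP; case: hg.
apply: (@bm_integrable _ _ _ _ _ _ (g \o phi)) => //.
by rewrite (pre true true) !addrK; exact: finite_domain_itv.
Qed.

(** The shift is reduced modulo [P] to some [r] in [[0, P)]; the window [[r, P + r)] is then cut at
    [P] and its last piece is moved back by one period. *)
Lemma tint_period P s g : 0 < P -> bounded_meas g ->
  (forall t, g (t + P) = g t) -> tint 0 P (fun t => g (t + s)) = tint 0 P g.
Proof.
move=> P0 hg gP.
have gPz (n : int) t : g (t + n%:~R * P) = g t.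
  have gPn (m : nat) u : g (u + m%:R * P) = g u.
    elim: m u => [|m IH] u; first by rewrite mul0r addr0.
    by rewrite -natr1 mulrDl mul1r addrA gP IH.
  case: n => m; first exact: gPn.
  by rewrite NegzE mulrNz mulNr -pmulrn -[LHS](gPn m.+1) subrK.
pose r := s - (Num.floor (s / P))%:~R * P.
have r0 : 0 <= r.
  by rewrite subr_ge0 -ler_pdivlMr// floor_le.
have rP : r < P.
  have := floorD1_gt (s / P); rewrite intrD ltr_pdivrMr// mulrDl mul1r /r; lra.
transitivity (tint 0 P (fun t => g (t + r))).
  apply: eq_tint => t _ _; rewrite -(gPz (Num.floor (s / P)) (t + r)).
  by congr g; rewrite /r; ring.
rewrite tint_shift// add0r (@tint_split r P)//; [|lra|lra].
rewrite addrC -[X in tint P (X + r)]add0r addrC.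
rewrite (_ : tint P _ g = tint 0 r g); last first.
  rewrite -[X in tint X _ g]add0r [X in tint _ X g]addrC.
  rewrite [X in tint _ X g](_ : _ = r + P); last by ring.
  by rewrite -tint_shift//; apply: eq_tint => t _ _; rewrite gP.
by rewrite addrC -tint_split//; lra.
Qed.

End TimeIntegral.

(** A case view that produces the three indices with the proof term [isT], the form in which [dir]
    and [vec3] mention them. *)
Variant ord3_spec : 'I_3 -> Prop :=
  | Ord3_0 : ord3_spec (@Ordinal 3 0 isT)
  | Ord3_1 : ord3_spec (@Ordinal 3 1 isT)
  | Ord3_2 : ord3_spec (@Ordinal 3 2 isT).

Lemma ord3P i : ord3_spec i.
Proof.
case: i => -[|[|[|//]]] iP.
- by rewrite (_ : Ordinal iP = @Ordinal 3 0 isT); [constructor|exact: val_inj].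
- by rewrite (_ : Ordinal iP = @Ordinal 3 1 isT); [constructor|exact: val_inj].
- by rewrite (_ : Ordinal iP = @Ordinal 3 2 isT); [constructor|exact: val_inj].
Qed.

Section CubeIntegral.
Context {R : realType}.
Implicit Types (f : pt (R := R) -> R) (s : R) (i : 'I_3).

Definition cint f := Rintegral leb3 cube f.

Lemma finite_domain_cube2 :
  finite_domain (leb2 (R := R)) (`[0%R, 1%R[ `*` `[0%R, 1%R[).
Proof. by apply: finite_domain_prod; exact: finite_domain_itv. Qed.

Lemma finite_domain_cube : finite_domain (leb3 (R := R)) cube.
Proof.
by apply: finite_domain_prod; [exact: finite_domain_itv|exact: finite_domain_cube2].
Qed.

Lemma leb3_cube : fine (leb3 (cube (R := R))) = 1.
Proof.
have I1 : lebs (`[0%R, 1%R[%classic : set (measurableTypeR R)) = 1%E.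
  rewrite -[LHS]fineK; first by rewrite lebs_itv// subr0.
  by rewrite ge0_fin_numE//; case: (finite_domain_itv (0 : R) 1).
have I2 : leb2 (`[0%R, 1%R[ `*` `[0%R, 1%R[ : set (measurableTypeR R * measurableTypeR R)) = 1%E.
  by rewrite [LHS](product_measure2E lebs lebs)// I1 [X in (1 * X)%E]I1 mule1.
by rewrite [X in fine X](product_measure2E lebs leb2)// ?I1 1?[X in (1 * X)%E]I2 ?mule1//; exact: measurableX.
Qed.

Lemma cint_cst r : cint (fun=> r) = r.
Proof. by rewrite /cint Rintegral_cst ?leb3_cube ?mulr1//; exact: finite_domain_cube.1. Qed.

Lemma cintE f : bounded_meas f ->
  cint f = tint 0 1 (fun x1 => tint 0 1 (fun x2 => tint 0 1 (fun x3 => f (x1, (x2, x3))))).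
Proof.
move=> hf; rewrite /cint.
rewrite (@Rintegral_prodE _ _ _ _ _ lebs leb2 _ _ (finite_domain_itv 0 1) finite_domain_cube2)//.
apply: eq_Rintegral => x1 _.
rewrite (@Rintegral_prodE _ _ _ _ _ lebs lebs _ _ (finite_domain_itv 0 1) (finite_domain_itv 0 1)
   (fun y => f (x1, y)))//.
by apply: (bm_comp hf); exact: pair1_measurable.
Qed.

Lemma measurable_shiftx i s : measurable_fun setT (shiftx i s : pt (R := R) -> pt (R := R)).
Proof.
have m1 : measurable_fun setT (fst : pt (R := R) -> R) by exact: measurable_fst.
have m2 : measurable_fun setT (fun x : pt (R := R) => x.2.1).
  by apply: (measurableT_comp measurable_fst); exact: measurable_snd.
have m3 : measurable_fun setT (fun x : pt (R := R) => x.2.2).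
  by apply: (measurableT_comp measurable_snd); exact: measurable_snd.
have ma (g : pt (R := R) -> R) : measurable_fun setT g -> measurable_fun setT (fun x => g x + s).
  by move=> mg; apply: measurable_funD => //; exact: measurable_cst.
rewrite /shiftx; case: i => -[|[|[|//]]] _ /=.
- apply: measurable_fun_pair; first exact: ma.
  exact: measurable_snd.
- by apply: measurable_fun_pair => //; apply: measurable_fun_pair => //; exact: ma.
- by apply: measurable_fun_pair => //; apply: measurable_fun_pair => //; exact: ma.
Qed.

Definition lattice_periodic f := forall i x, f (shiftx i 1 x) = f x.

Lemma bm_shiftx f i s : bounded_meas f -> bounded_meas (fun x => f (shiftx i s x)).
Proof. by move=> hf; apply: (bm_comp hf); exact: measurable_shiftx. Qed.

Lemma shiftxD i s s' (x : pt (R := R)) : shiftx i s (shiftx i s' x) = shiftx i (s' + s) x.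
Proof. by rewrite /shiftx; case: i => -[|[|[|//]]] _ /=; rewrite addrA. Qed.

Lemma shiftx0 i (x : pt (R := R)) : shiftx i 0 x = x.
Proof. by rewrite /shiftx; case: x => x [y z]; case: i => -[|[|[|//]]] _ /=; rewrite addr0. Qed.

Lemma shiftxC i j s s' (x : pt (R := R)) :
  shiftx i s (shiftx j s' x) = shiftx j s' (shiftx i s x).
Proof.
rewrite /shiftx; case: i => -[|[|[|//]]] _ /=; case: j => -[|[|[|//]]] _ //=;
  by rewrite addrAC.
Qed.

Lemma periodic_shiftx f i s : lattice_periodic f -> lattice_periodic (fun x => f (shiftx i s x)).
Proof. by move=> pf j x; rewrite shiftxC pf. Qed.

(** By Fubini only the shifted coordinate matters, and there the claim is [tint_period] with period
    [1]. *)
Lemma cint_shiftx f i s : bounded_meas f -> lattice_periodic f ->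
  cint (fun x => f (shiftx i s x)) = cint f.
Proof.
move=> hf pf; rewrite cintE; last exact: bm_shiftx.
have hf1 x1 : bounded_meas (fun y => f (x1, y)).
  by apply: (bm_comp hf); exact: pair1_measurable.
have hf12 x1 x2 : bounded_meas (fun z => f (x1, (x2, z))).
  by apply: (bm_comp (hf1 x1)); exact: pair1_measurable.
have hfi x1 : bounded_meas (fun x2 : R => tint 0 1 (fun x3 => f (x1, (x2, x3)))).
  exact: (bm_Rintegral_section (finite_domain_itv 0 1) (hf1 x1)).
rewrite [RHS](cintE hf).
have := pf i; case: i / (ord3P i) => /=; rewrite /shiftx /= => pf0.
- pose g x1 := tint 0 1 (fun x2 => tint 0 1 (fun x3 => f (x1, (x2, x3)))).
  have bg : bounded_meas (g : R -> R).
    rewrite (_ : g = (fun x1 => Rintegral leb2 (`[0%R, 1%R[ `*` `[0%R, 1%R[)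
        (fun y => f (x1, y)))).
      exact: (bm_Rintegral_section finite_domain_cube2 hf).
    apply/funext => x1.
    exact: (esym (@Rintegral_prodE _ _ _ _ _ lebs lebs _ _ (finite_domain_itv 0 1)
      (finite_domain_itv 0 1) (fun y => f (x1, y)) (hf1 x1))).
  apply: (tint_period (g := g) s ltr01 bg) => t.
  by apply: eq_tint => x2 _ _; apply: eq_tint => x3 _ _; exact: (pf0 (t, (x2, x3))).
- apply: eq_tint => x1 _ _; apply: (tint_period s ltr01 (hfi x1)) => t.
  by apply: eq_tint => x3 _ _; exact: (pf0 (x1, (t, x3))).
- apply: eq_tint => x1 _ _; apply: eq_tint => x2 _ _.
  by apply: (tint_period s ltr01 (hf12 x1 x2)) => t; exact: (pf0 (x1, (x2, t))).
Qed.

Lemma bm_cint d (T : measurableType d) (F : T * pt (R := R) -> R) : bounded_meas F ->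
  bounded_meas (fun t => cint (fun x => F (t, x))).
Proof. by move=> hF; exact: (bm_Rintegral_section finite_domain_cube hF). Qed.

Lemma bm_tint d (T : measurableType d) a b (F : T * R -> R) : bounded_meas F ->
  bounded_meas (fun x => tint a b (fun t => F (x, t))).
Proof. by move=> hF; exact: (bm_Rintegral_section (finite_domain_itv a b) hF). Qed.

Lemma tint_cint_swap a b (F : R * pt (R := R) -> R) : bounded_meas F ->
  tint a b (fun t => cint (fun x => F (t, x))) = cint (fun x => tint a b (fun t => F (t, x))).
Proof.
move=> hF; exact: (@Rintegral_swap _ _ _ _ _ lebs leb3 _ _ (finite_domain_itv a b) finite_domain_cube).
Qed.

Lemma Rintegral_mu4 a b (F : R * pt (R := R) -> R) : bounded_meas F ->
  Rintegral mu4 (`[a, b[ `*` cube) F = tint a b (fun t => cint (fun x => F (t, x))).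
Proof.
move=> hF; exact: (@Rintegral_prodE _ _ _ _ _ lebs leb3 _ _ (finite_domain_itv a b) finite_domain_cube).
Qed.

Lemma cint_swap (F : pt (R := R) * pt (R := R) -> R) : bounded_meas F ->
  cint (fun x => cint (fun y => F (x, y))) = cint (fun y => cint (fun x => F (x, y))).
Proof.
move=> hF; exact: (@Rintegral_swap _ _ _ _ _ leb3 leb3 _ _ finite_domain_cube finite_domain_cube).
Qed.

Lemma cintD f g : bounded_meas f -> bounded_meas g ->
  cint (fun x => f x + g x) = cint f + cint g.
Proof. exact: bm_RintegralD finite_domain_cube _ _. Qed.

Lemma cintB f g : bounded_meas f -> bounded_meas g ->
  cint (fun x => f x - g x) = cint f - cint g.
Proof. exact: bm_RintegralB finite_domain_cube _ _. Qed.

Lemma cintZ r f : bounded_meas f -> cint (fun x => r * f x) = r * cint f.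
Proof. exact: bm_RintegralZ finite_domain_cube _ _. Qed.

Lemma cint_sum (I : Type) (r : seq I) (F : I -> pt (R := R) -> R) :
  (forall j, bounded_meas (F j)) ->
  cint (fun x => \sum_(j <- r) F j x) = \sum_(j <- r) cint (F j).
Proof. exact: bm_Rintegral_sum finite_domain_cube _ _ _. Qed.

Lemma le_cint_ae f g : bounded_meas f -> bounded_meas g ->
  {ae mu3, forall x, cube x -> f x <= g x} -> cint f <= cint g.
Proof. exact: (ae_le_Rintegral finite_domain_cube). Qed.

Lemma eq_cint_ae f g : bounded_meas f -> bounded_meas g ->
  {ae mu3, forall x, cube x -> f x = g x} -> cint f = cint g.
Proof. exact: (ae_eq_Rintegral finite_domain_cube). Qed.

Lemma le_cint f g : bounded_meas f -> bounded_meas g ->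
  (forall x, f x <= g x) -> cint f <= cint g.
Proof. by move=> hf hg fg; apply: le_cint_ae => //; exact: aeW. Qed.

Lemma cint_ge0 f : (forall x, 0 <= f x) -> 0 <= cint f.
Proof. by move=> f0; apply: Rintegral_ge0. Qed.

Lemma normr_cint f : bounded_meas f -> `|cint f| <= cint (fun x => `|f x|).
Proof.
by move=> hf; apply: le_normr_Rintegral;
  [exact: finite_domain_cube.1|exact: bm_integrable finite_domain_cube _ hf].
Qed.

Lemma cint_eq0_ae f : bounded_meas f -> (forall x, 0 <= f x) -> cint f = 0 ->
  {ae mu3, forall x, cube x -> f x = 0}.
Proof.
move=> hf f0 i0; have mc := finite_domain_cube.1.
have := bm_fine finite_domain_cube hf; rewrite -/(cint f) i0 => I0.
have mf : measurable_fun (cube (R := R)) (EFin \o f).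
  by apply/measurable_EFinP/measurable_funTS; have [] := hf.
have : (\int[leb3]_(x in cube) `|(EFin \o f) x| = 0)%E.
  rewrite -[RHS]I0; apply: eq_integral => x _; rewrite gee0_abs//= lee_fin; exact: f0.
by move/(ae_eq_integral_abs leb3 mc mf); apply: filterS => x + /[dup] h => /(_ h) [].
Qed.

End CubeIntegral.

Section TimeIntegralLinear.
Context {R : realType}.
Variables (a b : R).
Implicit Types f g : R -> R.

Lemma tintD f g : bounded_meas f -> bounded_meas g ->
  tint a b (fun x => f x + g x) = tint a b f + tint a b g.
Proof. exact: bm_RintegralD (finite_domain_itv a b) _ _. Qed.

Lemma tintB f g : bounded_meas f -> bounded_meas g ->
  tint a b (fun x => f x - g x) = tint a b f - tint a b g.
Proof. exact: bm_RintegralB (finite_domain_itv a b) _ _. Qed.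

Lemma tintZ r f : bounded_meas f -> tint a b (fun x => r * f x) = r * tint a b f.
Proof. exact: bm_RintegralZ (finite_domain_itv a b) _ _. Qed.

Lemma tint_sum (I : Type) (r : seq I) (F : I -> R -> R) :
  (forall j, bounded_meas (F j)) ->
  tint a b (fun x => \sum_(i <- r) F i x) = \sum_(i <- r) tint a b (F i).
Proof. exact: bm_Rintegral_sum (finite_domain_itv a b) _ _ _. Qed.

Lemma le_tint_ae f g : bounded_meas f -> bounded_meas g ->
  {ae lebs, forall t, a <= t < b -> f t <= g t} -> tint a b f <= tint a b g.
Proof.
move=> hf hg h; apply: (ae_le_Rintegral (finite_domain_itv a b)) => //.
Qed.

Lemma eq_tint_ae f g : bounded_meas f -> bounded_meas g ->
  {ae lebs, forall t, a <= t < b -> f t = g t} -> tint a b f = tint a b g.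
Proof.
move=> hf hg h; apply: (ae_eq_Rintegral (finite_domain_itv a b)) => //.
Qed.

Lemma le_tint f g : bounded_meas f -> bounded_meas g ->
  (forall t, a <= t < b -> f t <= g t) -> tint a b f <= tint a b g.
Proof. by move=> hf hg fg; apply: le_tint_ae => //; exact: aeW. Qed.

Lemma tint_ge0 f : (forall t, 0 <= f t) -> 0 <= tint a b f.
Proof. by move=> f0; apply: Rintegral_ge0. Qed.

Lemma tint_sqr f : a <= b -> bounded_meas f ->
  tint a b f ^+ 2 <= (b - a) * tint a b (fun x => f x ^+ 2).
Proof.
by move=> ab hf; have := bm_Rintegral_sqr (finite_domain_itv a b) hf; rewrite lebs_itv.
Qed.

Lemma tint_bound f C : a <= b -> bounded_meas f -> (forall t, a <= t < b -> `|f t| <= C) ->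
  `|tint a b f| <= C * (b - a).
Proof.
move=> ab hf fC; rewrite -lebs_itv//.
by apply: (bm_Rintegral_le (finite_domain_itv a b) hf) => t; rewrite /= in_itv/=; exact: fC.
Qed.

End TimeIntegralLinear.

Section AlmostEverywhere.
Context {R : realType}.

Lemma ae_lebS (P Q : R -> Prop) : (forall t, P t -> Q t) ->
  {ae lebs, forall t, P t} -> {ae lebs, forall t, Q t}.
Proof. exact: (@filterS _ _ (ae_filter_ringOfSetsType lebs)). Qed.

Lemma ae_lebI (P Q : R -> Prop) : {ae lebs, forall t, P t} -> {ae lebs, forall t, Q t} ->
  {ae lebs, forall t, P t /\ Q t}.
Proof. exact: (@filterI _ _ (ae_filter_ringOfSetsType lebs)). Qed.

Lemma ae_leb_all (I : finType) (P : I -> R -> Prop) :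
  (forall i, {ae lebs, forall t, P i t}) -> {ae lebs, forall t, forall i, P i t}.
Proof.
move=> h; have H : {ae lebs, forall t, forall i, i \in enum I -> P i t}.
  elim: (enum I) => [|j s IH]; first exact: aeW.
  apply: ae_lebS (ae_lebI (h j) IH) => t [hj hs] i; rewrite inE => /orP[/eqP->//|].
  exact: hs.
by apply: ae_lebS H => t H i; apply: H; rewrite mem_enum.
Qed.

Lemma ae_mu3S (P Q : pt (R := R) -> Prop) : (forall x, P x -> Q x) ->
  {ae mu3, forall x, P x} -> {ae mu3, forall x, Q x}.
Proof. exact: (@filterS _ _ (ae_filter_ringOfSetsType mu3)). Qed.

Lemma ae_mu3I (P Q : pt (R := R) -> Prop) :
  {ae mu3, forall x, P x} -> {ae mu3, forall x, Q x} ->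
  {ae mu3, forall x, P x /\ Q x}.
Proof. exact: (@filterI _ _ (ae_filter_ringOfSetsType mu3)). Qed.

Lemma ae_mu3_all (I : finType) (P : I -> pt (R := R) -> Prop) :
  (forall i, {ae mu3, forall x, P i x}) -> {ae mu3, forall x, forall i, P i x}.
Proof.
move=> h; have H : {ae mu3, forall x, forall i, i \in enum I -> P i x}.
  elim: (enum I) => [|j s IH]; first exact: aeW.
  apply: ae_mu3S (ae_mu3I (h j) IH) => x [hj hs] i; rewrite inE => /orP[/eqP->//|].
  exact: hs.
by apply: ae_mu3S H => x H i; apply: H; rewrite mem_enum.
Qed.

End AlmostEverywhere.

(** * Transport and observability *)

Lemma bm_sqrB d (T : measurableType d) (R : realType) (f g : T -> R) :
  bounded_meas f -> bounded_meas g -> bounded_meas (fun x => (f x - g x) ^+ 2).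
Proof. by move=> hf hg; apply/bmX/bmB. Qed.

Section Flow.
Context {R : realType}.
Implicit Types (f g h : pt (R := R) -> R) (a b : 'I_3 * bool) (s : R).

(* The index [(i, true)] carries the speed [+c] along the axis [i], [(i, false)] the speed [-c]. *)
Definition flow a s : pt -> pt := shiftx a.1 (if a.2 then s else - s).

Lemma measurable_shiftx_comp d (T : measurableType d) (i : 'I_3) (u : T -> R)
    (v : T -> pt (R := R)) : measurable_fun setT u -> measurable_fun setT v ->
  measurable_fun setT (fun z => shiftx i (u z) (v z) : pt (R := R)).
Proof.
move=> mu mv.
have m1 : measurable_fun setT (fun z => (v z).1) by exact: measurableT_comp.
have m2' : measurable_fun setT (fun z => (v z).2) by exact: measurableT_comp.
have m2 : measurable_fun setT (fun z => (v z).2.1) by exact: measurableT_comp.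
have m3 : measurable_fun setT (fun z => (v z).2.2) by exact: measurableT_comp.
have ma (g : T -> R) : measurable_fun setT g ->
    measurable_fun setT ((fun z => g z + u z) : T -> R).
  by move=> mg; apply: measurable_funD.
rewrite /shiftx; case: i => -[|[|[|//]]] _ /=.
- by apply: measurable_fun_pair => //; exact: ma.
- by apply: measurable_fun_pair => //; apply: measurable_fun_pair => //; exact: ma.
- by apply: measurable_fun_pair => //; apply: measurable_fun_pair => //; exact: ma.
Qed.

Lemma measurable_flow_comp d (T : measurableType d) a (u : T -> R)
    (v : T -> pt (R := R)) : measurable_fun setT u -> measurable_fun setT v ->
  measurable_fun setT (fun z => flow a (u z) (v z) : pt (R := R)).
Proof.
move=> mu mv; apply: measurable_shiftx_comp => //; case: a.2 => //.
exact: measurableT_comp.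
Qed.

Lemma flowD a s s' (x : pt (R := R)) : flow a s (flow a s' x) = flow a (s' + s) x.
Proof. by rewrite /flow shiftxD; congr shiftx; case: a.2 => //; rewrite opprD. Qed.

Lemma flow0 a (x : pt (R := R)) : flow a 0 x = x.
Proof. by rewrite /flow oppr0 if_same shiftx0. Qed.

Lemma flowK a s (x : pt (R := R)) : flow a (- s) (flow a s x) = x.
Proof. by rewrite flowD subrr flow0. Qed.

Lemma periodic_flow f a s : lattice_periodic f -> lattice_periodic (fun x => f (flow a s x)).
Proof. exact: periodic_shiftx. Qed.

Lemma bm_flow f a s : bounded_meas f -> bounded_meas (fun x => f (flow a s x)).
Proof. exact: bm_shiftx. Qed.

Lemma cint_flow f a s : bounded_meas f -> lattice_periodic f ->
  cint (fun x => f (flow a s x)) = cint f.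
Proof. exact: cint_shiftx. Qed.

Lemma flow_period f a x : lattice_periodic f -> f (flow a 1 x) = f x.
Proof.
move=> pf; rewrite /flow; case: a.2; first exact: pf.
by rewrite -[LHS](pf a.1) shiftxD addNr shiftx0.
Qed.

Definition dist2 f g := cint (fun x => (f x - g x) ^+ 2).

Lemma dist2C f g : dist2 f g = dist2 g f.
Proof. by apply: eq_Rintegral => x _; ring. Qed.

Lemma dist2_tri f g h : bounded_meas f -> bounded_meas g -> bounded_meas h ->
  dist2 f h <= 2 * (dist2 f g + dist2 g h).
Proof.
move=> hf hg hh; rewrite /dist2 -(cintD (bm_sqrB hf hg) (bm_sqrB hg hh)).
rewrite -(cintZ 2 (bmD (bm_sqrB hf hg) (bm_sqrB hg hh))).
apply: le_cint; first exact: bm_sqrB.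
  by apply: bmM; [exact: bm_cst|apply: bmD; exact: bm_sqrB].
by move=> x; have := sqr_ge0 (f x - g x - (g x - h x)); lra.
Qed.

Lemma dist2_tri3 f g h k : bounded_meas f -> bounded_meas g -> bounded_meas h ->
  bounded_meas k -> dist2 f k <= 3 * (dist2 f g + dist2 g h + dist2 h k).
Proof.
move=> hf hg hh hk.
have hfg := bm_sqrB hf hg; have hgh := bm_sqrB hg hh; have hhk := bm_sqrB hh hk.
have hs := bmD (bmD hfg hgh) hhk.
rewrite /dist2 -(cintD hfg hgh) -(cintD (bmD hfg hgh) hhk) -(cintZ 3 hs).
apply: le_cint; first exact: bm_sqrB.
  exact: (bmM (bm_cst _) hs).
move=> x; have := sqr_ge0 (f x - g x - (g x - h x)).
have := sqr_ge0 (f x - g x - (h x - k x)); have := sqr_ge0 (g x - h x - (h x - k x)).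
lra.
Qed.

Lemma dist2_tri4 f g h k l : bounded_meas f -> bounded_meas g -> bounded_meas h ->
  bounded_meas k -> bounded_meas l ->
  dist2 f l <= 4 * (dist2 f g + dist2 g h + dist2 h k + dist2 k l).
Proof.
move=> hf hg hh hk hl; have := dist2_tri hf hh hl; have := dist2_tri hf hg hh.
have := dist2_tri hh hk hl; lra.
Qed.

Lemma dist2_flow f g a s : bounded_meas f -> bounded_meas g -> lattice_periodic f -> lattice_periodic g ->
  dist2 (fun x => f (flow a s x)) (fun x => g (flow a s x)) = dist2 f g.
Proof.
move=> hf hg pf pg; apply: (cint_flow a s (bm_sqrB hf hg)) => i x.
by rewrite pf pg.
Qed.

Lemma bm_dist2 (F G : R * pt (R := R) -> R) : bounded_meas F -> bounded_meas G ->
  bounded_meas ((fun s => dist2 (fun x => F (s, x)) (fun x => G (s, x))) : R -> R).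
Proof.
by move=> hF hG; exact: (bm_cint (bm_sqrB hF hG)).
Qed.

End Flow.

(** * Observability: from small defects over one window to near constancy in space *)

Section Observability.
Context {R : realType}.
Variables (c eta : R) (Q : 'I_3 * bool -> pt (R := R) -> R).
Hypotheses (c0 : 0 < c) (bQ : forall a, bounded_meas (Q a)) (pQ : forall a, lattice_periodic (Q a)).
Let L := (2 * c)^-1.
(** Each [Q a], transported freely with its own velocity, stays close in the time mean to every
    other [Q b] transported with its own. In the application [Q a] is the square of a density at the
    start of the window. *)
Hypothesis obs : forall a b, tint 0 L (fun s => dist2 (fun x => Q a (flow a (- (c * s)) x))
   (fun x => Q b (flow b (- (c * s)) x))) <= eta.

Let L0 : 0 < L. Proof. by rewrite invr_gt0 mulr_gt0. Qed.

Let bQflow a b (u : R -> R) : measurable_fun setT (u : R -> R) ->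
  bounded_meas (fun z : R * pt (R := R) => Q a (flow b (u z.1) z.2)).
Proof.
move=> mu; apply: (bm_comp (bQ a)); apply: measurable_flow_comp => //.
exact: measurableT_comp.
Qed.

Let mcs : measurable_fun setT ((fun s => - (c * s)) : R -> R).
Proof. by apply: measurableT_comp => //; apply: measurable_funM => //; exact: measurable_cst. Qed.

Let m2cs : measurable_fun setT ((fun s => 2 * c * s) : R -> R).
Proof. by apply: measurable_funM => //; exact: measurable_cst. Qed.

Let tint_L r : tint 0 L (fun=> r) = L * r.
Proof. by rewrite tint_cst ?ltW// subr0 mulrC. Qed.

(* A pair of opposite directions along one axis gives the invariance along that axis, because
   the relative displacement covers exactly one period when [s] runs over [[0, L)]. *)
Lemma obs_invariant_axis a h : L * dist2 (fun x => Q a (flow a h x)) (Q a) <= 4 * eta.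
Proof.
pose b := (a.1, ~~ a.2).
have flowb s x : flow b s x = flow a (- s) x.
  by rewrite /flow /b/=; case: a.2; rewrite ?opprK.
(* In the frame moving with [a], [Q a] is at rest and [Q b], which moves the opposite way, is
   displaced by [2 c s]. *)
pose D s := dist2 (Q a) (fun x => Q b (flow a (2 * c * s) x)).
have bD : bounded_meas (D : R -> R).
  apply: (bm_dist2 (F := fun z => Q a z.2) (G := fun z => Q b (flow a (2 * c * z.1) z.2))).
    by apply: (bm_comp (bQ a)); exact: measurable_snd.
  exact: (bQflow b a m2cs).
have DE s : dist2 (fun x => Q a (flow a (- (c * s)) x)) (fun x => Q b (flow b (- (c * s)) x)) = D s.
  rewrite -(dist2_flow (f := fun x => Q a (flow a (- (c * s)) x)) a (c * s));
    [|exact: bm_flow|exact: bm_flow|exact: periodic_flow|exact: periodic_flow].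
  apply: eq_Rintegral => x _; rewrite flowK flowb opprK flowD.
  by rewrite (_ : c * s + c * s = 2 * c * s)//; ring.
have Dint : tint 0 L D <= eta.
  by apply: le_trans (obs a b); rewrite le_eqVlt; apply/orP; left; apply/eqP;
    apply: eq_tint => s _ _; rewrite DE.
(* Since [2 c L = 1], a delay of [L] adds a full lattice period to the displacement. *)
have Dper s : D (s + L) = D s.
  apply: eq_Rintegral => x _; rewrite (_ : 2 * c * (s + L) = 2 * c * s + 1).
    by rewrite -flowD flow_period.
  by rewrite /L; field; rewrite gt_eqF.
(* The delay [s0] adds [h] to the displacement, so that [Q a] and its translate by [h] are both
   compared with the same translate of [Q b]. *)
pose s0 := h / (2 * c).
have key s : dist2 (fun x => Q a (flow a h x)) (Q a) <= 2 * (D s + D (s + s0)).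
  have -> : D s = dist2 (fun x => Q a (flow a h x)) (fun x => Q b (flow a (2 * c * (s + s0)) x)).
    rewrite /D -(dist2_flow (f := Q a) a h);
      [|exact: bQ|exact: bm_flow|exact: pQ|exact: periodic_flow].
    apply: eq_Rintegral => x _; rewrite flowD (_ : h + 2 * c * s = 2 * c * (s + s0))//.
    by rewrite /s0; field; rewrite gt_eqF.
  rewrite [D (s + s0)]dist2C; apply: dist2_tri => //; exact: bm_flow.
have bDs : bounded_meas ((fun s => D (s + s0)) : R -> R).
  by apply: (bm_comp bD); exact: measurable_shiftr.
rewrite -tint_L; apply: (le_trans (y := tint 0 L (fun s => 2 * (D s + D (s + s0))))).
  apply: le_tint; [exact: bm_cst| |by move=> s _; exact: key].
  by apply: bmM; [exact: bm_cst|exact: bmD].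
rewrite tintZ; last exact: bmD.
rewrite tintD// (tint_period s0 L0 bD Dper)//; lra.
Qed.

(** [Q a] is compared with its own transport at time [s], then with that of [Q b], then with [Q b].
    The two outer steps are translations along the own axis and cost [4 * eta] each, the middle one
    costs [eta] after integration in [s]; the factor [3] of [dist2_tri3] gives
    [3 * (4 + 1 + 4) = 27]. *)
Lemma obs_close a b : L * dist2 (Q a) (Q b) <= 27 * eta.
Proof.
pose E s := dist2 (fun x => Q a (flow a (- (c * s)) x)) (fun x => Q b (flow b (- (c * s)) x)).
have bE : bounded_meas (E : R -> R).
  apply: (bm_dist2 (F := fun z => Q a (flow a (- (c * z.1)) z.2))
                   (G := fun z => Q b (flow b (- (c * z.1)) z.2)));
    [exact: (bQflow a a mcs)|exact: (bQflow b b mcs)].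
have key s : L * dist2 (Q a) (Q b) <= 24 * eta + 3 * L * E s.
  have := obs_invariant_axis a (- (c * s)); have := obs_invariant_axis b (- (c * s)).
  have := dist2_tri3 (bQ a) (bm_flow a (- (c * s)) (bQ a)) (bm_flow b (- (c * s)) (bQ b)) (bQ b).
  rewrite -/(E s) (dist2C (Q a) (fun x => Q a (flow a (- (c * s)) x))) => /(ler_wpM2l (ltW L0)).
  lra.
have : L * (L * dist2 (Q a) (Q b)) <= L * (24 * eta) + 3 * L * tint 0 L E.
  rewrite -[X in X <= _]tint_L -[X in _ <= X + _]tint_L -tintZ// -tintD; last 2 first.
    exact: bm_cst.
    by apply: bmM => //; exact: bm_cst.
  apply: le_tint => //; first exact: bm_cst.
  by apply: bmD; [exact: bm_cst|apply: bmM => //; exact: bm_cst].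
have := obs a b; rewrite -/E => /(ler_wpM2l (ltW L0)) h1 h2.
rewrite -(ler_pM2l L0); lra.
Qed.

(** Invariance along a foreign axis is borrowed from the density [b] that moves along it:
    [3 * (27 + 4 + 27) = 174]. *)
Lemma obs_invariant a i h : L * dist2 (fun x => Q a (shiftx i h x)) (Q a) <= 174 * eta.
Proof.
pose b := (i, true).
have := dist2_tri3 (bm_shiftx i h (bQ a)) (bm_shiftx i h (bQ b)) (bQ b) (bQ a).
have hab : dist2 (fun x => Q a (shiftx i h x)) (fun x => Q b (shiftx i h x)) = dist2 (Q a) (Q b).
  exact: (dist2_flow b h (bQ a) (bQ b) (pQ a) (pQ b)).
rewrite hab.
have := obs_close a b; have := obs_close b a; have := obs_invariant_axis b h.
rewrite /flow/= => h1 h2 h3 /(ler_wpM2l (ltW L0)); lra.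
Qed.

Let dist2_shift2 a i h j s :
  dist2 (fun x => Q a (shiftx j s (shiftx i h x))) (fun x => Q a (shiftx j s x)) =
  dist2 (fun x => Q a (shiftx i h x)) (Q a).
Proof.
rewrite -(dist2_flow (j, true) s (bm_shiftx i h (bQ a)) (bQ a)
  (periodic_shiftx i h (pQ a)) (pQ a)).
congr dist2; apply/funext => x; congr (Q a _).
exact: shiftxC.
Qed.

(** The double mean over [y] and [z] is a mean over displacements [h] of the distance between [Q b]
    and the translate of [Q a] by [h]. Undoing the three coordinates of [h] one by one and then
    passing from [Q a] to [Q b] costs [4 * (3 * 174 + 27) = 2196]. *)
Theorem observability a b :
  L * cint (fun y => cint (fun z => (Q a z - Q b y) ^+ 2)) <= 2196 * eta.
Proof.
pose i0 : 'I_3 := @Ordinal 3 0 isT.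
pose i1 : 'I_3 := @Ordinal 3 1 isT.
pose i2 : 'I_3 := @Ordinal 3 2 isT.
(* Translation by the vector [h]; its symmetry allows it to be read as translating [h] by [y] as
   well. *)
pose S (h y : pt (R := R)) := shiftx i0 h.1 (shiftx i1 h.2.1 (shiftx i2 h.2.2 y)).
have SC h y : S h y = S y h.
  by case: h => h1 [h2 h3]; case: y => y1 [y2 y3]; rewrite /S /shiftx/=;
    rewrite [h1 + _]addrC [h2 + _]addrC [h3 + _]addrC.
have key h : L * dist2 (fun x => Q a (S h x)) (Q b) <= 2196 * eta.
  have b2 := bm_shiftx i0 h.1 (bQ a).
  have b3 := bm_shiftx i1 h.2.1 b2.
  have b4 := bm_shiftx i2 h.2.2 b3.
  have p2 := periodic_shiftx i0 h.1 (pQ a).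
  have := dist2_tri4 b4 b3 b2 (bQ a) (bQ b).
  have e1 := dist2_shift2 a i1 h.2.1 i0 h.1.
  have e2 : dist2 (fun x => Q a (shiftx i0 h.1 (shiftx i1 h.2.1 (shiftx i2 h.2.2 x))))
      (fun x => Q a (shiftx i0 h.1 (shiftx i1 h.2.1 x))) =
      dist2 (fun x => Q a (shiftx i2 h.2.2 x)) (Q a).
    rewrite -(dist2_shift2 a i2 h.2.2 i1 h.2.1).
    rewrite -(dist2_flow (i0, true) h.1 (bm_shiftx i2 h.2.2 (bm_shiftx i1 h.2.1 (bQ a)))
      (bm_shiftx i1 h.2.1 (bQ a)) (periodic_shiftx i2 h.2.2 (periodic_shiftx i1 h.2.1 (pQ a)))
      (periodic_shiftx i1 h.2.1 (pQ a))).
    have e x : shiftx i0 h.1 (shiftx i1 h.2.1 (shiftx i2 h.2.2 x)) =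
        shiftx i1 h.2.1 (shiftx i2 h.2.2 (shiftx i0 h.1 x)).
      by rewrite (shiftxC i0 i1) (shiftxC i0 i2).
    congr dist2; apply/funext => x; congr (Q a _).
  rewrite e1 e2.
  have := obs_invariant a i0 h.1; have := obs_invariant a i1 h.2.1.
  have := obs_invariant a i2 h.2.2; have := obs_close a b.
  move=> ? ? ? ? /(ler_wpM2l (ltW L0)); rewrite /S; lra.
have mS : measurable_fun setT (fun z : pt (R := R) * pt (R := R) => S z.1 z.2 : pt (R := R)).
  by do 3!(apply: measurable_shiftx_comp; first by do ?apply: measurableT_comp).
have bQS : bounded_meas (fun z : pt (R := R) * pt (R := R) => (Q a (S z.1 z.2) - Q b z.2) ^+ 2).
  apply: bm_sqrB; first exact: (bm_comp (bQ a)).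
  by apply: (bm_comp (bQ b)); exact: measurable_snd.
(* For fixed [y], periodicity permits the substitution [z = S h y], which turns the mean over [z]
   into a mean over [h]. *)
rewrite (_ : cint _ = cint (fun h => dist2 (fun x => Q a (S h x)) (Q b))); last first.
  rewrite /dist2 (cint_swap bQS); apply: eq_Rintegral => y _.
  pose f z := (Q a z - Q b y) ^+ 2.
  have bf : bounded_meas f by apply: bm_sqrB => //; exact: bm_cst.
  have pf : lattice_periodic f by move=> i x; rewrite /f pQ.
  rewrite -[cint _]/(cint f).
  rewrite -(cint_shiftx i0 y.1 bf pf).
  have b1 := bm_shiftx i0 y.1 bf; have p1 := periodic_shiftx i0 y.1 pf.
  rewrite -(cint_shiftx i1 y.2.1 b1 p1).
  have b2 := bm_shiftx i1 y.2.1 b1; have p2 := periodic_shiftx i1 y.2.1 p1.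
  rewrite -(cint_shiftx i2 y.2.2 b2 p2).
  by apply: eq_Rintegral => h _; rewrite SC.
rewrite -(cintZ L); last exact: (bm_cint bQS).
rewrite -[X in _ <= X]cint_cst; apply: le_cint.
- by apply: bmM; [exact: bm_cst|exact: (bm_cint bQS)].
- exact: bm_cst.
- by move=> h; exact: key.
Qed.

End Observability.

(** * Chain rule along characteristics *)

(** Applied to both halves of an interval, the quadratic bound improves by a factor [2], so [n]
    bisections leave [K (t - s) ^ 2 / 2 ^ n]. This takes the place of a vanishing derivative for
    functions that need not be differentiable. *)
Lemma quadratic_increment_cst {R : realType} (T K : R) (H : R -> R) :
  (forall s t : R, 0 <= s -> s <= t -> t <= T -> `|H t - H s| <= K * (t - s) ^+ 2) ->
  forall s t : R, 0 <= s -> s <= t -> t <= T -> H t = H s.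
Proof.
move=> hH s t s0 st tT.
have key n : forall s t : R, 0 <= s -> s <= t -> t <= T ->
    `|H t - H s| <= K * (t - s) ^+ 2 / 2 ^+ n.
  elim: n => [|n IH] {s0 st tT}s {}t s0 st tT; first by rewrite expr0 divr1; exact: hH.
  pose u := (s + t) / 2.
  have h1 : `|H u - H s| <= K * (u - s) ^+ 2 / 2 ^+ n by apply: IH; rewrite /u; lra.
  have h2 : `|H t - H u| <= K * (t - u) ^+ 2 / 2 ^+ n by apply: IH; rewrite /u; lra.
  rewrite (_ : H t - H s = (H t - H u) + (H u - H s)); last by ring.
  apply: (le_trans (ler_normD _ _)); apply: (le_trans (lerD h2 h1)).
  rewrite le_eqVlt; apply/orP; left; apply/eqP; rewrite /u (exprS 2 n).
  have : 2 ^+ n != 0 :> R by rewrite expf_neq0.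
  by move: (2 ^+ n) => z z0; field.
apply/eqP; rewrite -subr_eq0 -normr_le0; apply/ler_addgt0Pl => e e0; rewrite addr0.
set C := K * (t - s) ^+ 2 in key.
have C0 : 0 <= C by have := key 0%N s t s0 st tT; rewrite expr0 divr1 -/C; exact: le_trans.
have [n Cn] : exists n : nat, C / e < n%:R.
  by exists (Num.Def.archi_bound (C / e)); apply: archi_boundP; rewrite divr_ge0// ltW.
have := key n s t s0 st tT; rewrite -/C => /le_trans; apply.
rewrite ler_pdivrMr ?exprn_gt0//; move: Cn; rewrite ltr_pdivrMr// => Cn.
apply: (le_trans (ltW Cn)); rewrite mulrC ler_pM2l// -natrX ler_nat.
exact/ltnW/ltn_expl.
Qed.

Section ChainRule.
Context {R : realType}.
Variables (T : R) (f g Phi phi : R -> R) (B : R).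
Hypotheses (bf : bounded_meas f) (bg : bounded_meas g).
Hypothesis fE : forall s t : R, 0 <= s -> s <= t -> t <= T -> f t - f s = tint s t g.
Hypothesis Phi2 : forall x y, `|Phi y - Phi x - phi x * (y - x)| <= B * (y - x) ^+ 2.
Hypothesis phi1 : forall x y, `|phi y - phi x| <= B * `|y - x|.

Lemma lipschitz_continuous : continuous phi.
Proof.
have B0 : 0 <= B by have := phi1 0 1; rewrite subr0 normr1 mulr1; exact: le_trans.
move=> x; apply/(@cvgrPdist_le _ R^o) => e e0.
near=> y; apply: (le_trans (phi1 y x)).
apply: (le_trans (y := (B + 1) * `|x - y|)); first by rewrite ler_wpM2r// lerDl.
rewrite mulrC -ler_pdivlMr ?ltr_wpDl//; near: y.
by apply: (@cvgr_dist_le _ R^o) => //; rewrite divr_gt0// ltr_wpDl.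
Unshelve. all: by end_near. Qed.

Lemma bm_phi d (S : measurableType d) (h : S -> R) :
  bounded_meas h -> bounded_meas (fun x => phi (h x)).
Proof. by apply: bm_comp_continuous; exact: lipschitz_continuous. Qed.

(** [f] is a primitive of a function that is only bounded and measurable, so it may fail to be
    differentiable at a given time. Instead, the difference of the two sides has quadratically small
    increments: a Taylor remainder of [Phi], plus the error of freezing [phi (f r)] at the left
    end. *)
Lemma chain_rule s t : 0 <= s -> s <= t -> t <= T ->
  Phi (f t) - Phi (f s) = tint s t (fun r => phi (f r) * g r).
Proof.
have [mg [C gC]] := bg.
have bpg : bounded_meas (fun r => phi (f r) * g r) by apply: bmM => //; exact: bm_phi.
have B0 : 0 <= B by have := phi1 0 1; rewrite subr0 normr1 mulr1; exact: le_trans.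
have C0 : 0 <= C by exact: le_trans (gC 0).
have f_lip u v : 0 <= u -> u <= v -> v <= T -> `|f v - f u| <= C * (v - u).
  by move=> u0 uv vT; rewrite fE//; apply: tint_bound => // r _; exact: gC.
pose H t := Phi (f t) - tint 0 t (fun r => phi (f r) * g r).
have Hq u v : 0 <= u -> u <= v -> v <= T -> `|H v - H u| <= (2 * B * C ^+ 2) * (v - u) ^+ 2.
  move=> u0 uv vT; rewrite /H (tint_split bpg u0 uv).
  set I := tint u v _.
  have -> : Phi (f v) - (tint 0 u (fun r => phi (f r) * g r) + I) -
      (Phi (f u) - tint 0 u (fun r => phi (f r) * g r)) =
      (Phi (f v) - Phi (f u) - phi (f u) * (f v - f u)) - (I - phi (f u) * (f v - f u)) by ring.
  have h1 : `|Phi (f v) - Phi (f u) - phi (f u) * (f v - f u)| <= B * C ^+ 2 * (v - u) ^+ 2.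
    apply: (le_trans (Phi2 _ _)); rewrite -mulrA ler_wpM2l// -exprMn.
    rewrite -[leLHS]real_normK ?num_real// lerXn2r// ?nnegrE//; last exact: f_lip.
    by rewrite mulr_ge0// subr_ge0.
  have h2 : `|I - phi (f u) * (f v - f u)| <= B * C ^+ 2 * (v - u) ^+ 2.
    rewrite fE// -tintZ// -tintB//; last by apply: bmM => //; exact: bm_cst.
    have -> : B * C ^+ 2 * (v - u) ^+ 2 = B * C ^+ 2 * (v - u) * (v - u) by ring.
    apply: tint_bound => //.
      by apply: bmB => //; apply: bmM => //; exact: bm_cst.
    move=> r /andP[ur rv]; rewrite -mulrBl normrM.
    have -> : B * C ^+ 2 * (v - u) = B * (C * (v - u)) * C by ring.
    apply: ler_pM => //; apply: (le_trans (phi1 _ _)); rewrite ler_wpM2l//.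
    apply: (le_trans (f_lip u r u0 ur (le_trans (ltW rv) vT))).
    by rewrite ler_wpM2l// lerB// ltW.
  by apply: (le_trans (ler_normB _ _)); apply: (le_trans (lerD h1 h2)); lra.
move=> s0 st tT; have := quadratic_increment_cst Hq s0 st tT.
by rewrite /H (tint_split bpg s0 st); lra.
Qed.

End ChainRule.

Section Entropies.
Context {R : realType}.
Implicit Types x y m M : R.

Lemma pos_sq_taylor x y :
  `|Num.max 0 y ^+ 2 - Num.max 0 x ^+ 2 - 2 * Num.max 0 x * (y - x)| <= (y - x) ^+ 2.
Proof.
have hx := sqr_ge0 x; have hy := sqr_ge0 y; have hxy := sqr_ge0 (y - x).
have [x0|x0] := leP 0 x; have [y0|y0] := leP 0 y; rewrite ler_norml.
- by apply/andP; split; lra.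
- by have : 0 <= x * - y by [rewrite mulr_ge0// oppr_ge0 ltW]; move=> ?; apply/andP; split; lra.
- by have : 0 <= - x * y by [rewrite mulr_ge0// oppr_ge0 ltW]; move=> ?; apply/andP; split; lra.
- by rewrite expr0n/=; apply/andP; split; lra.
Qed.

Lemma pos_lip x y : `|Num.max 0 y - Num.max 0 x| <= `|y - x|.
Proof.
have h1 := ler_norm (y - x); have h2 := ler_norm (x - y); rewrite distrC in h2.
by have [x0|x0] := leP 0 x; have [y0|y0] := leP 0 y; rewrite ler_norml; apply/andP; split; lra.
Qed.

End Entropies.

(** * Algebra of the relaxation term over the six directions *)

Section DirectionSums.
Context {R : realType}.
Local Notation dir := ('I_3 * bool)%type.
Implicit Types x : dir -> R.

Lemma sum_dirE x : \sum_a x a =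
  \sum_(i < 3) (x (i, true) + x (i, false)).
Proof.
rewrite (eq_bigr (fun a => x (a.1, a.2))); last by case.
rewrite -(pair_bigA _ (fun i e => x (i, e))) /=; apply: eq_bigr => i _.
by rewrite big_bool.
Qed.

Lemma sum_dir_cst (r : R) : \sum_(a : dir) r = 6 * r.
Proof. by rewrite sum_dirE !big_ord_recr big_ord0 /=; ring. Qed.

Lemma sum_dirZ r x : \sum_a (r * x a) = r * \sum_a x a.
Proof. by rewrite mulr_sumr. Qed.

(** The relaxation term of [a] is the sum over [b] of [x b - x a]; averaging the double sum with its
    copy in which [a] and [b] are exchanged gives the symmetric form. *)
Lemma relaxation_dissipation x phi :
  \sum_a phi a * (\sum_b x b - 6 * x a) =
  - 2^-1 * \sum_a \sum_b (phi a - phi b) * (x a - x b).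
Proof.
have -> : \sum_a \sum_b (phi a - phi b) * (x a - x b) =
   12 * \sum_a (phi a * x a) - 2 * (\sum_a phi a * \sum_b x b).
  rewrite (eq_bigr (fun a => 6 * (phi a * x a) - phi a * (\sum_b x b) - x a * (\sum_b phi b)
    + \sum_b phi b * x b)).
    rewrite big_split/= sum_dir_cst !sumrB sum_dirZ -!mulr_suml; ring.
  move=> a _.
  rewrite (eq_bigr (fun b => phi a * x a - phi a * x b - x a * phi b + phi b * x b)).
    by rewrite big_split/= !sumrB sum_dir_cst !sum_dirZ.
  by move=> b _; ring.
rewrite (eq_bigr (fun a => phi a * (\sum_b x b) - 6 * (phi a * x a))).
  by rewrite sumrB sum_dirZ -mulr_suml; field.
by move=> a _; ring.
Qed.

Lemma relaxation_energy x m :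
  \sum_a 2 * (x a - m) * (\sum_b x b - 6 * x a) = - \sum_a \sum_b (x a - x b) ^+ 2.
Proof.
rewrite (relaxation_dissipation x (fun a => 2 * (x a - m))).
rewrite (eq_bigr (fun a => 2 * \sum_b (x a - x b) ^+ 2)).
  by rewrite sum_dirZ; field.
by move=> a _; rewrite -sum_dirZ; apply: eq_bigr => b _; ring.
Qed.

Lemma relaxation_mass x : \sum_a (\sum_b x b - 6 * x a) = 0.
Proof. by rewrite sumrB sum_dir_cst sum_dirZ subrr. Qed.

(** After symmetrisation the two differences in each term have the same sign. The single summands on
    the left have no sign of their own. *)
Lemma relaxation_monotone x (phi : R -> R) : {homo phi : y z / y <= z} ->
  \sum_a phi (x a) * (\sum_b x b - 6 * x a) <= 0.
Proof.
move=> hphi; rewrite relaxation_dissipation mulNr oppr_le0 mulr_ge0//.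
apply: sumr_ge0 => a _; apply: sumr_ge0 => b _.
have [ab|/ltW ab] := leP (x a) (x b).
  by rewrite -mulrNN !opprB mulr_ge0// subr_ge0// hphi.
by rewrite mulr_ge0// subr_ge0// hphi.
Qed.

Lemma sum_dir_sqr x : (\sum_a x a) ^+ 2 <= 6 * \sum_a x a ^+ 2.
Proof.
have : 0 <= \sum_a (x a - 6^-1 * \sum_b x b) ^+ 2.
  by apply: sumr_ge0 => a _; exact: sqr_ge0.
rewrite (eq_bigr (fun a => x a ^+ 2 - (3^-1 * \sum_b x b) * x a + (6^-1 * \sum_b x b) ^+ 2)).
  rewrite big_split/= sumrB sum_dirZ sum_dir_cst.
  by set S := \sum_a x a; set Q := \sum_a _; lra.
by move=> a _; field.
Qed.

Lemma le_sum_dir x a : (forall b, 0 <= x b) -> x a <= \sum_b x b.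
Proof. by move=> x0; rewrite (bigD1 a)//= lerDl sumr_ge0. Qed.

Lemma le_sum_dir2 x a b : a != b -> (forall b, 0 <= x b) -> x a + x b <= \sum_b x b.
Proof.
move=> ab x0; rewrite (bigD1 a)//= lerD2l (bigD1 b)/=; last by rewrite eq_sym.
by rewrite lerDl sumr_ge0.
Qed.

End DirectionSums.

(** * Mild solutions and entropy balance *)

Section MildSolution.
Context {R : realType}.
Local Notation dir := ('I_3 * bool)%type.
Variables (c T : R) (w0 : dir -> pt (R := R) -> R) (w : dir -> R * pt (R := R) -> R)
  (ka : R * pt (R := R) -> R).

Definition source a (z : R * pt (R := R)) : R := ka z * (\sum_b w b z - 6 * w a z).

(** Here [z.2] is the foot of a characteristic at time [0], not a position at time [z.1]; in this
    variable transport disappears and only the source remains to be integrated in time. *)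
Definition char_source a (z : R * pt (R := R)) : R := source a (z.1, flow a (c * z.1) z.2).

(* The factor [(s < t)%:R] cuts the time integral at [t], so that the value stays bounded for all [t]. *)
Definition char_sol a (z : R * pt (R := R)) : R :=
  w0 a z.2 + tint 0 T (fun s => (s < z.1)%R%:R * char_source a (s, z.2)).

(** The right-hand side of Duhamel's formula, with [w] inside the source. It serves as a version of
    [w] that is defined at every time and, on [[0, T]], is Lipschitz in time along each
    characteristic. *)
Definition mild_sol a (z : R * pt (R := R)) : R := char_sol a (z.1, flow a (- (c * z.1)) z.2).

Hypotheses (bw0 : forall a, bounded_meas (w0 a)) (pw0 : forall a, lattice_periodic (w0 a)).
Hypotheses (bw : forall a, bounded_meas (w a)) (pw : forall a t, lattice_periodic (fun x => w a (t, x))).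
Hypotheses (bka : bounded_meas ka) (pka : forall t, lattice_periodic (fun x => ka (t, x))).

Lemma bm_source a : bounded_meas (source a).
Proof.
apply: bmM => //; apply: bmB; first exact: bm_sum.
by apply: bmM => //; exact: bm_cst.
Qed.

Lemma periodic_source a t : lattice_periodic (fun x => source a (t, x)).
Proof.
move=> i x; rewrite /source pka pw; congr (_ * (_ - _)).
by apply: eq_bigr => b _; rewrite pw.
Qed.

Let measurable_char a e : measurable_fun setT
  (fun z : R * pt (R := R) => (z.1, flow a (e * (c * z.1)) z.2) : R * pt (R := R)).
Proof.
apply: measurable_fun_pair => //; apply: measurable_flow_comp => //.
apply: measurable_funM; first exact: measurable_cst.
by apply: measurable_funM; first exact: measurable_cst.
Qed.

Lemma bm_char_source a : bounded_meas (char_source a).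
Proof.
apply: (bm_comp (bm_source a)); have := measurable_char a 1.
by under eq_fun do rewrite mul1r.
Qed.

Lemma bm_char_source_at a y : bounded_meas (fun s => char_source a (s, y)).
Proof. by apply: (bm_comp (bm_char_source a)); exact: pair2_measurable. Qed.

Lemma periodic_char_source a s : lattice_periodic (fun y => char_source a (s, y)).
Proof. exact: (periodic_flow a (c * s) (@periodic_source a s)). Qed.

Lemma bm_lt_indic (t : R) : bounded_meas (fun s : R => (s < t)%R%:R : R).
Proof.
rewrite (_ : (fun s => _) = \1_(`]-oo, t[)).
  by apply: bm_indic; exact: measurable_itv.
by apply/funext => s; rewrite indicE; congr (nat_of_bool _)%:R; rewrite mem_setE in_itv.
Qed.

Lemma bm_char_sol a : bounded_meas (char_sol a).
Proof.
apply: bmD; first by apply: (bm_comp (bw0 a)); exact: measurable_snd.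
apply: (bm_tint 0 T (F := fun q : (R * pt (R := R)) * R =>
  (q.2 < q.1.1)%R%:R * char_source a (q.2, q.1.2))).
apply: bmM; last first.
  apply: (bm_comp (bm_char_source a)); apply: measurable_fun_pair => //.
  exact: measurableT_comp.
split; last by exists 1 => q; case: (_ < _); rewrite ?normr1 ?normr0.
rewrite (_ : (fun q => _) = \1_[set q : (R * pt (R := R)) * R | q.2 < q.1.1]).
  apply: measurable_indic; rewrite -[X in measurable X]setTI.
  have := @measurable_fun_ltr _ _ R setT (fun q : (R * pt (R := R)) * R => q.2) (fun q => q.1.1).
  by move=> /(_ _ _ measurableT [set true]); apply => //; exact: measurableT_comp.
by apply/funext => q; rewrite indicE; congr (nat_of_bool _)%:R; rewrite mem_setE.
Qed.

Lemma periodic_char_sol a t : lattice_periodic (fun y => char_sol a (t, y)).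
Proof.
move=> i y; rewrite /char_sol/= pw0; congr (_ + _).
by apply: eq_tint => s _ _; rewrite periodic_char_source.
Qed.

Lemma bm_mild_sol a : bounded_meas (mild_sol a).
Proof.
apply: (bm_comp (bm_char_sol a)); have := measurable_char a (-1).
by under eq_fun do rewrite mulN1r.
Qed.

Lemma periodic_mild_sol a t : lattice_periodic (fun y => mild_sol a (t, y)).
Proof. exact: (periodic_flow a (- (c * t)) (@periodic_char_sol a t)). Qed.

Lemma bm_mild_sol_at a t : bounded_meas (fun x => mild_sol a (t, x)).
Proof. by apply: (bm_comp (bm_mild_sol a)); exact: pair1_measurable. Qed.

Lemma bm_char_sol_at a t : bounded_meas (fun x => char_sol a (t, x)).
Proof. by apply: (bm_comp (bm_char_sol a)); exact: pair1_measurable. Qed.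

Lemma bm_char_sol_line a y : bounded_meas (fun t => char_sol a (t, y)).
Proof. by apply: (bm_comp (bm_char_sol a)); exact: pair2_measurable. Qed.

Lemma char_sol0 a y : char_sol a (0, y) = w0 a y.
Proof.
rewrite /char_sol/= (@eq_tint _ _ _ _ (fun=> 0)); last first.
  by move=> s s0 _; rewrite /= ltNge s0 mul0r.
rewrite /tint Rintegral_cst ?mul0r ?addr0//; exact: (finite_domain_itv 0 T).1.
Qed.

Lemma char_sol_increment a y s t : 0 <= s -> s <= t -> t <= T ->
  char_sol a (t, y) - char_sol a (s, y) = tint s t (fun r => char_source a (r, y)).
Proof.
move=> s0 st tT; have hb := bm_char_source_at a y.
have cut u : 0 <= u -> u <= T ->
    tint 0 T (fun r => (r < u)%R%:R * char_source a (r, y)) = tint 0 u (fun r => char_source a (r, y)).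
  move=> u0 uT; have hbu := bmM (bm_lt_indic u) hb.
  rewrite (tint_split hbu u0 uT).
  have -> : tint 0 u (fun r => (r < u)%R%:R * char_source a (r, y)) =
      tint 0 u (fun r => char_source a (r, y)).
    by apply: eq_tint => r _ ru; rewrite ru mul1r.
  have -> : tint u T (fun r => (r < u)%R%:R * char_source a (r, y)) = tint u T (fun=> 0).
    by apply: eq_tint => r ur _; rewrite ltNge ur mul0r.
  by rewrite tint_cst// mul0r addr0.
rewrite /char_sol/= !cut ?(le_trans s0)//; last exact: le_trans tT.
by rewrite (tint_split hb s0 st); ring.
Qed.

Hypothesis mild : forall a, {ae lebs, forall t : R, 0 <= t < T ->
  {ae mu3, forall x, cube x -> w a (t, x) = mild_sol a (t, x)}}.

Section Entropy.
Variables (Phi phi : R -> R) (B : R).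
Hypothesis Phi2 : forall x y, `|Phi y - Phi x - phi x * (y - x)| <= B * (y - x) ^+ 2.
Hypothesis phi1 : forall x y, `|phi y - phi x| <= B * `|y - x|.
Hypothesis cPhi : continuous Phi.

(** The chain rule holds on every characteristic; integrating over the foot points, exchanging with
    the time integral and translating back to positions gives the balance. [mild_sol] is replaced by
    [w] only under the time integral, where agreement at almost every time suffices. *)
Lemma entropy_balance a s t : 0 <= s -> s <= t -> t <= T ->
  cint (fun x => Phi (mild_sol a (t, x))) - cint (fun x => Phi (mild_sol a (s, x))) =
  tint s t (fun r => cint (fun x => phi (w a (r, x)) * source a (r, x))).
Proof.
move=> s0 st tT.
have bPhi d (S : measurableType d) (h : S -> R) : bounded_meas h -> bounded_meas (fun x => Phi (h x)).
  exact: bm_comp_continuous.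
have toV u : cint (fun x => Phi (mild_sol a (u, x))) = cint (fun y => Phi (char_sol a (u, y))).
  apply: (cint_flow a (- (c * u)) (f := fun y => Phi (char_sol a (u, y)))).
    exact/bPhi/bm_char_sol_at.
  by move=> i y; rewrite (@periodic_char_sol a u).
have bVG : bounded_meas (fun z : R * pt (R := R) => phi (char_sol a z) * char_source a z).
  by apply: bmM; [exact: (bm_phi phi1 (bm_char_sol a))|exact: bm_char_source].
have bWS : bounded_meas (fun z : R * pt (R := R) => phi (w a z) * source a z).
  by apply: bmM; [exact: (bm_phi phi1 (bw a))|exact: bm_source].
rewrite !toV -cintB; [|exact/bPhi/bm_char_sol_at..].
transitivity (cint (fun y => tint s t (fun r => phi (char_sol a (r, y)) * char_source a (r, y)))).
  apply: eq_Rintegral => y _.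
  apply: (chain_rule (bm_char_sol_line a y) (bm_char_source_at a y) _ Phi2 phi1 s0 st tT).
  exact: char_sol_increment.
rewrite -(tint_cint_swap s t bVG).
apply: eq_tint_ae; [exact: (bm_cint bVG)|exact: (bm_cint bWS)|].
apply: ae_lebS (mild a) => r m /andP[sr rt].
have {}m : {ae mu3, forall x, cube x -> w a (r, x) = mild_sol a (r, x)}.
  by apply: m; rewrite (le_trans s0 sr) (lt_le_trans rt tT).
have bMS : bounded_meas (fun x => phi (mild_sol a (r, x)) * source a (r, x)).
  apply: bmM; first exact: (bm_phi phi1 (bm_mild_sol_at a r)).
  by apply: (bm_comp (bm_source a)); exact: pair1_measurable.
transitivity (cint (fun x => phi (mild_sol a (r, x)) * source a (r, x))).
  rewrite -(cint_flow a (c * r) bMS); last first.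
    by move=> i x; rewrite (@periodic_mild_sol a r) (@periodic_source a r).
  by apply: eq_Rintegral => y _; rewrite /mild_sol /= flowK.
apply: eq_cint_ae => //.
  by apply: (bm_comp bWS); exact: pair1_measurable.
by apply: ae_mu3S m => x m /m ->.
Qed.

Lemma entropy_balance_sum s t : 0 <= s -> s <= t -> t <= T ->
  \sum_a cint (fun x => Phi (mild_sol a (t, x))) - \sum_a cint (fun x => Phi (mild_sol a (s, x))) =
  tint s t (fun r => cint (fun x =>
    ka (r, x) * \sum_a phi (w a (r, x)) * (\sum_b w b (r, x) - 6 * w a (r, x)))).
Proof.
move=> s0 st tT; rewrite -sumrB.
have bWS a : bounded_meas (fun z : R * pt (R := R) => phi (w a z) * source a z).
  by apply: bmM; [exact: (bm_phi phi1 (bw a))|exact: bm_source].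
transitivity (\sum_a tint s t (fun r => cint (fun x => phi (w a (r, x)) * source a (r, x)))).
  by apply: eq_bigr => a _; exact: entropy_balance.
rewrite -(tint_sum s t); last by move=> a; exact: (bm_cint (bWS a)).
apply: eq_tint => r _ _.
have bWSr a : bounded_meas (fun x => phi (w a (r, x)) * source a (r, x)).
  by apply: (bm_comp (bWS a)); exact: pair1_measurable.
rewrite -(cint_sum _ bWSr).
apply: eq_Rintegral => x _; rewrite mulr_sumr; apply: eq_bigr => a _.
by rewrite /source; ring.
Qed.

End Entropy.

End MildSolution.

(** * A priori bounds and energy decay of mild solutions *)

Section TruncatedSquare.
Context {R : realType}.
Variables (e k : R).
Hypothesis e1 : e ^+ 2 = 1.

(** With [e = 1], [k = M] this penalises values above [M]; with [e = -1], [k = 0] it penalises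
    negative values. *)
Definition trunc_sq (x : R) : R := Num.max 0 (e * x - k) ^+ 2.
Definition dtrunc_sq (x : R) : R := 2 * e * Num.max 0 (e * x - k).

Lemma trunc_sq_taylor x y :
  `|trunc_sq y - trunc_sq x - dtrunc_sq x * (y - x)| <= 2 * (y - x) ^+ 2.
Proof.
have h := pos_sq_taylor (e * x - k) (e * y - k).
rewrite (_ : dtrunc_sq x * (y - x) =
  2 * Num.max 0 (e * x - k) * (e * y - k - (e * x - k))); last by rewrite /dtrunc_sq; ring.
apply: (le_trans h).
rewrite (_ : (e * y - k - (e * x - k)) ^+ 2 = e ^+ 2 * (y - x) ^+ 2); last by ring.
by rewrite e1 mul1r; have := sqr_ge0 (y - x); lra.
Qed.

Lemma dtrunc_sq_lip x y : `|dtrunc_sq y - dtrunc_sq x| <= 2 * `|y - x|.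
Proof.
have ne : `|e| = 1 by apply/eqP; rewrite -(eqrXn2 (n := 2))// real_normK ?num_real// e1 expr1n.
rewrite /dtrunc_sq -mulrBr !normrM ne mulr1 ger0_norm// ler_wpM2l//.
apply: (le_trans (pos_lip _ _)).
by rewrite (_ : e * y - k - (e * x - k) = e * (y - x)) ?normrM ?ne ?mul1r//; ring.
Qed.

Lemma continuous_trunc_sq : continuous trunc_sq.
Proof.
have cp : continuous (fun x : R => Num.max 0 x).
  by apply: (@lipschitz_continuous _ _ 1) => x y; rewrite mul1r; exact: pos_lip.
move=> x; apply: (@continuous_comp _ _ _ (fun x => Num.max 0 (e * x - k)) (fun y : R => y ^+ 2)).
  apply: (@continuous_comp _ _ _ (fun x => e * x - k) (fun y : R => Num.max 0 y)); last exact: cp.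
  by apply: cvgB; [apply: cvgM; [exact: cvg_cst|exact: cvg_id]|exact: cvg_cst].
exact: exprn_continuous.
Qed.

Lemma trunc_sq_ge0 x : 0 <= trunc_sq x. Proof. exact: sqr_ge0. Qed.

Lemma trunc_sq_eq0 x : (trunc_sq x == 0) = (e * x <= k).
Proof. by rewrite /trunc_sq sqrf_eq0; have [h|h] := leP 0 (e * x - k); lra. Qed.

Lemma dtrunc_sq_eq0 x : e * x <= k -> dtrunc_sq x = 0.
Proof. by move=> h; rewrite /dtrunc_sq (max_idPl _) ?mulr0// subr_le0. Qed.

End TruncatedSquare.

Section Decay.
Context {R : realType}.
Local Notation dir := ('I_3 * bool)%type.
Variables (c T M m K d : R) (w0 : dir -> pt (R := R) -> R) (w : dir -> R * pt (R := R) -> R)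
  (ka : R * pt (R := R) -> R).
Hypotheses (c0 : 0 < c) (M0 : 0 < M) (d0 : 0 < d).
Hypotheses (bw0 : forall a, bounded_meas (w0 a)) (pw0 : forall a, lattice_periodic (w0 a)).
Hypotheses (bw : forall a, bounded_meas (w a)) (pw : forall a t, lattice_periodic (fun x => w a (t, x))).
Hypotheses (bka : bounded_meas ka) (pka : forall t, lattice_periodic (fun x => ka (t, x))).
Hypothesis w0M : forall a x, 0 <= w0 a x <= M.
Hypothesis w_ge0 : forall a z, 0 <= w a z.
Hypothesis ka_ge0 : forall z, 0 <= ka z.
(** The bounds are conditional on the densities lying below [M], because that fact is proved in this
    section, from the sign and the boundedness of [ka] alone. *)
Hypothesis ka_bounds : {ae mu3, forall x, cube x -> forall t, (forall b, w b (t, x) <= M) ->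
  d * (\sum_b w b (t, x)) <= ka (t, x) <= K}.
Let p a z := mild_sol c T w0 w ka a z.
Hypothesis mild : forall a, {ae lebs, forall t : R, 0 <= t < T ->
  {ae mu3, forall x, cube x -> w a (t, x) = p a (t, x)}}.

Let bp a t : bounded_meas (fun x => p a (t, x)).
Proof. exact: bm_mild_sol_at. Qed.

Let w_at a t : bounded_meas (fun x => w a (t, x)).
Proof. by apply: (bm_comp (bw a)); exact: pair1_measurable. Qed.

Let p0 a x : p a (0, x) = w0 a x.
Proof. by rewrite /p /mild_sol/= mulr0 oppr0 flow0 char_sol0. Qed.

Let balance (Phi phi : R -> R) (B : R)
    (Phi2 : forall x y, `|Phi y - Phi x - phi x * (y - x)| <= B * (y - x) ^+ 2)
    (phi1 : forall x y, `|phi y - phi x| <= B * `|y - x|)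
    (cPhi : continuous Phi) (s t : R) : 0 <= s -> s <= t -> t <= T ->
  \sum_a cint (fun x => Phi (p a (t, x))) - \sum_a cint (fun x => Phi (p a (s, x))) =
  tint s t (fun r => cint (fun x =>
    ka (r, x) * \sum_a phi (w a (r, x)) * (\sum_b w b (r, x) - 6 * w a (r, x)))).
Proof. exact: (entropy_balance_sum bw0 pw0 bw pw bka pka mild Phi2 phi1 cPhi). Qed.

(** As [w] is nonnegative, the production of the penalty on negative values vanishes, so its
    integral keeps the initial value [0]. Agreement with [w] alone would give the sign at almost
    every time only. *)
Lemma mild_sol_ge0 a (t : R) : 0 <= t <= T -> {ae mu3, forall x, cube x -> 0 <= p a (t, x)}.
Proof.
move=> /andP[t0 tT].
have e1 : (-1 : R) ^+ 2 = 1 by rewrite sqrrN expr1n.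
have := entropy_balance bw0 pw0 bw pw bka pka mild (trunc_sq_taylor 0 e1)
  (dtrunc_sq_lip 0 e1) (@continuous_trunc_sq _ (-1) 0) a (lexx 0) t0 tT.
rewrite (@eq_tint _ 0 t _ (fun=> 0)); last first.
  move=> r _ _; rewrite -[RHS]cint_cst; apply: eq_Rintegral => x _.
  by rewrite dtrunc_sq_eq0 ?mul0r// mulN1r oppr_le0.
rewrite tint_cst// mul0r.
rewrite [X in _ - X](_ : _ = 0); last first.
  rewrite -[RHS]cint_cst; apply: eq_Rintegral => x _; rewrite -/(p a (0, x)) p0.
  by apply/eqP; rewrite trunc_sq_eq0 mulN1r oppr_le0; case/andP: (w0M a x).
rewrite subr0 => /cint_eq0_ae h.
apply: ae_mu3S (h _ _) => [x hx /hx /eqP| |x]; last exact: trunc_sq_ge0.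
  by rewrite trunc_sq_eq0 mulN1r oppr_le0.
by apply: bm_comp_continuous (bp a t); exact: continuous_trunc_sq.
Qed.

(** Only the sum over the directions has a production of one sign, by [relaxation_monotone]; the
    truncated energies are nonnegative with vanishing initial sum, hence each of them vanishes. *)
Lemma mild_sol_leM a (t : R) : 0 <= t <= T -> {ae mu3, forall x, cube x -> p a (t, x) <= M}.
Proof.
move=> /andP[t0 tT].
have e1 : (1 : R) ^+ 2 = 1 by rewrite expr1n.
have bPhi a' : bounded_meas (fun x => trunc_sq 1 M (p a' (t, x))).
  by apply: bm_comp_continuous (bp a' t); exact: continuous_trunc_sq.
have := balance (trunc_sq_taylor M e1) (dtrunc_sq_lip M e1) (@continuous_trunc_sq _ 1 M)
  (lexx 0) t0 tT.
rewrite [X in _ - X](_ : _ = 0); last first.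
  apply: big1 => b _; rewrite -[RHS]cint_cst; apply: eq_Rintegral => x _; rewrite p0.
  by apply/eqP; rewrite trunc_sq_eq0 mul1r; case/andP: (w0M b x).
rewrite subr0 => sE.
have bI : bounded_meas (fun z : R * pt (R := R) =>
    ka z * \sum_a dtrunc_sq 1 M (w a z) * (\sum_b w b z - 6 * w a z)).
  apply: bmM => //; apply: bm_sum => b; apply: bmM; first exact: (bm_phi (dtrunc_sq_lip M e1) (bw b)).
  by apply: bmB; [exact: bm_sum|apply: bmM => //; exact: bm_cst].
have s0 : \sum_a' cint (fun x => trunc_sq 1 M (p a' (t, x))) <= 0.
  rewrite sE -[X in _ <= X](mul0r (t - 0)) -tint_cst//.
  apply: le_tint; [exact: (bm_cint bI)|exact: bm_cst|move=> r _].
  rewrite -[X in _ <= X]cint_cst; apply: le_cint.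
  - by apply: (bm_comp bI); exact: pair1_measurable.
  - exact: bm_cst.
  - move=> x; rewrite -oppr_ge0 -mulrN mulr_ge0// oppr_ge0.
    apply: (relaxation_monotone (fun b => w b (r, x))) => y z yz.
    by rewrite /dtrunc_sq mulr1 ler_wpM2l// ge_max le_max lexx/= le_max !mul1r lerB ?orbT.
have i0 : cint (fun x => trunc_sq 1 M (p a (t, x))) = 0.
  apply/eqP; rewrite eq_le; apply/andP; split; last by apply: cint_ge0 => x; exact: trunc_sq_ge0.
  apply: le_trans s0; apply: le_sum_dir => b; apply: cint_ge0 => x; exact: trunc_sq_ge0.
apply: ae_mu3S (cint_eq0_ae (bPhi a) (fun x => trunc_sq_ge0 1 M _) i0) => x hx /hx /eqP.
by rewrite trunc_sq_eq0 mul1r.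
Qed.

Let E t := \sum_a cint (fun x => (p a (t, x) - m) ^+ 2).

Let diss z : R := ka z * \sum_a \sum_b (w a z - w b z) ^+ 2.

Let bdiss : bounded_meas diss.
Proof. by apply: bmM => //; apply: bm_sum => a; apply: bm_sum => b; exact: bm_sqrB. Qed.

Let diss_ge0 z : 0 <= diss z.
Proof. by rewrite mulr_ge0// sumr_ge0// => a _; rewrite sumr_ge0// => b _; exact: sqr_ge0. Qed.

Lemma energy_dissipation (s t : R) : 0 <= s -> s <= t -> t <= T ->
  E s - E t = tint s t (fun r => cint (fun x => diss (r, x))).
Proof.
move=> s0 st tT.
have h2 x y : `|(y - m) ^+ 2 - (x - m) ^+ 2 - 2 * (x - m) * (y - x)| <= 2 * (y - x) ^+ 2.
  rewrite (_ : _ - _ * _ = (y - x) ^+ 2); last by ring.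
  by rewrite ger0_norm ?sqr_ge0//; have := sqr_ge0 (y - x); lra.
have h1 x y : `|2 * (y - m) - 2 * (x - m)| <= 2 * `|y - x|.
  by rewrite -mulrBr normrM ger0_norm// (_ : y - m - (x - m) = y - x)//; ring.
have hc : continuous (fun x => (x - m) ^+ 2).
  move=> x; apply: (@continuous_comp _ _ _ (fun x => x - m) (fun y : R => y ^+ 2)).
    by apply: cvgB; [exact: cvg_id|exact: cvg_cst].
  exact: exprn_continuous.
have h : E t - E s = _ := balance h2 h1 hc s0 st tT.
rewrite -opprB h -mulN1r -tintZ; last first.
  apply: (bm_cint (F := fun z => ka z * \sum_a 2 * (w a z - m) * (\sum_b w b z - 6 * w a z))).
  apply: bmM => //; apply: bm_sum => b; apply: bmM.
    by apply: bmM; [exact: bm_cst|apply: bmB => //; exact: bm_cst].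
  by apply: bmB; [exact: bm_sum|apply: bmM => //; exact: bm_cst].
apply: eq_tint => r _ _; rewrite -cintZ.
  apply: eq_Rintegral => x _; rewrite (relaxation_energy (fun b => w b (r, x))) /diss; ring.
apply: bmM; first by apply: (bm_comp bka); exact: pair1_measurable.
apply: bm_sum => b; apply: bmM.
  by apply: bmM; [exact: bm_cst|apply: bmB => //; exact: bm_cst].
by apply: bmB; [exact: bm_sum|apply: bmM => //; exact: bm_cst].
Qed.

Lemma energy_nonincreasing (s t : R) : 0 <= s -> s <= t -> t <= T -> E t <= E s.
Proof.
move=> s0 st tT; rewrite -subr_ge0 energy_dissipation//.
by apply: tint_ge0 => r; apply: cint_ge0.
Qed.

Hypothesis mass0 : \sum_a cint (w0 a) = 6 * m.

(** The linear entropy has no Taylor remainder, so the balance applies with [B = 0], and the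
    relaxation terms cancel in the sum over the directions. *)
Lemma mild_sol_mass (t : R) : 0 <= t <= T -> \sum_a cint (fun x => p a (t, x)) = 6 * m.
Proof.
move=> /andP[t0 tT].
have h2 (x y : R) : `|y - x - 1 * (y - x)| <= 0 * (y - x) ^+ 2.
  by rewrite mul1r subrr normr0 mul0r.
have h1 (x y : R) : `|1 - 1 : R| <= 0 * `|y - x| by rewrite subrr normr0 mul0r.
have hc : continuous (fun x : R => x) by move=> x; exact: cvg_id.
have := @balance (fun x => x) (fun=> 1) 0 h2 h1 hc 0 t (lexx 0) t0 tT.
rewrite (@eq_tint _ 0 t _ (fun=> 0)); last first.
  move=> r _ _; rewrite -[RHS]cint_cst; apply: eq_Rintegral => x _.
  under eq_bigr do rewrite mul1r.
  by rewrite (relaxation_mass (fun b => w b (r, x))) mulr0.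
rewrite tint_cst// mul0r => /eqP; rewrite subr_eq0 => /eqP ->.
by rewrite -mass0; apply: eq_bigr => a _; apply: eq_Rintegral => x _; exact: p0.
Qed.

Let L := (2 * c)^-1.

Let L0 : 0 < L. Proof. by rewrite invr_gt0 mulr_gt0. Qed.

Let pointwise_bounds : {ae lebs, forall r : R, 0 <= r < T -> {ae mu3, forall x, cube x ->
  [/\ forall a, w a (r, x) = p a (r, x), forall a, w a (r, x) <= M &
      d * (\sum_b w b (r, x)) <= ka (r, x) <= K]}}.
Proof.
apply: ae_lebS (ae_leb_all mild) => r h rT.
have hM : {ae mu3, forall x, forall a, cube x -> p a (r, x) <= M}.
  by apply: ae_mu3_all => a; apply: mild_sol_leM; case/andP: rT => -> /ltW ->.
have hw : {ae mu3, forall x, forall a, cube x -> w a (r, x) = p a (r, x)}.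
  by apply: ae_mu3_all => a; exact: h.
apply: ae_mu3S (ae_mu3I (ae_mu3I hM hw) ka_bounds) => x [[h1 h2] h3] cx.
have wM a : w a (r, x) <= M by rewrite h2//; exact: h1.
by split => // [a|]; [exact: h2|exact: h3].
Qed.

(** The left side is the squared derivative of [w a ^ 2] along its characteristic. One factor [ka]
    is bounded by [K] and the other is kept for the dissipation; [24] is [4], from the square of
    [2], times [6], from Cauchy-Schwarz over the directions. *)
Let source_sqr_le a z : (forall b, w b z <= M) -> ka z <= K ->
  (2 * w a z * source w ka a z) ^+ 2 <= 24 * M ^+ 2 * K * diss z.
Proof.
move=> wM kK; rewrite /source /diss.
have k0 := ka_ge0 z; have wa := wM a; have wa0 := w_ge0 a z.
set D := \sum_a \sum_b _.
have hs : (\sum_b w b z - 6 * w a z) ^+ 2 <= 6 * D.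
  rewrite -(sum_dir_cst (w a z)) -sumrB.
  apply: (le_trans (sum_dir_sqr _)); rewrite ler_wpM2l//.
  rewrite (eq_bigr (fun b => (w a z - w b z) ^+ 2)); last by move=> b _; ring.
  apply: (le_sum_dir (x := fun a => \sum_b (w a z - w b z) ^+ 2)) => b.
  by apply: sumr_ge0 => b' _; exact: sqr_ge0.
have D0 : 0 <= D by apply: le_trans (_ : 0 <= 6^-1 * (\sum_b w b z - 6 * w a z) ^+ 2) _;
  [rewrite mulr_ge0 ?sqr_ge0 ?invr_ge0|rewrite ler_pdivrMl].
rewrite (_ : (_ * _) ^+ 2 = 4 * (w a z ^+ 2 * (ka z * (ka z * (\sum_b w b z - 6 * w a z) ^+ 2)))); last by ring.
rewrite (_ : 24 * M ^+ 2 * K * (ka z * D) = 4 * (M ^+ 2 * (K * (ka z * (6 * D))))); last by ring.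
rewrite ler_wpM2l//; apply: ler_pM; first exact: sqr_ge0.
- by apply: mulr_ge0 => //; apply: mulr_ge0 => //; exact: sqr_ge0.
- by rewrite lerXn2r ?nnegrE// ltW.
apply: ler_pM => //; first by rewrite mulr_ge0 ?sqr_ge0.
by rewrite ler_wpM2l.
Qed.

Let sqr_diff_le a b z : (forall b, w b z <= M) -> d * (\sum_b w b z) <= ka z ->
  (w a z ^+ 2 - w b z ^+ 2) ^+ 2 <= 2 * M / d * diss z.
Proof.
(* For [a = b] the bound of [w a + w b] by the total density may fail, but then the left side is
   zero. *)
move=> wM hk; have [->|ab] := eqVneq a b.
  by rewrite subrr expr0n/= mulr_ge0 ?diss_ge0// divr_ge0 ?mulr_ge0 ?ltW.
have hsum := le_sum_dir2 (x := fun b => w b z) ab (fun b => w_ge0 b z).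
have hD : (w a z - w b z) ^+ 2 <= \sum_a \sum_b (w a z - w b z) ^+ 2.
  apply: le_trans (le_sum_dir (x := fun b => (w a z - w b z) ^+ 2) b _) _ => [b'|].
    exact: sqr_ge0.
  apply: (le_sum_dir (x := fun a => \sum_b (w a z - w b z) ^+ 2)) => b'.
  by apply: sumr_ge0 => *; exact: sqr_ge0.
have h1 : (w a z + w b z) ^+ 2 <= 2 * M / d * ka z.
  apply: (le_trans (y := 2 * M * (\sum_b w b z))).
    rewrite expr2 ler_pM ?addr_ge0//.
    by have := wM a; have := wM b; lra.
  rewrite -[X in _ <= X]mulrA; apply: ler_wpM2l; first by rewrite mulr_ge0// ltW.
  by rewrite ler_pdivlMl.
rewrite (_ : _ ^+ 2 = (w a z + w b z) ^+ 2 * (w a z - w b z) ^+ 2); last by ring.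
by rewrite /diss mulrA ler_pM ?sqr_ge0.
Qed.

Section Window.
Variable t0 : R.
Hypotheses (t00 : 0 <= t0) (t1T : t0 + L <= T).
Let t1 := t0 + L.
Let eps := E t0 - E t1.

Let t01 : t0 <= t1. Proof. by rewrite lerDl ltW. Qed.

Let eps_diss : tint t0 t1 (fun r => cint (fun x => diss (r, x))) = eps.
Proof. by rewrite /eps (energy_dissipation t00 t01 t1T). Qed.

Let Q a x := p a (t0, x) ^+ 2.

Let bQ a : bounded_meas (Q a). Proof. exact/bmX/bp. Qed.

Let pQ a : lattice_periodic (Q a).
Proof. by move=> i x; rewrite /Q /p periodic_mild_sol. Qed.

Let tint_cint_le (F : R * pt (R := R) -> R) C : bounded_meas F ->
  {ae lebs, forall r : R, t0 <= r < t1 -> {ae mu3, forall x, cube x -> F (r, x) <= C * diss (r, x)}} ->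
  tint t0 t1 (fun r => cint (fun x => F (r, x))) <= C * eps.
Proof.
move=> bF hF; rewrite -eps_diss -tintZ; last exact: (bm_cint bdiss).
have bC : bounded_meas (fun z => C * diss z) by apply: bmM => //; exact: bm_cst.
apply: le_tint_ae.
- exact: (bm_cint bF).
- by apply: bmM; [exact: bm_cst|exact: (bm_cint bdiss)].
apply: ae_lebS hF => r h tr; rewrite -cintZ.
  apply: le_cint_ae (h tr).
    by apply: (bm_comp bF); exact: pair1_measurable.
  by apply: (bm_comp bC); exact: pair1_measurable.
by apply: (bm_comp bdiss); exact: pair1_measurable.
Qed.

Let window_bounds : {ae lebs, forall r : R, t0 <= r < t1 -> {ae mu3, forall x, cube x ->
  [/\ forall a, w a (r, x) = p a (r, x), forall a, w a (r, x) <= M &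
      d * (\sum_b w b (r, x)) <= ka (r, x) <= K]}}.
Proof.
apply: ae_lebS pointwise_bounds => r h /andP[t0r rt1]; apply: h.
by rewrite (le_trans t00 t0r) (lt_le_trans rt1 t1T).
Qed.

(** Seen from the foot point, the difference is that of the squared [char_sol] at two times, hence a
    time integral of its derivative. Cauchy-Schwarz in time gives the factor [L], and
    [source_sqr_le] bounds what is left by the dissipation. *)
Lemma transport_close a s : 0 <= s -> s <= L ->
  dist2 (fun x => Q a (flow a (- (c * s)) x)) (fun x => p a (t0 + s, x) ^+ 2) <=
  L * (24 * M ^+ 2 * K * eps).
Proof.
move=> s0 sL; pose V := char_sol c T w0 w ka a; pose G := char_source c w ka a.
have bV : bounded_meas V by exact: bm_char_sol.
have bG : bounded_meas G by exact: bm_char_source.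
have bH : bounded_meas (fun z => (2 * V z * G z) ^+ 2).
  by apply: bmX; apply: bmM => //; apply: bmM => //; exact: bm_cst.
have bVt t : bounded_meas (fun y => V (t, y)) by exact: bm_char_sol_at.
rewrite (_ : dist2 _ _ = cint (fun y => (V (t0, y) ^+ 2 - V (t0 + s, y) ^+ 2) ^+ 2)); last first.
  rewrite -(cint_flow a (- (c * (t0 + s))) (f := fun y => (V (t0, y) ^+ 2 - V (t0 + s, y) ^+ 2) ^+ 2)).
  - apply: eq_Rintegral => x _; rewrite /Q /p /mild_sol /= flowD.
    by rewrite (_ : - (c * s) - c * t0 = - (c * (t0 + s)))//; ring.
  - by apply: bm_sqrB; exact: bmX.
  - by move=> i y; rewrite /V !periodic_char_sol.
apply: (le_trans (y := cint (fun y => L * tint t0 t1 (fun r => (2 * V (r, y) * G (r, y)) ^+ 2)))).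
  have bT : bounded_meas (fun y => tint t0 t1 (fun r => (2 * V (r, y) * G (r, y)) ^+ 2)).
    apply: (bm_tint t0 t1 (F := fun q : pt (R := R) * R => (2 * V (q.2, q.1) * G (q.2, q.1)) ^+ 2)).
    apply: (bm_comp bH); apply: measurable_fun_pair => //.
  apply: le_cint; first by apply: bm_sqrB; exact: bmX.
    by apply: bmM => //; exact: bm_cst.
  move=> y; have bVl : bounded_meas (fun r => V (r, y)) by exact: bm_char_sol_line.
  have bGl : bounded_meas (fun r => G (r, y)) by exact: bm_char_source_at.
  have h2 (x z : R) : `|z ^+ 2 - x ^+ 2 - 2 * x * (z - x)| <= 2 * (z - x) ^+ 2.
    rewrite (_ : _ - _ * _ = (z - x) ^+ 2); last by ring.
    by rewrite ger0_norm ?sqr_ge0//; have := sqr_ge0 (z - x); lra.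
  have h1 (x z : R) : `|2 * z - 2 * x| <= 2 * `|z - x|.
    by rewrite -mulrBr normrM ger0_norm.
  have st : t0 <= t0 + s by rewrite lerDl.
  have sT : t0 + s <= T by apply: le_trans t1T; rewrite lerD2l.
  have inc (u v : R) : 0 <= u -> u <= v -> v <= T ->
      V (v, y) - V (u, y) = tint u v (fun r => G (r, y)) by exact: char_sol_increment.
  have e : V (t0 + s, y) ^+ 2 - V (t0, y) ^+ 2 = _ :=
    @chain_rule _ T _ _ (fun x => x ^+ 2) (fun x => 2 * x) 2 bVl bGl inc h2 h1 t0 (t0 + s) t00 st sT.
  rewrite -sqrrN opprB e.
  have bI : bounded_meas (fun r => 2 * V (r, y) * G (r, y)).
    by apply: bmM => //; apply: bmM => //; exact: bm_cst.
  apply: (le_trans (tint_sqr st bI)).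
  have bI2 := bmX 2 bI.
  rewrite (tint_split bI2 st (c := t1)); last by rewrite lerD2l.
  apply: ler_pM.
  - by rewrite subr_ge0.
  - by apply: tint_ge0 => r; exact: sqr_ge0.
  - by rewrite addrC addKr.
  - by rewrite lerDl; apply: tint_ge0 => r; exact: sqr_ge0.
rewrite cintZ; last first.
  apply: (bm_tint t0 t1 (F := fun q : pt (R := R) * R => (2 * V (q.2, q.1) * G (q.2, q.1)) ^+ 2)).
  by apply: (bm_comp bH); apply: measurable_fun_pair.
apply: ler_wpM2l; [exact: ltW|]; rewrite -(tint_cint_swap t0 t1 bH).
pose S z := (2 * p a z * source w ka a z) ^+ 2.
have bS : bounded_meas S.
  apply: bmX; apply: bmM; last exact: bm_source.
  by apply: bmM; [exact: bm_cst|exact: bm_mild_sol].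
rewrite (_ : tint _ _ _ = tint t0 t1 (fun r => cint (fun x => S (r, x)))); last first.
  apply: eq_tint => r _ _; rewrite -(cint_flow a (c * r) (f := fun x => S (r, x))).
  - by apply: eq_Rintegral => y _; rewrite /S /p /mild_sol /= flowK.
  - by apply: (bm_comp bS); exact: pair1_measurable.
  - by move=> i x; rewrite /S /p periodic_mild_sol// periodic_source.
apply: (tint_cint_le bS); apply: ae_lebS window_bounds => r h tr.
apply: ae_mu3S (h tr) => x {}h /h [wp wM /andP[_ kK]].
by rewrite /S -wp; exact: source_sqr_le.
Qed.

Lemma directions_close a b :
  tint 0 L (fun s => dist2 (fun x => p a (t0 + s, x) ^+ 2) (fun x => p b (t0 + s, x) ^+ 2)) <=
  2 * M / d * eps.
Proof.
have bF : bounded_meas (fun z => (p a z ^+ 2 - p b z ^+ 2) ^+ 2).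
  by apply: bm_sqrB; apply: bmX; exact: bm_mild_sol.
have := tint_shift 0 L t0 (bm_cint bF).
rewrite add0r addrC -/t1 => e.
rewrite (_ : tint 0 L _ = tint t0 t1 (fun r => cint (fun x => (p a (r, x) ^+ 2 - p b (r, x) ^+ 2) ^+ 2))).
  apply: (tint_cint_le bF); apply: ae_lebS window_bounds => r h tr.
  apply: ae_mu3S (h tr) => x {}h /h [wp wM /andP[kd _]].
  by rewrite -!wp; exact: sqr_diff_le.
by rewrite -e; apply: eq_tint => s _ _; rewrite addrC.
Qed.

(** The [3] is that of [dist2_tri3]. Two transport defects, integrated over the window, give
    [2 * L * (L * 24 * M ^ 2 * K * eps)], and [directions_close] gives the remaining term. *)
Let eta := 3 * (48 * L ^+ 2 * M ^+ 2 * K + 2 * M / d) * eps.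

Let eps0 : 0 <= eps.
Proof. by rewrite subr_ge0; apply: energy_nonincreasing. Qed.

Let observed a b : tint 0 L (fun s => dist2 (fun x => Q a (flow a (- (c * s)) x))
   (fun x => Q b (flow b (- (c * s)) x))) <= eta.
Proof.
pose C := L * (24 * M ^+ 2 * K * eps).
pose D s := dist2 (fun x => p a (t0 + s, x) ^+ 2) (fun x => p b (t0 + s, x) ^+ 2).
have mcs : measurable_fun setT (fun s : R => - (c * s) : R).
  by apply: measurableT_comp => //; apply: measurable_funM => //; exact: measurable_cst.
have bQf b' : bounded_meas (fun z : R * pt (R := R) => Q b' (flow b' (- (c * z.1)) z.2)).
  by apply: (bm_comp (bQ b')); apply: measurable_flow_comp => //; exact: (measurableT_comp mcs).
have bps b' : bounded_meas (fun z : R * pt (R := R) => p b' (t0 + z.1, z.2) ^+ 2).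
  apply: bmX; apply: (bm_comp (h := fun z : R * pt (R := R) => (t0 + z.1, z.2))).
    exact: bm_mild_sol.
  apply: measurable_fun_pair => //; apply: measurable_funD => //; exact: measurable_cst.
have bD : bounded_meas D := bm_dist2 (bps a) (bps b).
apply: (le_trans (y := tint 0 L (fun s => 3 * (2 * C + D s)))).
  apply: le_tint.
  - exact: (bm_dist2 (bQf a) (bQf b)).
  - by apply: bmM; [exact: bm_cst|apply: bmD => //; exact: bm_cst].
  move=> s /andP[s0 /ltW sL].
  have ha := transport_close a s0 sL; have hb := transport_close b s0 sL.
  rewrite dist2C in hb.
  have h3 : dist2 (fun x => Q a (flow a (- (c * s)) x)) (fun x => Q b (flow b (- (c * s)) x)) <=
      3 * (dist2 (fun x => Q a (flow a (- (c * s)) x)) (fun x => p a (t0 + s, x) ^+ 2) + D s +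
        dist2 (fun x => p b (t0 + s, x) ^+ 2) (fun x => Q b (flow b (- (c * s)) x))).
    exact: (dist2_tri3 (bm_flow _ _ (bQ a)) (bmX 2 (bp a _)) (bmX 2 (bp b _)) (bm_flow _ _ (bQ b))).
  apply: (le_trans h3); apply: ler_wpM2l; first exact: ler0n.
  have -> : 2 * C + D s = C + D s + C by ring.
  exact: (lerD (lerD ha (lexx (D s))) hb).
rewrite tintZ; last by apply: bmD => //; exact: bm_cst.
rewrite tintD//; last exact: bm_cst.
rewrite (tint_cst _ (ltW L0)) subr0.
have h : tint 0 L D <= 2 * M / d * eps := directions_close a b.
rewrite /eta /C -[X in _ <= X]mulrA; apply: ler_wpM2l; first exact: ler0n.
have -> : (48 * L ^+ 2 * M ^+ 2 * K + 2 * M / d) * eps =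
  2 * (L * (24 * M ^+ 2 * K * eps)) * L + 2 * M / d * eps by ring.
exact: (lerD (lexx _) h).
Qed.

(** Because [m] is the mean density, replacing it by any other constant [r] can only increase the
    sum of squared deviations; and for nonnegative [x] and [r] the factor [r ^ 2] is at most
    [(x + r) ^ 2], which completes [(x - r) ^ 2] to the squared difference of squares. *)
Let E_le_var b y : 0 <= p b (t0, y) ->
  p b (t0, y) ^+ 2 * E t0 <= \sum_a cint (fun z => (Q a z - Q b y) ^+ 2).
Proof.
have tT : 0 <= t0 <= T by rewrite t00 (le_trans _ t1T)// lerDl ltW.
set r := p b (t0, y) => r0.
have bsq k a : bounded_meas (fun x => (p a (t0, x) - k) ^+ 2).
  by apply: bm_sqrB => //; exact: bm_cst.
have Ek k : \sum_a cint (fun x => (p a (t0, x) - k) ^+ 2) =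
    \sum_a cint (fun x => p a (t0, x) ^+ 2) - 2 * k * (6 * m) + 6 * k ^+ 2.
  rewrite -(mild_sol_mass tT) -sum_dirZ -sum_dir_cst -sumrB -big_split/=.
  apply: eq_bigr => a _.
  rewrite -cintZ// -(cint_cst (k ^+ 2)) -cintB; [|exact/bmX/bp|by apply: bmM => //; exact: bm_cst].
  rewrite -cintD; [|by apply: bmB; [exact/bmX/bp|apply: bmM => //; exact: bm_cst]|exact: bm_cst].
  by apply: eq_Rintegral => x _; ring.
apply: (le_trans (y := r ^+ 2 * \sum_a cint (fun x => (p a (t0, x) - r) ^+ 2))).
  rewrite ler_wpM2l ?sqr_ge0// /E !Ek.
  by have := sqr_ge0 (r - m); lra.
rewrite -sum_dirZ; apply: ler_sum => a _; rewrite -cintZ//.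
apply: le_cint_ae.
- by apply: bmM => //; exact: bm_cst.
- by apply: bm_sqrB; [exact: bQ|exact: bm_cst].
apply: ae_mu3S (mild_sol_ge0 a tT) => x {}h /h x0; rewrite /Q -/r.
have -> : (p a (t0, x) ^+ 2 - r ^+ 2) ^+ 2 =
  (p a (t0, x) + r) ^+ 2 * (p a (t0, x) - r) ^+ 2 by ring.
apply: ler_wpM2r; first exact: sqr_ge0.
have pr0 : 0 <= p a (t0, x) + r := addr_ge0 x0 r0.
have rp : r <= p a (t0, x) + r by rewrite lerDr.
exact: (lerXn2r 2 r0 pr0 rp).
Qed.

Let sum_sqr_ge : 6 * m ^+ 2 <= \sum_b cint (Q b).
Proof.
have tT : 0 <= t0 <= T by rewrite t00 (le_trans _ t1T)// lerDl ltW.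
have : 0 <= \sum_a cint (fun x => (p a (t0, x) - m) ^+ 2).
  by apply: sumr_ge0 => a _; apply: cint_ge0 => x; exact: sqr_ge0.
rewrite (_ : \sum_a _ = \sum_a cint (Q a) - 2 * m * (6 * m) + 6 * m ^+ 2); first by lra.
rewrite -(mild_sol_mass tT) -sum_dirZ -sum_dir_cst -sumrB -big_split/=.
apply: eq_bigr => a _.
rewrite -cintZ// -(cint_cst (m ^+ 2)) -cintB; [|exact: bQ|by apply: bmM => //; exact: bm_cst].
rewrite -cintD; [|by apply: bmB; [exact: bQ|apply: bmM => //; exact: bm_cst]|exact: bm_cst].
by apply: eq_Rintegral => x _; rewrite /Q; ring.
Qed.

(** [E_le_var] is integrated over [y] and summed over [b]: on the left the weights add up to at
    least [6 * m ^ 2], on the right there are [36] pairs of directions, each bounded by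
    [observability]. *)
Theorem energy_window :
  6 * m ^+ 2 * L * E t0 <= 36 * 2196 * eta.
Proof.
have tT : 0 <= t0 <= T by rewrite t00 (le_trans _ t1T)// lerDl ltW.
have E0 : 0 <= E t0 by apply: sumr_ge0 => a _; apply: cint_ge0 => x; exact: sqr_ge0.
have bQQ a b : bounded_meas (fun z : pt (R := R) * pt (R := R) => (Q a z.2 - Q b z.1) ^+ 2).
  apply: bm_sqrB; first by apply: (bm_comp (bQ a)); exact: measurable_snd.
  by apply: (bm_comp (bQ b)); exact: measurable_fst.
have h1 : (\sum_b cint (Q b)) * E t0 <=
    \sum_b \sum_a cint (fun y => cint (fun z => (Q a z - Q b y) ^+ 2)).
  rewrite mulr_suml; apply: ler_sum => b _.
  have bQc a := bm_cint (bQQ a b).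
  rewrite mulrC -cintZ// -(cint_sum _ bQc).
  apply: le_cint_ae; [by apply: bmM => //; exact: bm_cst|exact: bm_sum|].
  apply: ae_mu3S (mild_sol_ge0 b tT) => y {}h /h y0; rewrite mulrC; exact: E_le_var.
have h2 : \sum_b \sum_a L * cint (fun y => cint (fun z => (Q a z - Q b y) ^+ 2)) <=
    36 * 2196 * eta.
  rewrite (_ : 36 * 2196 * eta = \sum_(b : dir) \sum_(a : dir) (2196 * eta)); last first.
    by rewrite !sum_dir_cst; ring.
  by apply: ler_sum => b _; apply: ler_sum => a _; exact: (observability c0 bQ pQ observed).
apply: le_trans h2.
have -> : \sum_b \sum_a L * cint (fun y => cint (fun z => (Q a z - Q b y) ^+ 2)) =
    L * \sum_b \sum_a cint (fun y => cint (fun z => (Q a z - Q b y) ^+ 2)).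
  by rewrite -sum_dirZ; apply: eq_bigr => b _; rewrite sum_dirZ.
rewrite [X in X * E t0]mulrC -mulrA ler_pM2l//; apply: le_trans h1.
by rewrite ler_wpM2r.
Qed.

End Window.

End Decay.

(** * Smooth cutoffs *)

Section FlatFunction.
Context {R : realType}.

(* The value is [0] for [z <= 0], the junk value of [z^-1] at [0] being discarded by the test. *)
Definition flat (n : nat) (z : R) : R :=
  if 0 < z then z^-1 ^+ n * expR (- z^-1) else 0.

Lemma flat_ge0 n z : 0 <= flat n z.
Proof.
by rewrite /flat; case: ifPn => // z0; rewrite mulr_ge0 ?expR_ge0// exprn_ge0// invr_ge0 ltW.
Qed.

Lemma flat_le0 n z : z <= 0 -> flat n z = 0.
Proof. by move=> z0; rewrite /flat ltNge z0. Qed.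

(** One term of the exponential series at [z^-1] already dominates the power of [z^-1], and its
    degree is free. This is the vanishing of infinite order at [0]. *)
Lemma flat_pow_bound n k z : 0 <= z -> flat n z <= (n + k).+1`!%:R * z ^+ k.+1.
Proof.
rewrite le_eqVlt => /predU1P[<-|z0].
  by rewrite flat_le0// mulr_ge0 ?exprn_ge0.
rewrite /flat z0 expRN; set y := z^-1.
have y0 : 0 < y by rewrite invr_gt0.
have := expR_ge1Dxn (n + k) (ltW y0).
set F := _`!%:R; have F0 : 0 < F :> R by rewrite ltr0n fact_gt0.
move=> h; have hy : y ^+ (n + k).+1 <= F * expR y.
  by rewrite -ler_pdivrMl// mulrC; apply: le_trans h; rewrite lerDr.
rewrite ler_pdivrMr ?expR_gt0// -mulrA [_ * expR y]mulrC mulrA -ler_pdivrMr ?exprn_gt0//.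
by rewrite -exprVn -/y -exprD addnS.
Qed.

Lemma flat_le1 z : flat 0 z <= 1.
Proof.
rewrite /flat; case: ifPn => // z0.
by rewrite expr0 mul1r expR_le1 oppr_le0 invr_ge0 ltW.
Qed.

Lemma flat1_le1 z : flat 1 z <= 1.
Proof.
rewrite /flat; case: ifPn => // z0; rewrite expr1 expRN ler_pdivrMr ?expR_gt0// mul1r.
by apply: le_trans (expR_ge1Dx _); rewrite lerDr.
Qed.

(** The family is closed under differentiation, which is how smoothness is obtained for all orders
    at once. At [0] the difference quotient is controlled by the quadratic case of
    [flat_pow_bound]. *)
Lemma is_derive_flat n (z : R) : is_derive z 1 (flat n) (- n%:R * flat n.+1 z + flat n.+2 z).
Proof.
have [z0|z0|->] := ltrgtP z 0.
- apply: (@near_eq_is_derive _ _ _ (cst 0)).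
    near=> y; rewrite flat_le0//; apply/ltW; near: y; exact: (lt_nbhsl z0).
  rewrite !flat_le0 ?ltW// mulr0 addr0; exact: is_derive_cst.
- have nE : \near z, (fun y => y^-1 ^+ n * expR (- y^-1)) z = flat n z.
    by near=> y; rewrite /flat ifT//; near: y; exact: (lt_nbhsr z0).
  apply: near_eq_is_derive nE _.
  have zn : z != 0 by rewrite gt_eqF.
  have hV : is_derive z 1 (fun y : R => y^-1) (- z ^- 2).
    have := @is_deriveV R id z 1 1 zn (is_derive_id z 1).
    by move=> h; apply: is_derive_eq h _; rewrite /GRing.scale/= mulr1.
  rewrite /flat z0.
  have hX : is_derive z 1 (fun y : R => y^-1 ^+ n) (n%:R * z^-1 ^+ n.-1 * - z ^- 2).
    have := @is_deriveX _ _ (fun y : R => y^-1) n z 1 _ hV; rewrite exprfctE.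
    move=> h; exact: is_derive_eq h _.
  have hE : is_derive z 1 (fun y : R => expR (- y^-1)) (expR (- z^-1) * z ^- 2).
    have h := is_deriveN hV.
    have := @is_derive1_comp _ expR (fun y : R => - y^-1) z _ _ (is_derive_expR _) h.
    by move=> {}h; apply: is_derive_eq h _; rewrite opprK.
  have := is_deriveM hX hE; rewrite mulrfctE => h; apply: is_derive_eq h _.
  rewrite /GRing.scale/= -!exprVn.
  by case: (n) => [|k] /=; rewrite ?exprS; ring.
- rewrite !flat_le0// mulr0 addr0.
  apply/is_derive1_caratheodory; exists (fun y => flat n y / y); split.
  + move=> y; rewrite (flat_le0 n (lexx 0)) !subr0; have [->|y0] := eqVneq y 0.
      by rewrite flat_le0// mulr0.
    by rewrite mulfVK.
  + rewrite /prop_for /continuous_at; apply/(@cvgrPdist_le _ R^o) => e e0; near=> y.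
    rewrite invr0 mulr0 sub0r normrN normrM normfV ger0_norm ?flat_ge0//.
    have [y0|y0] := leP y 0; first by rewrite flat_le0// mul0r ltW.
    rewrite gtr0_norm// ler_pdivrMr//.
    apply: (le_trans (flat_pow_bound n 1 (ltW y0))); rewrite expr2 mulrA ler_pM2r//.
    rewrite -ler_pdivlMl ?ltr0n ?fact_gt0//; apply/ltW; near: y; apply: lt_nbhsl.
    by apply: mulr_gt0 => //; rewrite invr_gt0 ltr0n fact_gt0.
  + by rewrite invr0 mulr0.
Unshelve. all: by end_near. Qed.

Lemma continuous_flat n : continuous (flat n).
Proof.
move=> z; apply/differentiable_continuous/derivable1_diffP.
by case: (is_derive_flat n z).
Qed.

End FlatFunction.

Section SmoothExpressions.
Context {R : realType}.
Local Notation pt := (@pt R).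

(* A small calculus closed under the four partial derivatives; [TSin k b] is
   [sin (k . (t, x) + b)] and [TFlat n N tau] is [flat n (N (tau - t))]. *)
Inductive texp :=
  | TCst of R
  | TSin of R * pt & R
  | TFlat of nat & R & R
  | TAdd of texp & texp
  | TMul of texp & texp.

Definition tlin (k : R * pt) (t : R) (x : pt) : R :=
  k.1 * t + k.2.1 * x.1 + k.2.2.1 * x.2.1 + k.2.2.2 * x.2.2.

Definition tcoef (j : nat) (k : R * pt) : R :=
  match j with 0%N => k.1 | 1%N => k.2.1 | 2%N => k.2.2.1 | _ => k.2.2.2 end.

Fixpoint tev (e : texp) (t : R) (x : pt) : R :=
  match e with
  | TCst r => r
  | TSin k b => sin (tlin k t x + b)
  | TFlat n N tau => flat n (N * (tau - t))
  | TAdd e1 e2 => tev e1 t x + tev e2 t x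
  | TMul e1 e2 => tev e1 t x * tev e2 t x
  end.

(** A cosine is a sine with its phase advanced by [pi / 2], so one trigonometric constructor is
    enough; [j = 0] is the time derivative, the only one that sees [TFlat]. *)
Fixpoint tder (j : nat) (e : texp) : texp :=
  match e with
  | TCst _ => TCst 0
  | TSin k b => TMul (TCst (tcoef j k)) (TSin k (b + pi / 2))
  | TFlat n N tau => if j is 0%N then
      TMul (TCst (- N)) (TAdd (TMul (TCst (- n%:R)) (TFlat n.+1 N tau)) (TFlat n.+2 N tau))
      else TCst 0
  | TAdd e1 e2 => TAdd (tder j e1) (tder j e2)
  | TMul e1 e2 => TAdd (TMul (tder j e1) e2) (TMul e1 (tder j e2))
  end.

Let is_derive_sin_lin (a b s : R) :
  is_derive s 1 (fun s => sin (a * s + b)) (a * sin (a * s + b + pi / 2)).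
Proof.
have h : is_derive s 1 (fun s : R => a * s + b) a.
  have := is_deriveD (is_deriveZ a (is_derive_id s 1)) (is_derive_cst b s 1).
  by move=> h; apply: is_derive_eq h _; rewrite /GRing.scale/= mulr1 addr0.
have := @is_derive1_comp _ sin (fun s : R => a * s + b) s _ _ (is_derive_sin _) h.
by move=> {}h; apply: is_derive_eq h _; rewrite sinDpihalf mulrC.
Qed.

Lemma is_derive_tev0 (e : texp) (t : R) (x : pt) :
  is_derive t 1 (fun s => tev e s x) (tev (tder 0 e) t x).
Proof.
elim: e => [r|k b|n N tau|e1 h1 e2 h2|e1 h1 e2 h2] /=.
- exact: is_derive_cst.
- rewrite (_ : (fun s => _) = (fun s => sin (k.1 * s +
    (k.2.1 * x.1 + k.2.2.1 * x.2.1 + k.2.2.2 * x.2.2 + b)))); last first.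
    by apply/funext => s; rewrite /tlin !addrA.
  by apply: is_derive_eq (is_derive_sin_lin _ _ _) _; rewrite /tlin !addrA.
- have h : is_derive t 1 (fun s : R => N * (tau - s)) (- N).
    have := is_deriveZ N (is_deriveB (is_derive_cst tau t 1) (is_derive_id t 1)).
    by move=> h; apply: is_derive_eq h _; rewrite /GRing.scale/= sub0r mulrN1.
  have := @is_derive1_comp _ (flat n) (fun s : R => N * (tau - s)) t _ _ (is_derive_flat n _) h.
  by move=> {}h; apply: is_derive_eq h _; rewrite mulrC.
- exact: is_deriveD.
- have := is_deriveM h1 h2; rewrite mulrfctE => h; apply: is_derive_eq h _.
  by rewrite /GRing.scale/=; ring.
Qed.

Lemma is_derive_tev (e : texp) (i : 'I_3) (t : R) (x : pt) :
  is_derive (0 : R) 1 (fun s => tev e t (shiftx i s x)) (tev (tder i.+1 e) t x).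
Proof.
elim: e => [r|k b|n N tau|e1 h1 e2 h2|e1 h1 e2 h2].
- exact: is_derive_cst.
- rewrite (_ : (fun s => _) = (fun s => sin (tcoef i.+1 k * s + (tlin k t x + b)))); last first.
    apply/funext => s /=; congr sin; rewrite /tlin /shiftx.
    by case: i / (ord3P i) => /=; ring.
  by apply: is_derive_eq (is_derive_sin_lin _ _ _) _; rewrite mulr0 add0r /= addrA.
- exact: is_derive_cst.
- exact: is_deriveD.
- have := is_deriveM h1 h2; rewrite mulrfctE => h; apply: is_derive_eq h _.
  by rewrite /GRing.scale/= shiftx0; ring.
Qed.

Lemma continuous_tev (e : texp) : continuous (fun p : R * pt => tev e p.1 p.2).
Proof.
elim: e => [r|k b|n N tau|e1 h1 e2 h2|e1 h1 e2 h2] /= p.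
- exact: cvg_cst.
- apply: (@continuous_comp _ _ _ (fun p : R * pt => tlin k p.1 p.2 + b) sin); last exact: continuous_sin.
  have c1 : (fun p : R * pt => p.1) @ p --> p.1 by exact: cvg_fst.
  have c2 : (fun p : R * pt => p.2) @ p --> p.2 by exact: cvg_snd.
  have c3 : (fun p : R * pt => p.2.1) @ p --> p.2.1 by apply: cvg_comp c2 _; exact: cvg_fst.
  have c4 : (fun p : R * pt => p.2.2) @ p --> p.2.2 by apply: cvg_comp c2 _; exact: cvg_snd.
  have c5 : (fun p : R * pt => p.2.2.1) @ p --> p.2.2.1 by apply: cvg_comp c4 _; exact: cvg_fst.
  have c6 : (fun p : R * pt => p.2.2.2) @ p --> p.2.2.2 by apply: cvg_comp c4 _; exact: cvg_snd.
  rewrite /tlin; apply: cvgD; last exact: cvg_cst.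
  by apply: cvgD; [apply: cvgD; [apply: cvgD|]|]; apply: cvgM => //; exact: cvg_cst.
- apply: (@continuous_comp _ _ _ (fun p : R * pt => N * (tau - p.1)) (flat n)).
    apply: cvgM; first exact: cvg_cst.
    by apply: cvgB; [exact: cvg_cst|exact: cvg_fst].
  exact: continuous_flat.
- by apply: cvgD; [exact: h1|exact: h2].
- by apply: cvgM; [exact: h1|exact: h2].
Qed.

Lemma dir_tev (j : 'I_4) (e : texp) : dir j (tev e) = tev (tder j e).
Proof.
have dxE (i : 'I_3) : dx i (tev e) = tev (tder i.+1 e).
  apply/funext => t; apply/funext => x; rewrite /dx derive1E.
  by have h := is_derive_tev e i t x; rewrite derive_val.
rewrite /dir; case: j => -[|[|[|[|j]]]] jP //=; try exact: dxE.
apply/funext => t; apply/funext => x; rewrite /dt derive1E.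
by have h := is_derive_tev0 e t x; rewrite derive_val.
Qed.

(** Iterated partial derivatives of an expression are again expressions, so all orders reduce to
    continuity and first derivatives of [tev]. *)
Lemma smooth_tev (e : texp) : smooth (tev e).
Proof.
move=> js /=.
have [e' ->] : exists e', foldr dir (tev e) js = tev e'.
  elim: js => [|j js [e' IH]] /=; first by exists e.
  by exists (tder j e'); rewrite IH dir_tev.
split; first exact: continuous_tev.
move=> j t x; rewrite /derivable_dir; case: j => -[|[|[|[|j]]]] jP //=.
- by case: (is_derive_tev0 e' t x).
- by case: (is_derive_tev e' (@Ordinal 3 0 isT) t x).
- by case: (is_derive_tev e' (@Ordinal 3 1 isT) t x).
- by case: (is_derive_tev e' (@Ordinal 3 2 isT) t x).
Qed.

(* No cutoff in time, and every linear form is annihilated by [d_t + c d_i]. *)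
Fixpoint transported (i : 'I_3) (c : R) (e : texp) : Prop :=
  match e with
  | TCst _ => True
  | TSin k _ => k.1 + c * tcoef i.+1 k = 0
  | TFlat _ _ _ => False
  | TAdd e1 e2 | TMul e1 e2 => transported i c e1 /\ transported i c e2
  end.

Lemma transportedP i c (e : texp) (t : R) (x : pt) : transported i c e ->
  tev (tder 0 e) t x + c * tev (tder i.+1 e) t x = 0.
Proof.
elim: e => [r|k b|n N tau|e1 h1 e2 h2|e1 h1 e2 h2] //=.
- by rewrite mulr0 addr0.
- by move=> h; rewrite mulrA -mulrDl h mul0r.
- move=> [/h1 {}h1 /h2 {}h2]; rewrite -[RHS](addr0 0) -{1}h1 -h2; ring.
- move=> [/h1 {}h1 /h2 {}h2].
  rewrite [LHS](_ : _ = (tev (tder 0 e1) t x + c * tev (tder i.+1 e1) t x) * tev e2 t x +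
    tev e1 t x * (tev (tder 0 e2) t x + c * tev (tder i.+1 e2) t x)); last by ring.
  by rewrite h1 h2 mul0r mulr0 addr0.
Qed.

Lemma bm_tev i c (e : texp) : transported i c e -> bounded_meas (fun p : R * pt => tev e p.1 p.2).
Proof.
elim: e => [r|k b|n N tau|e1 h1 e2 h2|e1 h1 e2 h2] //=.
- by move=> _; exact: bm_cst.
- move=> _; split; last by exists 1 => p; exact: sin_max.
  apply: measurableT_comp; first exact: (continuous_measurable_fun (@continuous_sin R)).
  have m2 : measurable_fun setT (fun p : R * pt => p.2) by exact: measurable_snd.
  have m3 : measurable_fun setT (fun p : R * pt => p.2.1) by exact: (measurableT_comp measurable_fst m2).
  have m4 : measurable_fun setT (fun p : R * pt => p.2.2) by exact: (measurableT_comp measurable_snd m2).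
  have m5 : measurable_fun setT (fun p : R * pt => p.2.2.1) by exact: (measurableT_comp measurable_fst m4).
  have m6 : measurable_fun setT (fun p : R * pt => p.2.2.2) by exact: (measurableT_comp measurable_snd m4).
  rewrite /tlin; apply: measurable_funD; last exact: measurable_cst.
  by do 3?[apply: measurable_funD]; apply: measurable_funM => //; exact: measurable_cst.
- by move=> [/h1 ? /h2 ?]; exact: bmD.
- by move=> [/h1 ? /h2 ?]; exact: bmM.
Qed.

Lemma transported_tder i c j (e : texp) : transported i c e -> transported i c (tder j e).
Proof.
elim: e => [r|k b|n N tau|e1 h1 e2 h2|e1 h1 e2 h2] //=.
- by move=> [/h1 ? /h2 ?].
- by move=> [/[dup] ? /h1 ? /[dup] ? /h2 ?].
Qed.

(** The time derivative is again a transported expression, hence bounded, and the mean value theorem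
    applies. *)
Lemma tev_lip i c (e : texp) : transported i c e ->
  exists2 B, 0 <= B & forall (t s : R) (x : pt), `|tev e t x - tev e s x| <= B * `|t - s|.
Proof.
move=> he; have [_ [B hB]] := bm_tev (transported_tder 0 he).
have B0 : 0 <= B by exact: le_trans (hB (0, (0, (0, 0)))).
exists B => //.
have key t s x : s <= t -> `|tev e t x - tev e s x| <= B * `|t - s|.
  move=> st; have [||r _ ->] := @MVT_segment _ (fun s => tev e s x) (fun s => tev (tder 0 e) s x) s t st.
  - by move=> r _; exact: is_derive_tev0.
  - apply: continuous_subspaceT => r.
    apply/differentiable_continuous/derivable1_diffP; by case: (is_derive_tev0 e r x).
  - by rewrite normrM ler_wpM2r//; exact: (hB (r, x)).
move=> t s x; have [st|/ltW ts] := leP s t; first exact: key.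
by rewrite distrC [`|t - s|]distrC; exact: key.
Qed.

End SmoothExpressions.

Lemma bm_Rintegral_cvg d (T : measurableType d) (R : realType)
    (mu : {measure set T -> \bar R}) (D : set T) (F_ : nat -> T -> R) (F : T -> R) (C : R) :
  finite_domain mu D -> (forall n, bounded_meas (F_ n)) -> bounded_meas F ->
  (forall n x, `|F_ n x| <= C) -> {ae mu, forall x, D x -> F_ ^~ x @ \oo --> F x} ->
  (fun n => Rintegral mu D (F_ n)) @ \oo --> Rintegral mu D F.
Proof.
move=> fD hF_ hF FC cF; have [mD fmD] := fD.
have mE (f : T -> R) : bounded_meas f -> measurable_fun D (EFin \o f).
  by move=> [mf _]; apply/measurable_EFinP/measurable_funTS.
have iC : mu.-integrable D (EFin \o (fun=> C)) by apply: bm_integrable => //; exact: bm_cst.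
have cF' : {ae mu, forall x, D x -> (fun n => (EFin \o F_ n) x) @ \oo --> (EFin \o F) x}.
  apply: filterS cF => x h Dx; apply: cvg_EFin; first exact: nearW.
  exact: h.
have [_ _ h] := @dominated_convergence _ _ _ mu D mD (fun n => EFin \o F_ n) (EFin \o F)
  (EFin \o (fun=> C)) (fun n => mE _ (hF_ n)) (mE _ hF)
  cF' iC
  (aeW _ (fun x n _ => FC n x)).
by apply: fine_cvg; move: h; rewrite (bm_fine fD hF).
Qed.

(** * Functions whose integrals over all boxes vanish *)

Section PiLambda.
Context {R : realType}.
Local Notation pt := (@pt R).

Lemma cint_cvg (F_ : nat -> pt -> R) (F : pt -> R) (C : R) :
  (forall n, bounded_meas (F_ n)) -> bounded_meas F ->
  (forall n x, `|F_ n x| <= C) -> {ae mu3, forall x, cube x -> F_ ^~ x @ \oo --> F x} ->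
  (fun n => cint (F_ n)) @ \oo --> cint F.
Proof. exact: (bm_Rintegral_cvg finite_domain_cube). Qed.

Lemma tint_cvg (a b : R) (F_ : nat -> R -> R) (F : R -> R) (C : R) :
  (forall n, bounded_meas (F_ n)) -> bounded_meas F ->
  (forall n x, `|F_ n x| <= C) -> (forall t, a <= t < b -> F_ ^~ t @ \oo --> F t) ->
  (fun n => tint a b (F_ n)) @ \oo --> tint a b F.
Proof.
move=> hF_ hF FC cF; apply: (bm_Rintegral_cvg (finite_domain_itv a b) hF_ hF FC).
by apply: aeW => t; rewrite /= in_itv/=; exact: cF.
Qed.

Lemma bm_indic_comp d (T : measurableType d) (h : pt -> T) (A : set T) :
  measurable_fun setT h -> measurable A -> bounded_meas (fun x => \1_A (h x) : R).
Proof. by move=> mh mA; apply: bm_comp mh; exact: bm_indic. Qed.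

(** The map [h] lets the argument run in one coordinate at a time. The condition [cint Z = 0] stands
    for the whole space, which need not belong to the generator. *)
Lemma cint_pi_lambda d (T : measurableType d) (G : set (set T)) (h : pt -> T) (Z : pt -> R) :
  setI_closed G -> measurable = <<s G >> -> measurable_fun setT h -> bounded_meas Z ->
  (forall A, G A -> cint (fun x => Z x * \1_A (h x)) = 0) -> cint Z = 0 ->
  forall A, measurable A -> cint (fun x => Z x * \1_A (h x)) = 0.
Proof.
move=> GI GE mh bZ hG Z0 A; rewrite GE.
have bZA B : measurable B -> bounded_meas (fun x => Z x * \1_B (h x)).
  by move=> mB; apply: bmM => //; exact: bm_indic_comp.
pose H := [set B | measurable B /\ cint (fun x => Z x * \1_B (h x)) = 0].
suff : <<s G >> `<=` H by move=> /[apply] -[].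
apply: lambda_system_subset => //; last first.
  by move=> B GB; split; [rewrite GE; exact: sub_sigma_algebra|exact: hG].
split => //.
- split => //; rewrite -[RHS]Z0; apply: eq_Rintegral => x _.
  by rewrite indicE in_setT mulr1.
- move=> B1 B2 B21 [m1 e1] [m2 e2]; split; first exact: measurableD.
  rewrite -[RHS](subr0 0) -{1}e1 -e2 -cintB; [|exact: bZA|exact: bZA].
  apply: eq_Rintegral => x _; rewrite -mulrBr; congr (_ * _).
  rewrite !indicE in_setD; have [h2|h2] := boolP (h x \in B2); last by rewrite subr0 andbT.
  by rewrite (mem_set (B21 _ (set_mem h2))) subrr.
- move=> F ndF HF.
  have mF : measurable (\bigcup_i F i) by apply: bigcup_measurable => i _; case: (HF i).
  split => //; have [mZ [C ZC]] := bZ.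
  have C0 : 0 <= C by exact: le_trans (ZC (0, (0, 0))).
  have cv : (fun n => cint (fun x => Z x * \1_(F n) (h x))) @ \oo -->
      cint (fun x => Z x * \1_(\bigcup_i F i) (h x)).
    apply: (@cint_cvg (fun n x => Z x * \1_(F n) (h x)) _ C (fun n => bZA _ (HF n).1) (bZA _ mF)).
      move=> n x; rewrite normrM indicE; case: (_ \in _).
        by rewrite normr1 mulr1.
      by rewrite normr0 mulr0.
    apply: aeW => x _; apply: cvgM; first exact: cvg_cst.
    have [[N _ FN]|nF] := pselect ((\bigcup_i F i) (h x)).
      have U : (\bigcup_i F i) (h x) by exists N.
      apply: cvg_near_cst; near=> n.
      have Fn : F n (h x).
        have : (N <= n)%N by near: n; exact: nbhs_infty_ge.
        by move=> /ndF /subsetPset; exact.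
      by rewrite !indicE (mem_set Fn) (mem_set U).
    rewrite (_ : (fun n => _) = (fun=> \1_(\bigcup_i F i) (h x))); first exact: cvg_cst.
    apply/funext => n; rewrite !indicE !memNset// => FN; apply: nF; by exists n.
  have e0 : (fun n => cint (fun x => Z x * \1_(F n) (h x))) = fun=> 0.
    by apply/funext => n; case: (HF n).
  rewrite e0 in cv.
  exact: (cvg_unique _ cv (@cvg_cst _ _ _ _ _)).
Unshelve. all: by end_near. Qed.

(** Half-lines rather than intervals, because these are what the smooth cutoffs converge to inside
    the cell. *)
Definition ray_box (p x : pt) : R :=
  \1_(`]p.1, +oo[) x.1 * (\1_(`]p.2.1, +oo[) x.2.1 * \1_(`]p.2.2, +oo[) x.2.2).

(** Rays are replaced by Borel sets one coordinate after the other ([s1] to [s3]), then rectangles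
    by product-measurable sets ([s4], [s5]), so that finally the set where [Z] is positive may be
    inserted. *)
Lemma cint_ray_box_eq0 (Z : pt -> R) : bounded_meas Z ->
  (forall p, cint (fun x => Z x * ray_box p x) = 0) ->
  {ae mu3, forall x, cube x -> Z x = 0}.
Proof.
move=> bZ hZ.
pose c1 (x : pt) : R := x.1; pose c2 (x : pt) : R := x.2.1; pose c3 (x : pt) : R := x.2.2.
have mc1 : measurable_fun setT c1 by exact: measurable_fst.
have ms : measurable_fun setT (snd : pt -> R * R) by exact: measurable_snd.
have mc2 : measurable_fun setT c2 by exact: (measurableT_comp measurable_fst ms).
have mc3 : measurable_fun setT c3 by exact: (measurableT_comp measurable_snd ms).
(* The bound [-1 < h x] makes the ray starting at [-1] contain the image of the whole cell, which
   supplies the vanishing of the integral of [Y] itself. *)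
have rays (h : pt -> R) (Y : pt -> R) : measurable_fun setT h -> bounded_meas Y ->
    (forall x, cube x -> -1 < h x) ->
    (forall q, cint (fun x => Y x * \1_(`]q, +oo[) (h x)) = 0) ->
    forall A : set R, measurable A -> cint (fun x => Y x * \1_A (h x)) = 0.
  move=> mh bY h1 hY; apply: (@cint_pi_lambda _ _ (@RGenOInfty.G R)) => //.
  - move=> _ _ [a ->] [b ->]; exists (Num.max a b).
    by apply/seteqP; split => x /=; rewrite !in_itv/= !andbT gt_max => /andP.
  - exact: RGenOInfty.measurableE.
  - by move=> _ [a ->]; exact: hY.
  - rewrite -[RHS](hY (-1)); apply: eq_Rintegral => x; rewrite inE => /h1 hx.
    by rewrite indicE mem_set ?mulr1//= in_itv/= hx.
have bI (h : pt -> R) (A : set R) : measurable_fun setT h -> measurable A ->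
  bounded_meas (fun x => \1_A (h x) : R) by exact: bm_indic_comp.
have cube_gt x : cube x -> [/\ -1 < c1 x, -1 < c2 x & -1 < c3 x].
  by move=> [/= + [/=]]; rewrite /= !in_itv/= => /andP[? _] /andP[? _] /andP[? _];
    split; rewrite /c1 /c2 /c3; lra.
have mray (q : R) : measurable (`]q, +oo[%classic : set R) by exact: measurable_itv.
have s1 (A : set R) q2 q3 : measurable A ->
    cint (fun x => Z x * \1_(`]q2, +oo[) (c2 x) * \1_(`]q3, +oo[) (c3 x) * \1_A (c1 x)) = 0.
  apply: rays => //; first by do 2?[apply: bmM => //]; exact: bI.
    by move=> x /cube_gt[].
  move=> q1; rewrite -(hZ (q1, (q2, q3))); apply: eq_Rintegral => x _.
  by rewrite /ray_box /c1 /c2 /c3 /=; ring.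
have s2 (A B : set R) q3 : measurable A -> measurable B ->
    cint (fun x => Z x * \1_A (c1 x) * \1_(`]q3, +oo[) (c3 x) * \1_B (c2 x)) = 0.
  move=> mA; apply: rays => //; first by do 2?[apply: bmM => //]; exact: bI.
    by move=> x /cube_gt[].
  by move=> q2; rewrite -(s1 A q2 q3 mA); apply: eq_Rintegral => x _; ring.
have s3 (A B C : set R) : measurable A -> measurable B -> measurable C ->
    cint (fun x => Z x * \1_A (c1 x) * \1_B (c2 x) * \1_C (c3 x)) = 0.
  move=> mA mB; apply: rays => //; first by do 2?[apply: bmM => //]; exact: bI.
    by move=> x /cube_gt[].
  by move=> q3; rewrite -(s2 A B q3 mA mB); apply: eq_Rintegral => x _; ring.
have rect d1 d2 (T1 : measurableType d1) (T2 : measurableType d2) :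
    setI_closed [set A `*` B | A in (measurable : set (set T1)) & B in (measurable : set (set T2))].
  move=> _ _ [A mA [B mB <-]] [A' mA' [B' mB' <-]].
  exists (A `&` A'); first exact: measurableI.
  by exists (B `&` B'); [exact: measurableI|rewrite setXI].
have indicX (S1 S2 : Type) (A : set S1) (B : set S2) z :
    \1_(A `*` B) z = \1_A z.1 * \1_B z.2 :> R.
  by rewrite !indicE in_setX; case: (_ \in _); case: (_ \in _); rewrite ?mulr1 ?mulr0.
have s4 (A : set R) (B : set (R * R)) : measurable A -> measurable B ->
    cint (fun x => Z x * \1_A (c1 x) * \1_B x.2) = 0.
  move=> mA mB; apply: (cint_pi_lambda (@rect _ _ _ _) (@measurable_prod_measurableType _ _ _ _) ms) mB.
  - by apply: bmM => //; exact: bI.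
  - move=> _ [B1 mB1 [B2 mB2 <-]]; rewrite -(s3 A B1 B2 mA mB1 mB2).
    by apply: eq_Rintegral => x _; rewrite indicX /c2 /c3; ring.
  - rewrite -(s3 A setT setT mA measurableT measurableT).
    by apply: eq_Rintegral => x _; rewrite !indicE !in_setT !mulr1.
have s5 (A : set pt) : measurable A -> cint (fun x => Z x * \1_A x) = 0.
  move=> mA; apply: (cint_pi_lambda (@rect _ _ _ _) (@measurable_prod_measurableType _ _ _ _)
    (@measurable_id _ _ _) bZ) mA.
  - move=> _ [A1 mA1 [A2 mA2 <-]]; rewrite -(s4 A1 A2 mA1 mA2).
    by apply: eq_Rintegral => x _; rewrite indicX mulrA.
  - rewrite -(s4 setT setT measurableT measurableT).
    by apply: eq_Rintegral => x _; rewrite !indicE !in_setT !mulr1.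
have half (Y : pt -> R) : bounded_meas Y ->
    (forall A : set pt, measurable A -> cint (fun x => Y x * \1_A x) = 0) ->
    {ae mu3, forall x, cube x -> Y x <= 0}.
  move=> bY hY; pose A := [set x | 0 < Y x].
  have mA : measurable A.
    rewrite -[X in measurable X]setTI.
    have := @measurable_fun_ltr _ _ R setT (fun=> 0) Y.
    by move=> /(_ (measurable_cst _) bY.1 measurableT [set true]); exact.
  have YA x : Y x * \1_A x = Num.max 0 (Y x).
    rewrite indicE; have [y0|y0] := ltP 0 (Y x).
      by rewrite mem_set ?mulr1//; exact/ltW.
    rewrite memNset ?mulr0// => /=; rewrite /A/= ltNge y0//.
  have h0 := hY A mA; have := cint_eq0_ae _ _ h0.
  move=> h; apply: ae_mu3S (h _ _) => [x hx /hx||x].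
  - by rewrite YA => /eqP; rewrite eq_maxl; exact.
  - by apply: bmM => //; exact: bm_indic.
  - by rewrite YA le_max lexx.
have h1 := half Z bZ s5.
have h2 : {ae mu3, forall x, cube x -> - Z x <= 0}.
  apply: (half _ (bmN bZ)) => A mA; rewrite -oppr0 -(s5 A mA) -mulN1r -cintZ.
    by apply: eq_Rintegral => x _; rewrite mulN1r mulNr.
  by apply: bmM => //; exact: bm_indic.
apply: ae_mu3S (ae_mu3I h1 h2) => x [a b] cx; apply/eqP; rewrite eq_le a//=.
by rewrite -oppr_le0; exact: b.
Qed.

End PiLambda.

(** * Smooth periodic approximations of boxes and the test functions built from them *)

Section BoxCutoffs.
Context {R : realType}.
Local Notation pt := (@pt R).

(* Tends to [0] for [0 <= x < 1/2] and to [1] for [1/2 < x <= 1]. *)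
Definition poly_step (n : nat) (x : R) : R := 1 - (1 - x ^+ n) ^+ (2 ^ n).

Lemma poly_step_itv n x : 0 <= x <= 1 -> 0 <= poly_step n x <= 1.
Proof.
move=> /andP[x0 x1]; have h0 : 0 <= x ^+ n by exact: exprn_ge0.
have h1 : x ^+ n <= 1 by exact: exprn_ile1.
have g0 : 0 <= (1 - x ^+ n) ^+ (2 ^ n) by rewrite exprn_ge0// subr_ge0.
have g1 : (1 - x ^+ n) ^+ (2 ^ n) <= 1 by apply: exprn_ile1; lra.
by rewrite /poly_step; apply/andP; split; lra.
Qed.

Lemma bernoulli_lower (a : R) m : 0 <= a <= 1 -> 1 - m%:R * a <= (1 - a) ^+ m.
Proof.
move=> /andP[a0 a1]; elim: m => [|m IH]; first by rewrite mul0r subr0 expr0.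
rewrite exprS; apply: (le_trans (y := (1 - a) * (1 - m%:R * a))).
  rewrite -natr1; have : 0 <= m%:R * (a * a) by rewrite !mulr_ge0.
  lra.
by rewrite ler_wpM2l// subr_ge0.
Qed.

Lemma bernoulli_upper (a : R) m : 0 <= a <= 1 -> (1 - a) ^+ m * (m%:R * a) <= 1.
Proof.
move=> /andP[a0 a1].
have h : m%:R * a <= (1 + a) ^+ m.
  elim: m => [|m IH]; first by rewrite mul0r expr0.
  have h1 : 1 <= (1 + a) ^+ m by apply: exprn_ege1; lra.
  rewrite exprS mulrDl mul1r -natr1 mulrDl mul1r lerD// -[X in X <= _]mulr1.
  by rewrite ler_wpM2l.
apply: (le_trans (y := (1 - a) ^+ m * (1 + a) ^+ m)).
  by rewrite ler_wpM2l// exprn_ge0// subr_ge0.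
rewrite -exprMn; apply: exprn_ile1.
  by rewrite mulr_ge0// ?subr_ge0// addr_ge0.
by have := sqr_ge0 a; lra.
Qed.

(** The exponents are matched so that [2 ^ n * x ^ n = (2 x) ^ n]: by Bernoulli's inequality the
    subtracted power is at least [1 - (2 x) ^ n] and at most [(2 x) ^ - n], which settles the two
    sides of [1/2]. *)
Lemma poly_step_cvg (x : R) : 0 <= x <= 1 -> x != 2^-1 ->
  (fun n => poly_step n x) @ \oo --> ((2^-1 < x)%R%:R : R).
Proof.
move=> /andP[x0 x1] xn.
have hn n : 0 <= x ^+ n <= 1 by rewrite exprn_ge0//= exprn_ile1.
have [lt|gt|e] := ltrgtP x 2^-1; last by rewrite e eqxx in xn.
- have r1 : `|2 * x| < 1 by rewrite ger0_norm ?mulr_ge0//; lra.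
  apply: (@squeeze_cvgr _ _ _ _ (fun=> 0) (fun n => (2 * x) ^+ n)).
  + near=> n; have /andP[-> _] := poly_step_itv n (introT andP (conj x0 x1)).
    have := bernoulli_lower (2 ^ n) (hn n).
    by rewrite natrX exprMn /poly_step; lra.
  + exact: cvg_cst.
  + exact: cvg_expr.
- have xp : 0 < x by apply: lt_trans gt; rewrite invr_gt0.
  have r1 : `|(2 * x)^-1| < 1.
    by rewrite ger0_norm ?invr_ge0 ?mulr_ge0// invf_lt1 ?mulr_gt0//; lra.
  apply: (@squeeze_cvgr _ _ _ _ (fun n => 1 - (2 * x)^-1 ^+ n) (fun=> 1)).
  + near=> n; have /andP[_ ->] := poly_step_itv n (introT andP (conj x0 x1)); rewrite andbT.
    have := bernoulli_upper (2 ^ n) (hn n).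
    rewrite natrX -exprMn -ler_pdivlMr ?exprn_gt0 ?mulr_gt0// mul1r exprVn /poly_step.
    by lra.
  + rewrite -[X in _ --> X]subr0; apply: cvgB; first exact: cvg_cst.
    exact: cvg_expr.
  + exact: cvg_cst.
Unshelve. all: by end_near. Qed.

(** Each sine changes sign under [y -> y + 1], so the product has period [1]. For [0 <= p < 1] and
    [0 < y < 1] the second sine is positive and the first has the sign of [y - p], so that the value
    [1/2] is crossed exactly at [p]. *)
Definition wave (p y : R) : R := (1 + sin (pi * (y - p)) * sin (pi * y)) / 2.

Lemma wave_itv p y : 0 <= wave p y <= 1.
Proof.
have : `|sin (pi * (y - p)) * sin (pi * y)| <= 1.
  by rewrite normrM -[X in _ <= X]mulr1 ler_pM// sin_max.
by rewrite ler_norml /wave => /andP[h1 h2]; apply/andP; split; lra.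
Qed.

Lemma wave_period p y : wave p (y + 1) = wave p y.
Proof.
rewrite /wave (_ : pi * (y + 1 - p) = pi * (y - p) + pi); last by ring.
by rewrite [pi * (y + 1)]mulrDr mulr1 !sinDpi mulrNN.
Qed.

Lemma wave_gt p y : 0 <= p < 1 -> 0 < y < 1 -> y != p ->
  (wave p y != 2^-1) /\ (2^-1 < wave p y) = (p < y).
Proof.
move=> /andP[p0 p1] /andP[y0 y1] yp; have pi0 := pi_gt0 R.
have sy : 0 < sin (pi * y).
  by apply: sin_gt0_pi; rewrite mulr_gt0//= -[X in _ < X]mulr1 ltr_pM2l.
have [lt|gt|e] := ltrgtP y p; last by rewrite e eqxx in yp.
- have : 0 < sin (pi * (p - y)).
    apply: sin_gt0_pi; rewrite mulr_gt0 ?subr_gt0//= -[X in _ < X]mulr1 ltr_pM2l//; lra.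
  move=> s; have := mulr_gt0 s sy.
  rewrite (_ : pi * (p - y) = - (pi * (y - p))); last by ring.
  rewrite sinN mulNr /wave => h; split; last by apply/negbTE; rewrite -leNgt; lra.
  by rewrite lt_eqF//; lra.
- have : 0 < sin (pi * (y - p)).
    apply: sin_gt0_pi; rewrite mulr_gt0 ?subr_gt0//= -[X in _ < X]mulr1 ltr_pM2l//; lra.
  move=> s; have := mulr_gt0 s sy; rewrite /wave => h; split; last by lra.
  by rewrite gt_eqF//; lra.
Qed.

Definition coord_cutoff n p y := poly_step n (wave p y).

Definition box_cutoff n (p x : pt) : R :=
  coord_cutoff n p.1 x.1 * (coord_cutoff n p.2.1 x.2.1 * coord_cutoff n p.2.2 x.2.2).

Lemma coord_cutoff_itv n p y : 0 <= coord_cutoff n p y <= 1.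
Proof. exact/poly_step_itv/wave_itv. Qed.

Lemma box_cutoff_norm n p x : `|box_cutoff n p x| <= 1.
Proof.
have h q y := andP (coord_cutoff_itv n q y).
by rewrite /box_cutoff !normrM !ger0_norm ?(h _ _).1// !mulr_ile1 ?mulr_ge0 ?(h _ _).1 ?(h _ _).2.
Qed.

Lemma periodic_box_cutoff n p : lattice_periodic (box_cutoff n p).
Proof.
by move=> i x; rewrite /shiftx /box_cutoff /coord_cutoff; case: i / (ord3P i) => /=;
  rewrite wave_period.
Qed.

Fixpoint tpow (e : texp) n : @texp R := if n is k.+1 then TMul e (tpow e k) else TCst 1.

Lemma tev_tpow e n t x : tev (tpow e n) t x = tev e t x ^+ n.
Proof. by elim: n => [|n IH] /=; [rewrite expr0|rewrite exprS IH]. Qed.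

Lemma transported_tpow i c e n : transported i c e -> transported i c (tpow e n).
Proof. by move=> he; elim: n => //= n IH; split. Qed.

Definition tone_minus (e : texp) : @texp R := TAdd (TCst 1) (TMul (TCst (-1)) e).

Definition tstep n (e : texp) : @texp R := tone_minus (tpow (tone_minus (tpow e n)) (2 ^ n)).

(** The linear form [pi x_j], read at the point carried back along the axis [i]: only for [j = i]
    does this add the time term [- pi c t]. *)
Definition twave_vec (i : 'I_3) (c : R) (j : nat) : R * pt :=
  (if val i == j then - (pi * c) else 0,
   (if j == 0%N then pi else 0, (if j == 1%N then pi else 0, if j == 2 then pi else 0))).

Definition twave i c j (p : R) : texp :=
  TMul (TCst 2^-1) (TAdd (TCst 1)
    (TMul (TSin (twave_vec i c j) (- (pi * p))) (TSin (twave_vec i c j) 0))).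

Definition tbox n (p : pt) i c : texp :=
  TMul (tstep n (twave i c 0 p.1))
    (TMul (tstep n (twave i c 1 p.2.1)) (tstep n (twave i c 2 p.2.2))).

Lemma transported_tbox n p i c : transported i c (tbox n p i c).
Proof.
have hw j q : (j < 3)%N -> transported i c (tstep n (twave i c j q)).
  move=> j3; split => //; split => //; apply: transported_tpow.
  split => //; split => //; apply: transported_tpow; split => //; split => //.
  suff h : (twave_vec i c j).1 + c * tcoef i.+1 (twave_vec i c j) = 0 by split.
  by case: i / (ord3P i) => /=; move: j j3 => [|[|[|//]]] _ /=; ring.
by split; [exact: hw|split; exact: hw].
Qed.

Lemma tev_tbox n p i c t x : tev (tbox n p i c) t x = box_cutoff n p (shiftx i (- (c * t)) x).
Proof.
have hs e : tev (tstep n e) t x = poly_step n (tev e t x).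
  by rewrite /tstep /tone_minus /= tev_tpow /= tev_tpow /poly_step !mulN1r.
rewrite /tbox /box_cutoff /coord_cutoff.
change (tev (tstep n (twave i c 0 p.1)) t x * (tev (tstep n (twave i c 1 p.2.1)) t x *
  tev (tstep n (twave i c 2 p.2.2)) t x) = poly_step n (wave p.1 (shiftx i (- (c * t)) x).1) *
  (poly_step n (wave p.2.1 (shiftx i (- (c * t)) x).2.1) *
   poly_step n (wave p.2.2 (shiftx i (- (c * t)) x).2.2))).
have [h1 h2 h3] : [/\ tlin (twave_vec i c 0) t x = pi * (shiftx i (- (c * t)) x).1,
    tlin (twave_vec i c 1) t x = pi * (shiftx i (- (c * t)) x).2.1 &
    tlin (twave_vec i c 2) t x = pi * (shiftx i (- (c * t)) x).2.2].
  by rewrite /tlin /shiftx; case: i / (ord3P i) => /=; split; ring.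
have hw (y q : R) (j : nat) : tlin (twave_vec i c j) t x = pi * y ->
    tev (twave i c j q) t x = wave q y.
  by move=> /= ->; rewrite /wave addr0 -mulrN -mulrDr mulrC.
by rewrite !hs (hw _ _ _ h1) (hw _ _ _ h2) (hw _ _ _ h3).
Qed.

Lemma bm_box_cutoff n p : bounded_meas (box_cutoff n p).
Proof.
have h := bm_tev (transported_tbox n p (@Ordinal 3 0 isT) 0).
have mh : measurable_fun setT (fun x : pt => (0, x) : R * pt) by exact: pair1_measurable.
have -> : box_cutoff n p = (fun x => tev (tbox n p (@Ordinal 3 0 isT) 0) 0 x).
  by apply/funext => x; rewrite tev_tbox mul0r oppr0 shiftx0.
exact: (bm_comp h mh).
Qed.

(** The first factor vanishes from [tau] on, whence the compact support, and for [t < tau] it tends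
    to [1] as [N] grows. The second is a periodic cutoff carried along by the flow. *)
Lemma test_fun_box n p i c N tau : 0 < N ->
  test_fun (fun t x => flat 0 (N * (tau - t)) * box_cutoff n p (shiftx i (- (c * t)) x)).
Proof.
move=> N0; rewrite (_ : (fun t x => _) = tev (TMul (TFlat 0 N tau) (tbox n p i c))); last first.
  by apply/funext => t; apply/funext => x; rewrite -tev_tbox.
split; first exact: smooth_tev.
- move=> j t x; change (flat 0 (N * (tau - t)) * tev (tbox n p i c) t (shiftx j 1 x) =
    flat 0 (N * (tau - t)) * tev (tbox n p i c) t x).
  by rewrite !tev_tbox shiftxC periodic_box_cutoff.
- exists tau => t x ht; change (flat 0 (N * (tau - t)) * tev (tbox n p i c) t x = 0).
  rewrite flat_le0 ?mul0r//.
  by rewrite pmulr_rle0// subr_le0.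
Qed.

(** The transport operator annihilates the carried cutoff, so that only the derivative of the time
    factor survives. *)
Lemma transport_test_fun n p i c N tau t x :
  dt (fun t x => flat 0 (N * (tau - t)) * box_cutoff n p (shiftx i (- (c * t)) x)) t x +
  c * dx i (fun t x => flat 0 (N * (tau - t)) * box_cutoff n p (shiftx i (- (c * t)) x)) t x =
  - (N * flat 2 (N * (tau - t))) * box_cutoff n p (shiftx i (- (c * t)) x).
Proof.
rewrite (_ : (fun t x => _) = tev (TMul (TFlat 0 N tau) (tbox n p i c))); last first.
  by apply/funext => s; apply/funext => y; rewrite -tev_tbox.
set e := TMul _ _.
have -> : dt (tev e) t x = tev (tder 0 e) t x.
  by rewrite -[dt _]/(dir (@Ordinal 4 0 isT) (tev e)) dir_tev.
have -> : dx i (tev e) t x = tev (tder i.+1 e) t x.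
  by rewrite /dx derive1E; have h := is_derive_tev e i t x; rewrite derive_val.
have := transportedP t x (transported_tbox n p i c).
rewrite -tev_tbox /e; move: (tbox n p i c) => b.
change (tev (tder 0 b) t x + c * tev (tder i.+1 b) t x = 0 ->
  (- N * (- 0%:R * flat 1 (N * (tau - t)) + flat 2 (N * (tau - t))) * tev b t x +
    flat 0 (N * (tau - t)) * tev (tder 0 b) t x) +
  c * (0 * tev b t x + flat 0 (N * (tau - t)) * tev (tder i.+1 b) t x) =
  - (N * flat 2 (N * (tau - t))) * tev b t x).
move=> h.
have -> : forall u v w z f, (- N * (- 0%:R * u + v) * w + f * z) +
  c * (0 * w + f * tev (tder i.+1 b) t x) =
  - (N * v) * w + f * (z + c * tev (tder i.+1 b) t x) :> R by move=> *; ring.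
by rewrite h mulr0 addr0.
Qed.

Lemma box_cutoff_lip n p i c : exists2 B, 0 <= B & forall (t s : R) (x : pt),
  `|box_cutoff n p (shiftx i (- (c * t)) x) - box_cutoff n p (shiftx i (- (c * s)) x)|
    <= B * `|t - s|.
Proof.
have [B B0 hB] := tev_lip (transported_tbox n p i c).
by exists B => // t s x; rewrite -!tev_tbox.
Qed.

(** These coordinate planes are where the cutoffs need not converge to the indicator of the box. *)
Lemma ae_coord_neq (j : 'I_3) (a : R) : {ae mu3, forall x : pt, cube x ->
  a != match val j with 0%N => x.1 | 1%N => x.2.1 | _ => x.2.2 end}.
Proof.
pose h (x : pt) : R := match val j with 0%N => x.1 | 1%N => x.2.1 | _ => x.2.2 end.
have ms : measurable_fun setT (snd : pt -> R * R) by exact: measurable_snd.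
have mh : measurable_fun setT h.
  rewrite /h; clear h; case: j / (ord3P j) => /=; first exact: measurable_fst.
    exact: (measurableT_comp measurable_fst ms).
  exact: (measurableT_comp measurable_snd ms).
have b1 : bounded_meas (\1_[set a] : R -> R) by apply: bm_indic; exact: measurable_set1.
have b0 : bounded_meas (fun x => \1_[set a] (h x) : R) by exact: (bm_comp b1).
have t0 : tint 0 1 (\1_[set a]) = 0 :> R.
  rewrite -[RHS](mul0r (1 - 0)) -tint_cst//; apply: eq_tint_ae => //; first exact: bm_cst.
  exists [set a]; split; [exact: measurable_set1|exact: lebesgue_measure_set1|].
  move=> t /=; apply: contra_notP => ta _; rewrite indicE memNset//.
have c0 : cint (fun x => \1_[set a] (h x)) = 0.
  move: b0; rewrite /h; clear mh h; case: j / (ord3P j) => /= b0; rewrite (cintE b0) /=.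
  - rewrite -[RHS]t0; apply: eq_tint => x1 _ _.
    by rewrite !tint_cst// subr0 !mulr1.
  - rewrite -[RHS](mul0r (1 - 0)) -tint_cst//; apply: eq_tint => x1 _ _.
    rewrite -[RHS]t0; apply: eq_tint => x2 _ _.
    by rewrite tint_cst// subr0 mulr1.
  - rewrite -[RHS](mul0r (1 - 0)) -tint_cst//; apply: eq_tint => x1 _ _.
    rewrite -[RHS](mul0r (1 - 0)) -tint_cst//; apply: eq_tint => x2 _ _.
    exact: t0.
have i0 x : 0 <= \1_[set a] (h x) :> R by rewrite indicE.
apply: ae_mu3S (cint_eq0_ae b0 i0 c0) => x hx /hx; apply: contra_eq_neq => e.
have {}e : h x = a by rewrite e.
by rewrite e indicE mem_set//; exact: oner_neq0.
Qed.

Lemma cint_box_cutoff_eq0 (Z : pt -> R) : bounded_meas Z ->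
  (forall n p, cint (fun x => Z x * box_cutoff n p x) = 0) ->
  {ae mu3, forall x, cube x -> Z x = 0}.
Proof.
move=> bZ hZ; apply: cint_ray_box_eq0 => // p.
have [mZ [C ZC]] := bZ.
have C0 : 0 <= C by exact: le_trans (ZC (0, (0, 0))).
(* A ray that starts at or beyond [1] does not meet the cell. *)
have outside : (1 <= p.1) || ((1 <= p.2.1) || (1 <= p.2.2)) ->
    cint (fun x => Z x * ray_box p x) = 0.
  move=> h; rewrite -[RHS]cint_cst; apply: eq_Rintegral => x; rewrite inE.
  move=> [/= + [/=]]; rewrite /= !in_itv/= => /andP[_ a1] /andP[_ a2] /andP[_ a3].
  have z (q y : R) : y < 1 -> 1 <= q -> \1_(`]q, +oo[) y = 0 :> R.
    by move=> y1 q1; rewrite indicE memNset//= in_itv/= andbT; apply/negP; rewrite -leNgt; lra.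
  by rewrite /ray_box; case/or3P: h => h; rewrite (z _ _ _ h)// ?mul0r ?mulr0.
have [/outside//|] := boolP ((1 <= p.1) || ((1 <= p.2.1) || (1 <= p.2.2))).
rewrite !negb_or -!ltNge => /and3P[p1 p2 p3].
(* [wave] detects corners in [[0, 1)] only; raising a negative coordinate to [0] changes the box
   inside the cell by a null set. *)
pose q : pt := (Num.max 0 p.1, (Num.max 0 p.2.1, Num.max 0 p.2.2)).
have mq (r : R) : r < 1 -> 0 <= Num.max 0 r < 1 by move=> r1; rewrite le_max lexx gt_max r1 ltr01.
have bray : bounded_meas (ray_box p).
  have ms : measurable_fun setT (snd : pt -> R * R) by exact: measurable_snd.
  have mi (r : R) : measurable (`]r, +oo[%classic : set R) by exact: measurable_itv.
  apply: bmM; first by apply: bm_indic_comp => //; exact: measurable_fst.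
  apply: bmM; apply: bm_indic_comp => //.
    exact: (measurableT_comp measurable_fst ms).
  exact: (measurableT_comp measurable_snd ms).
have cv : (fun n => cint (fun x => Z x * box_cutoff n q x)) @ \oo --> cint (fun x => Z x * ray_box p x).
  apply: (@cint_cvg _ (fun n x => Z x * box_cutoff n q x) _ C).
  - by move=> n; apply: bmM => //; exact: bm_box_cutoff.
  - exact: bmM.
  - by move=> n x; rewrite normrM -[X in _ <= X]mulr1 ler_pM// box_cutoff_norm.
  have N0 j := ae_coord_neq j 0.
  have N1 := ae_coord_neq (@Ordinal 3 0 isT) (Num.max 0 p.1).
  have N2 := ae_coord_neq (@Ordinal 3 1 isT) (Num.max 0 p.2.1).
  have N3 := ae_coord_neq (@Ordinal 3 2 isT) (Num.max 0 p.2.2).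
  apply: ae_mu3S (ae_mu3I (ae_mu3I (N0 (@Ordinal 3 0 isT)) (ae_mu3I (N0 (@Ordinal 3 1 isT)) (N0 (@Ordinal 3 2 isT))))
    (ae_mu3I N1 (ae_mu3I N2 N3))).
  move=> x [[n1 [n2 n3]] [m1 [m2 m3]]] cx.
  have {}n1 : 0 != x.1 := n1 cx. have {}n2 : 0 != x.2.1 := n2 cx. have {}n3 : 0 != x.2.2 := n3 cx.
  have {}m1 : Num.max 0 p.1 != x.1 := m1 cx. have {}m2 : Num.max 0 p.2.1 != x.2.1 := m2 cx.
  have {}m3 : Num.max 0 p.2.2 != x.2.2 := m3 cx.
  move: cx => [/= + [/=]]; rewrite /= !in_itv/= => /andP[a1 b1] /andP[a2 b2] /andP[a3 b3].
  have one (r y : R) : r < 1 -> 0 <= y -> y < 1 -> 0 != y -> Num.max 0 r != y ->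
      (fun n => coord_cutoff n (Num.max 0 r) y) @ \oo --> (\1_(`]r, +oo[) y : R).
    move=> r1 y0 y1 yn yr; have yp : 0 < y by rewrite lt_neqAle yn.
    have [w1 w2] := wave_gt (mq r r1) (introT andP (conj yp y1)) (negbT (etrans (eq_sym _ _) (negbTE yr))).
    have := poly_step_cvg (wave_itv (Num.max 0 r) y) w1; rewrite w2 gt_max yp/=.
    by rewrite indicE mem_setE in_itv/= andbT.
  apply: cvgM; first exact: cvg_cst.
  by apply: cvgM; [exact: one|apply: cvgM; exact: one].
have e0 : (fun n => cint (fun x => Z x * box_cutoff n q x)) = fun=> 0.
  by apply/funext => n; exact: hZ.
rewrite e0 in cv.
exact: (cvg_unique _ cv (@cvg_cst _ _ _ _ _)).
Qed.

End BoxCutoffs.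

(** * From the weak formulation to mild solutions *)

Section FlatLimits.
Context {R : realType}.

Lemma flat_le_fact n (z : R) : flat n z <= n`!%:R.
Proof.
rewrite /flat; case: ifPn => // z0; rewrite expRN; set y := z^-1.
have y0 : 0 < y by rewrite invr_gt0.
rewrite ler_pdivrMr ?expR_gt0//; case: n => [|n].
  by rewrite expr0 mul1r; apply: le_trans (expR_ge1Dx _); rewrite lerDl ltW.
have := expR_ge1Dxn n (ltW y0); set F := _`!%:R; have F0 : 0 < F :> R by rewrite ltr0n fact_gt0.
by move=> h; rewrite -ler_pdivrMl// mulrC; apply: le_trans h; rewrite lerDr.
Qed.

(** Used with [z = N * (tau - t)]: a factor [tau - t] turns the concentrating kernel [N * flat 2]
    into [flat 1], whose integral tends to [0]. *)
Lemma flat_recr n (z : R) : z * flat n.+1 z = flat n z.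
Proof.
rewrite /flat; case: ifPn => [z0|]; last by rewrite mulr0.
by rewrite exprS !mulrA divff ?mul1r// gt_eqF.
Qed.

Lemma bm_flat_comp n (N tau : R) : bounded_meas (fun t : R => flat n (N * (tau - t))).
Proof.
split; last first.
  by exists n`!%:R => t; rewrite ger0_norm ?flat_ge0// flat_le_fact.
apply: (measurableT_comp (continuous_measurable_fun (@continuous_flat _ n))).
apply: measurable_funM; first exact: measurable_cst.
by apply: measurable_funB => //; exact: measurable_cst.
Qed.

Lemma flat0_cvg (u : R) : 0 < u -> (fun k : nat => flat 0 (k.+1%:R * u)) @ \oo --> (1 : R).
Proof.
move=> u0; apply: (@squeeze_cvgr _ _ _ _ (fun k => 1 - u^-1 * harmonic k) (fun=> 1)).
- near=> k; rewrite flat_le1 andbT /flat pmulr_rgt0// u0 expr0 mul1r.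
  by apply: le_trans (expR_ge1Dx _); rewrite invfM [u^-1 * _]mulrC.
- rewrite -[X in _ --> X]subr0 -(mulr0 u^-1); apply: cvgB; first exact: cvg_cst.
  by apply: cvgM; [exact: cvg_cst|exact: cvg_harmonic].
- exact: cvg_cst.
Unshelve. all: by end_near. Qed.

Lemma flat1_cvg (u : R) : 0 < u -> (fun k : nat => flat 1 (k.+1%:R * u)) @ \oo --> (0 : R).
Proof.
move=> u0; apply: (@squeeze_cvgr _ _ _ _ (fun=> 0) (fun k => u^-1 * harmonic k)).
- near=> k; rewrite flat_ge0/= /flat pmulr_rgt0// u0 expr1 invfM [u^-1 * _]mulrC.
  rewrite -[X in _ <= X]mulr1 ler_wpM2l ?mulr_ge0 ?invr_ge0 ?(ltW u0)//.
  by rewrite expR_le1 oppr_le0 mulr_ge0 ?invr_ge0 ?(ltW u0).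
- exact: cvg_cst.
- rewrite -(mulr0 u^-1); by apply: cvgM; [exact: cvg_cst|exact: cvg_harmonic].
Unshelve. all: by end_near. Qed.

(** The integrand is the derivative of [- flat 0 (N * (tau - t))]; as [N] grows it becomes a unit
    mass concentrated just before [tau]. *)
Lemma tint_flat2 (N tau : R) : 0 < tau ->
  tint 0 tau (fun t => N * flat 2 (N * (tau - t))) = flat 0 (N * tau).
Proof.
move=> tau0; pose F t := - flat 0 (N * (tau - t)).
have cf : continuous (fun t : R => N * flat 2 (N * (tau - t))).
  move=> t; apply: cvgM; first exact: cvg_cst.
  apply: (@continuous_comp _ _ _ (fun t : R => N * (tau - t)) (flat 2)); last exact: continuous_flat.
  apply: cvgM; first exact: cvg_cst.
  by apply: cvgB; [exact: cvg_cst|exact: cvg_id].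
have dF (t : R) : is_derive t 1 F (N * flat 2 (N * (tau - t))).
  have h := is_deriveN (is_derive_tev0 (TFlat 0 N tau) t (0, (0, 0))).
  apply: is_derive_eq h _.
  change (- (- N * (- 0%:R * flat 1 (N * (tau - t)) + flat 2 (N * (tau - t)))) =
    N * flat 2 (N * (tau - t))).
  by rewrite oppr0 mul0r add0r mulNr opprK.
have cF : continuous F.
  by move=> t; apply/differentiable_continuous/derivable1_diffP; case: (dF t).
have := @continuous_FTC2 _ (fun t => N * flat 2 (N * (tau - t))) F 0 tau tau0
  (continuous_subspaceT cf) _ _.
move=> /(_ _ _) h; rewrite /tint Rintegral_itv_bndo_bndc; last first.
  apply: (bm_integrable (finite_domain_itv 0 tau)); apply: bmM; first exact: bm_cst.
  exact: bm_flat_comp.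
rewrite /Rintegral h.
- by rewrite /F/= subrr mulr0 flat_le0// oppr0 sub0r opprK addr0.
- split; first by move=> t _; case: (dF t).
    by apply: cvg_at_right_filter; exact: cF.
  by apply: cvg_at_left_filter; exact: cF.
- by move=> t _; rewrite derive1E; have d := dF t; rewrite derive_val.
Qed.

End FlatLimits.

Lemma cvg_scalel (R : realType) (k l : R) (u : nat -> R) :
  u @ \oo --> l -> (fun n => k * u n) @ \oo --> k * l.
Proof. by move=> h; apply: cvgM => //; exact: cvg_cst. Qed.

Lemma cvg_scaler (R : realType) (k l : R) (u : nat -> R) :
  u @ \oo --> l -> (fun n => u n * k) @ \oo --> l * k.
Proof. by move=> h; apply: cvgM => //; exact: cvg_cst. Qed.

Section WeakMild.
Context {R : realType}.
Local Notation pt := (@pt R).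
Variables (i : 'I_3) (e tau : R) (W S : R * pt -> R) (W0 : pt -> R).
Hypothesis tau0 : 0 < tau.
Hypotheses (bW : bounded_meas W) (bS : bounded_meas S) (bW0 : bounded_meas W0).
Hypotheses (pW : forall t, lattice_periodic (fun x => W (t, x))) (pS : forall t, lattice_periodic (fun x => S (t, x)))
  (pW0 : lattice_periodic W0).
Hypothesis W_cont : forall eps : R, 0 < eps -> exists2 delta : R, 0 < delta &
  forall t, 0 <= t -> t < tau -> tau - t < delta ->
    cint (fun x => `|W (t, x) - W (tau, x)|) <= eps.
Hypothesis weak : forall n p (N : R), 0 < N ->
  tint 0 tau (fun t => cint (fun x => W (t, x) *
    (- (N * flat 2 (N * (tau - t))) * box_cutoff n p (shiftx i (- (e * t)) x)))) +
  cint (fun x => flat 0 (N * (tau - 0)) * box_cutoff n p (shiftx i (- (e * 0)) x) * W0 x) +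
  tint 0 tau (fun t => cint (fun x => S (t, x) *
    (flat 0 (N * (tau - t)) * box_cutoff n p (shiftx i (- (e * t)) x)))) = 0.

Section Cutoff.
Variables (n : nat) (p : pt).
Let b (z : R * pt) := box_cutoff n p (shiftx i (- (e * z.1)) z.2).

Let bb : bounded_meas b.
Proof.
have := bm_tev (transported_tbox n p i e); congr bounded_meas.
by apply/funext => z; rewrite tev_tbox.
Qed.

Let at_ (F : R * pt -> R) t : bounded_meas F -> bounded_meas (fun x => F (t, x)).
Proof. by move=> bF; apply: (bm_comp bF); exact: pair1_measurable. Qed.

Let A t := cint (fun x => W (t, x) * b (t, x)).
Let B t := cint (fun x => S (t, x) * b (t, x)).
Let A0 := cint (fun x => W0 x * box_cutoff n p x).

Let bA : bounded_meas A. Proof. exact: (bm_cint (bmM bW bb)). Qed.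
Let bB : bounded_meas B. Proof. exact: (bm_cint (bmM bS bb)). Qed.

Let weakE (N : R) : 0 < N ->
  tint 0 tau (fun t => N * flat 2 (N * (tau - t)) * A t) =
  flat 0 (N * tau) * A0 + tint 0 tau (fun t => flat 0 (N * (tau - t)) * B t).
Proof.
move=> N0; have := weak n p N0.
have -> : tint 0 tau (fun t => cint (fun x => W (t, x) *
    (- (N * flat 2 (N * (tau - t))) * box_cutoff n p (shiftx i (- (e * t)) x)))) =
    -1 * tint 0 tau (fun t => N * flat 2 (N * (tau - t)) * A t).
  rewrite -tintZ; last first.
    by apply: bmM => //; apply: bmM; [exact: bm_cst|exact: bm_flat_comp].
  apply: eq_tint => t _ _; rewrite -cintZ; last exact: (at_ _ (bmM bW bb)).
  rewrite -cintZ; last by apply: bmM; [exact: bm_cst|exact: (at_ _ (bmM bW bb))].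
  by apply: eq_Rintegral => x _; rewrite /b /=; ring.
have -> : cint (fun x => flat 0 (N * (tau - 0)) * box_cutoff n p (shiftx i (- (e * 0)) x) * W0 x) =
    flat 0 (N * tau) * A0.
  rewrite -cintZ; last by apply: bmM => //; exact: bm_box_cutoff.
  by apply: eq_Rintegral => x _; rewrite mulr0 oppr0 shiftx0 addr0; ring.
have -> : tint 0 tau (fun t => cint (fun x => S (t, x) *
    (flat 0 (N * (tau - t)) * box_cutoff n p (shiftx i (- (e * t)) x)))) =
    tint 0 tau (fun t => flat 0 (N * (tau - t)) * B t).
  apply: eq_tint => t _ _; rewrite -cintZ; last exact: (at_ _ (bmM bS bb)).
  by apply: eq_Rintegral => x _; rewrite /b /=; ring.
by move/eqP; rewrite mulN1r -[X in X == _]addrA [X in X == _]addrC subr_eq0 => /eqP <-.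
Qed.

(** Close to [tau] continuity in the mean gives [eps] and the motion of the cutoff a linear term;
    far from [tau] the crude bound [2 * C] is absorbed into [2 * C / delta * (tau - t)]. The linear
    form is the one that [flat_recr] can integrate. *)
Let A_cont (eps : R) : 0 < eps -> exists2 K : R, 0 <= K & forall t, 0 <= t < tau ->
  `|A t - A tau| <= eps + K * (tau - t).
Proof.
move=> eps0; have e2 : 0 < eps by [].
have [delta d0 hd] := W_cont e2.
have [_ [C hAC]] := bA; have C0 : 0 <= C by exact: le_trans (hAC 0).
have [L L0 hL] := box_cutoff_lip n p i e.
have [_ [CW WC]] := bW; have CW0 : 0 <= CW by exact: le_trans (WC (0, (0, (0, 0)))).
exists (2 * C / delta + CW * L); first by rewrite addr_ge0 ?divr_ge0 ?mulr_ge0// ltW.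
move=> t /andP[t0 ttau]; have tt : 0 < tau - t by rewrite subr_gt0.
have [far|near_] := leP delta (tau - t).
  apply: (le_trans (ler_normB _ _)); apply: (le_trans (lerD (hAC t) (hAC tau))).
  have h1 : 2 * C <= 2 * C / delta * (tau - t).
    by rewrite -mulrA ler_peMr ?mulr_ge0// mulrC ler_pdivlMr// mul1r.
  have h2 : 0 <= CW * L * (tau - t) by rewrite !mulr_ge0// ltW.
  by lra.
have bWt s := at_ s bW; have bbt s := at_ s bb.
rewrite /A -cintB; [|exact: bmM|exact: bmM].
apply: (le_trans (normr_cint _)); first by apply: bmB; exact: bmM.
have bD : bounded_meas (fun x => `|W (t, x) - W (tau, x)|) by apply/bm_norm/bmB.
apply: (le_trans (y := cint (fun x => `|W (t, x) - W (tau, x)| + CW * L * (tau - t)))).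
  apply: le_cint.
  - by apply/bm_norm/bmB; exact: bmM.
  - by apply: bmD => //; exact: bm_cst.
  move=> x.
  rewrite (_ : W (t, x) * b (t, x) - W (tau, x) * b (tau, x) =
    (W (t, x) - W (tau, x)) * b (t, x) + W (tau, x) * (b (t, x) - b (tau, x))); last by ring.
  apply: (le_trans (ler_normD _ _)).
  rewrite (normrM (W (t, x) - W (tau, x)) (b (t, x))) (normrM (W (tau, x)) (b (t, x) - b (tau, x))).
  apply: lerD.
    rewrite -[X in _ <= X]mulr1; apply: ler_wpM2l; first exact: normr_ge0.
    exact: (box_cutoff_norm n p _).
  rewrite -mulrA; apply: ler_pM; [exact: normr_ge0|exact: normr_ge0|exact: WC|].
  by apply: (le_trans (hL t tau x)); rewrite distrC gtr0_norm.
rewrite cintD//; last exact: bm_cst.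
rewrite cint_cst; have := hd t t0 ttau near_ => h1.
have h2 : 0 <= 2 * C / delta * (tau - t).
  by rewrite mulr_ge0 ?divr_ge0 ?mulr_ge0// ltW.
by lra.
Qed.

(** The limit [N -> oo] of the tested equation: the kernel in front of [A t] concentrates at [tau],
    and the time cutoff in the other terms tends to [1]. *)
Lemma cutoff_balance : A tau = A0 + tint 0 tau B.
Proof.
have [_ [CB BC]] := bB; have CB0 : 0 <= CB by exact: le_trans (BC 0).
have cB : (fun k : nat => tint 0 tau (fun t => flat 0 (k.+1%:R * (tau - t)) * B t)) @ \oo -->
    tint 0 tau B.
  apply: (@tint_cvg _ 0 tau (fun k t => flat 0 (k.+1%:R * (tau - t)) * B t) B CB) => //.
  - by move=> k; apply: bmM => //; exact: bm_flat_comp.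
  - move=> k t; rewrite normrM -[X in _ <= X]mul1r ler_pM//.
    by rewrite ger0_norm ?flat_ge0// flat_le1.
  - move=> t /andP[_ tt]; rewrite -[X in _ --> X]mul1r.
    by apply: cvgM; [apply: flat0_cvg; rewrite subr_gt0|exact: cvg_cst].
have c1 : (fun k : nat => tint 0 tau (fun t => flat 1 (k.+1%:R * (tau - t)))) @ \oo --> (0 : R).
  rewrite -[X in _ --> X](mul0r (tau - 0)) -tint_cst ?(ltW tau0)//.
  apply: (@tint_cvg _ 0 tau (fun k t => flat 1 (k.+1%:R * (tau - t))) (fun=> 0) 1) => //.
  - by move=> k; exact: bm_flat_comp.
  - exact: bm_cst.
  - by move=> k t; rewrite ger0_norm ?flat_ge0// flat1_le1.
  - by move=> t /andP[_ tt]; apply: flat1_cvg; rewrite subr_gt0.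
have c0 := flat0_cvg tau0.
apply/eqP; rewrite -subr_eq0 -normr_le0; apply/ler_addgt0Pl => eps eps0; rewrite addr0.
have [K K0 hK] := A_cont eps0.
(* By [weakE] this is the integral of [A tau - A t] against the concentrating kernel, which [A_cont]
   bounds by [eps] plus a vanishing term. *)
pose D k := A tau * flat 0 (k.+1%:R * tau) -
  (flat 0 (k.+1%:R * tau) * A0 + tint 0 tau (fun t => flat 0 (k.+1%:R * (tau - t)) * B t)).
have cD : D @ \oo --> A tau - (A0 + tint 0 tau B).
  have h := cvgB (@cvg_scalel R (A tau) _ _ c0) (cvgD (@cvg_scaler R A0 _ _ c0) cB).
  rewrite mulr1 mul1r in h; exact: h.
have cE : (fun k : nat => eps + K * tint 0 tau (fun t => flat 1 (k.+1%:R * (tau - t)))) @ \oo --> eps.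
  have h : (fun k : nat => eps + K * tint 0 tau (fun t => flat 1 (k.+1%:R * (tau - t)))) @ \oo -->
    eps + K * 0.
    by apply: cvgD (@cvg_scalel R K _ _ c1); exact: cvg_cst.
  by rewrite mulr0 addr0 in h.
have cN : (fun k => `|D k|) @ \oo --> `|A tau - (A0 + tint 0 tau B)|.
  by apply: cvg_norm.
suff le_near : \forall k \near \oo,
    `|D k| <= eps + K * tint 0 tau (fun t => flat 1 (k.+1%:R * (tau - t))).
  exact: (ler_cvg_to cN cE le_near).
near=> k.
have N0 : 0 < k.+1%:R :> R by rewrite ltr0Sn.
have bg : bounded_meas (fun t : R => k.+1%:R * flat 2 (k.+1%:R * (tau - t)) : R).
  by apply: bmM; [exact: bm_cst|exact: bm_flat_comp].
have bgA : bounded_meas (fun t : R => k.+1%:R * flat 2 (k.+1%:R * (tau - t)) * A t) by exact: bmM.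
have -> : D k = tint 0 tau (fun t => k.+1%:R * flat 2 (k.+1%:R * (tau - t)) * (A tau - A t)).
  rewrite /D -(weakE N0) -(tint_flat2 _ tau0) -tintZ// -tintB//; last first.
    by apply: bmM => //; exact: bm_cst.
  by apply: eq_tint => t _ _; ring.
have bI : bounded_meas (fun t : R => k.+1%:R * flat 2 (k.+1%:R * (tau - t)) * (A tau - A t)).
  by apply: bmM => //; apply: bmB => //; exact: bm_cst.
have bf1 := bm_flat_comp 1 k.+1%:R tau.
apply: (le_trans (y := tint 0 tau (fun t => `|k.+1%:R * flat 2 (k.+1%:R * (tau - t)) * (A tau - A t)|))).
  apply: le_normr_Rintegral; first exact: (finite_domain_itv 0 tau).1.
  exact: (bm_integrable (finite_domain_itv 0 tau) bI).
apply: (le_trans (y := tint 0 tau (fun t => eps * (k.+1%:R * flat 2 (k.+1%:R * (tau - t))) +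
    K * flat 1 (k.+1%:R * (tau - t))))).
  apply: le_tint; first exact: bm_norm.
    by apply: bmD; apply: bmM => //; exact: bm_cst.
  move=> t tt; have g0 : 0 <= k.+1%:R * flat 2 (k.+1%:R * (tau - t)) by rewrite mulr_ge0 ?flat_ge0.
  rewrite normrM (ger0_norm g0) distrC.
  apply: (le_trans (ler_wpM2l g0 (hK t tt))).
  rewrite -(flat_recr 1) le_eqVlt; apply/orP; left; apply/eqP; ring.
rewrite tintD; [|by apply: bmM => //; exact: bm_cst|by apply: bmM => //; exact: bm_cst].
rewrite tintZ// tintZ// tint_flat2// lerD2r -[X in _ <= X]mulr1.
by apply: ler_wpM2l; [exact: ltW|exact: flat_le1].
Unshelve. all: by end_near. Qed.

End Cutoff.

(** As a function of the foot point, the defect of Duhamel's formula is a periodic function [Z]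
    whose integral against every box cutoff vanishes by [cutoff_balance]. *)
Lemma weak_mild : {ae mu3, forall x, cube x -> W (tau, x) =
  W0 (shiftx i (- (e * tau)) x) +
  tint 0 tau (fun s => S (s, shiftx i (e * s) (shiftx i (- (e * tau)) x)))}.
Proof.
pose Sc (z : R * pt) := S (z.1, shiftx i (e * z.1) z.2).
have bSc : bounded_meas Sc.
  apply: (bm_comp bS); apply: measurable_fun_pair => //; apply: measurable_shiftx_comp => //.
  by apply: measurable_funM; first exact: measurable_cst.
pose Z y := W (tau, shiftx i (e * tau) y) - W0 y - tint 0 tau (fun s => Sc (s, y)).
have bWt : bounded_meas (fun x => W (tau, x)) by apply: (bm_comp bW); exact: pair1_measurable.
have bWs : bounded_meas (fun y => W (tau, shiftx i (e * tau) y)) := bm_shiftx i (e * tau) bWt.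
have bI : bounded_meas (fun y => tint 0 tau (fun s => Sc (s, y))).
  apply: (bm_tint 0 tau (F := fun q : pt * R => Sc (q.2, q.1))).
  by apply: (bm_comp bSc); exact: measurable_fun_pair.
have bZ : bounded_meas Z by apply: bmB => //; exact: bmB.
have pZ : lattice_periodic Z.
  move=> j y; rewrite /Z pW0 /Sc/=; congr (_ - _ - _).
    by rewrite shiftxC (pW tau).
  by apply: eq_tint => s _ _; rewrite shiftxC (pS s).
have Z0 : {ae mu3, forall y, cube y -> Z y = 0}.
  apply: cint_box_cutoff_eq0 => // n p; have := cutoff_balance n p.
  have bbox := bm_box_cutoff n p; have pbox := periodic_box_cutoff n p.
  have -> : cint (fun x => W (tau, x) * box_cutoff n p (shiftx i (- (e * (tau, x).1)) (tau, x).2)) =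
      cint (fun y => W (tau, shiftx i (e * tau) y) * box_cutoff n p y).
    rewrite -(cint_shiftx i (- (e * tau)) (f := fun y => W (tau, shiftx i (e * tau) y) * box_cutoff n p y)).
    - by apply: eq_Rintegral => x _; rewrite shiftxD addNr shiftx0.
    - exact: bmM.
    - by move=> j y; rewrite shiftxC (pW tau) pbox.
  have -> : tint 0 tau (fun t => cint (fun x => S (t, x) *
      box_cutoff n p (shiftx i (- (e * (t, x).1)) (t, x).2))) =
      cint (fun y => tint 0 tau (fun s => Sc (s, y)) * box_cutoff n p y).
    transitivity (tint 0 tau (fun s => cint (fun y => Sc (s, y) * box_cutoff n p y))).
      apply: eq_tint => t _ _.
      rewrite -(cint_shiftx i (- (e * t)) (f := fun y => Sc (t, y) * box_cutoff n p y)).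
      - by apply: eq_Rintegral => x _; rewrite /Sc /= shiftxD addNr shiftx0.
      - by apply: bmM => //; apply: (bm_comp bSc); exact: pair1_measurable.
      - by move=> j y; rewrite /Sc /= shiftxC (pS t) pbox.
    have bSb : bounded_meas (fun z : R * pt => Sc z * box_cutoff n p z.2).
      by apply: bmM => //; apply: (bm_comp bbox); exact: measurable_snd.
    rewrite (tint_cint_swap 0 tau bSb); apply: eq_Rintegral => y _.
    rewrite [RHS]mulrC -tintZ; last by apply: (bm_comp bSc); exact: pair2_measurable.
    by apply: eq_tint => s _ _; rewrite mulrC.
  move=> h; rewrite -[RHS](subrr (cint (fun y => W (tau, shiftx i (e * tau) y) * box_cutoff n p y))) {2}h.
  rewrite opprD addrA -cintB; [|exact: bmM|exact: bmM].
  rewrite -cintB; [|by apply: bmB; exact: bmM|exact: bmM].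
  by apply: eq_Rintegral => y _; rewrite /Z; ring.
(* The integral of the absolute value is invariant under translations, and so carries the statement
   from foot points in the cell to positions in the cell. *)
have N0 : cint (fun y => `|Z y|) = 0.
  rewrite -[RHS]cint_cst; apply: eq_cint_ae; [exact: bm_norm|exact: bm_cst|].
  by apply: ae_mu3S Z0 => y h /h ->; rewrite normr0.
have pN : lattice_periodic (fun y => `|Z y|) by move=> j y; rewrite pZ.
rewrite -(cint_shiftx i (- (e * tau)) (bm_norm bZ) pN) in N0.
have := cint_eq0_ae (bm_shiftx i (- (e * tau)) (bm_norm bZ)) (fun x => normr_ge0 _) N0.
apply: ae_mu3S => x h /h /eqP; rewrite normr_eq0 /Z shiftxD addNr shiftx0 subr_eq0 => /eqP hx.
by rewrite -hx addrC subrK.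
Qed.

End WeakMild.

(** * Regular representatives of weak solutions *)

Section PeriodicExtension.
Context {R : realType}.
Local Notation pt := (@pt R).

Definition frac (y : R) : R := y - (Num.floor y)%:~R.
Definition frac3 (x : pt) : pt := (frac x.1, (frac x.2.1, frac x.2.2)).

Lemma frac_itv y : 0 <= frac y < 1.
Proof.
by rewrite /frac subr_ge0 floor_le/= ltrBlDl; have := floorD1_gt y; rewrite intrD.
Qed.

Lemma frac_id y : 0 <= y < 1 -> frac y = y.
Proof.
move=> /andP[y0 y1]; rewrite /frac (@floor_def _ y 0) ?subr0//.
by rewrite y0/= add0r.
Qed.

Lemma frac_period y : frac (y + 1) = frac y.
Proof.
have h : Num.floor (y + 1) = Num.floor y + 1.
  apply: floor_def; rewrite !intrD lerD2r floor_le/= ltrD2r.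
  by have := floorD1_gt y; rewrite intrD.
by rewrite /frac h intrD; ring.
Qed.

Lemma frac3_cube x : cube (frac3 x).
Proof.
by split; rewrite /= ?in_itv/= ?frac_itv//; split; rewrite /= in_itv/= frac_itv.
Qed.

Lemma frac3_id x : cube x -> frac3 x = x.
Proof.
case: x => x1 [x2 x3] [/= + [/=]]; rewrite /= !in_itv/= => h1 h2 h3.
by rewrite /frac3/= !frac_id.
Qed.

Lemma frac3_period i x : frac3 (shiftx i 1 x) = frac3 x.
Proof. by rewrite /frac3 /shiftx; case: i / (ord3P i) => /=; rewrite frac_period. Qed.

Lemma measurable_frac : measurable_fun setT (frac : R -> R).
Proof.
apply: measurable_funB => //.
by apply: nondecreasing_measurable => // x y xy; rewrite ler_int; exact: le_floor.
Qed.

Lemma measurable_frac3 : measurable_fun setT (frac3 : pt -> pt).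
Proof.
have ms : measurable_fun setT (snd : pt -> R * R) by exact: measurable_snd.
apply: measurable_fun_pair; first exact: (measurableT_comp measurable_frac measurable_fst).
apply: measurable_fun_pair; apply: (measurableT_comp measurable_frac).
  exact: (measurableT_comp measurable_fst ms).
exact: (measurableT_comp measurable_snd ms).
Qed.

Definition clamp (C y : R) : R := Num.max 0 (Num.min C y).

Lemma clamp_itv C y : 0 <= C -> 0 <= clamp C y <= C.
Proof. by move=> C0; rewrite /clamp le_max lexx/= ge_max C0/= ge_min lexx. Qed.

Lemma clamp_id C y : 0 <= y <= C -> clamp C y = y.
Proof. by move=> /andP[y0 yC]; rewrite /clamp (min_idPr yC) (max_idPr y0). Qed.

Lemma clamp_lip C y z : `|clamp C y - clamp C z| <= `|y - z|.
Proof.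
apply: (le_trans (pos_lip _ _)); have h1 := ler_norm (y - z).
have h2 := ler_norm (z - y); rewrite distrC in h2; have h0 := normr_ge0 (y - z).
by have [a|a] := leP C y; have [b|b] := leP C z; rewrite ler_norml; apply/andP; split; lra.
Qed.

(** The nearest-point property of the projection to [[0, C]], by which membership in this interval
    survives limits in the mean. *)
Lemma clamp_dist C y z : 0 <= z <= C -> `|y - clamp C y| <= `|y - z|.
Proof.
move=> /andP[z0 zC]; have h1 := ler_norm (y - z).
have h2 := ler_norm (z - y); rewrite distrC in h2; have h0 := normr_ge0 (y - z).
rewrite /clamp; have [a|a] := leP C y; [have [b|b] := leP 0 C|have [b|b] := leP 0 y];
  rewrite ler_norml; apply/andP; split; lra.
Qed.

Lemma measurable_clamp C : measurable_fun setT (clamp C : R -> R).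
Proof.
apply: measurable_maxr; first exact: measurable_cst.
by apply: measurable_minr; [exact: measurable_cst|exact: measurable_id].
Qed.

End PeriodicExtension.

Section NullSetTransfer.
Context {R : realType}.
Local Notation pt := (@pt R).

Lemma ae_mu4S (P Q : R * pt -> Prop) : (forall x, P x -> Q x) ->
  {ae mu4, forall x, P x} -> {ae mu4, forall x, Q x}.
Proof. exact: (@filterS _ _ (ae_filter_ringOfSetsType mu4)). Qed.

Lemma ae_mu4I (P Q : R * pt -> Prop) :
  {ae mu4, forall x, P x} -> {ae mu4, forall x, Q x} ->
  {ae mu4, forall x, P x /\ Q x}.
Proof. exact: (@filterI _ _ (ae_filter_ringOfSetsType mu4)). Qed.

Lemma ae_mu4_all (I : finType) (P : I -> R * pt -> Prop) :
  (forall i, {ae mu4, forall x, P i x}) -> {ae mu4, forall x, forall i, P i x}.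
Proof.
move=> h; have H : {ae mu4, forall x, forall i, i \in enum I -> P i x}.
  elim: (enum I) => [|j s IH]; first exact: aeW.
  apply: ae_mu4S (ae_mu4I (h j) IH) => x [hj hs] i; rewrite inE => /orP[/eqP->//|].
  exact: hs.
by apply: ae_mu4S H => x H i; apply: H; rewrite mem_enum.
Qed.

Lemma ae_mu4_sections (P : R * pt -> Prop) : {ae mu4, forall z, P z} ->
  {ae lebs, forall t : R, {ae mu3, forall x : pt, P (t, x)}}.
Proof.
move=> [N [mN N0 PN]].
apply: ae_lebS (@ae_section _ _ _ _ R lebs leb3 N mN N0) => t Nt.
exists (xsection N t); split => //; first exact: measurable_xsection.
by move=> x /= nP; rewrite /xsection /= inE; exact: PN.
Qed.

Lemma ae_muT (P : pt -> Prop) : {ae muT, forall x, P x} -> {ae mu3, forall x, cube x -> P x}.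
Proof.
move=> [N [mN N0 PN]]; exists (N `&` cube); split => //.
  by apply: measurableI => //; exact: measurable_cube.
by move=> x /= /not_implyP[cx nP]; split => //; exact: PN.
Qed.

Lemma ae_leb_exists (P : R -> Prop) (a b : R) : a < b ->
  {ae lebs, forall t, a <= t < b -> P t} -> exists2 t, a <= t < b & P t.
Proof.
move=> ab [N [mN N0 PN]]; apply: contrapT => nP.
have sub : `[a, b[ `<=` N.
  move=> t /=; rewrite in_itv/= => tab; apply: PN => /= h; apply: nP.
  by exists t => //; exact: h.
have : (lebs `[a, b[%classic <= lebs N)%E by apply: le_measure; rewrite ?inE.
rewrite N0 => h; have := lebs_itv (ltW ab).
have -> : lebs `[a, b[%classic = 0%E by apply/eqP; rewrite eq_le h measure_ge0.
by move=> /= e; move: ab; rewrite -subr_gt0 -e ltxx.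
Qed.

(** [F] is not assumed measurable, because on a null set the densities may leave the domain on which
    [k] is measurable. The measurable [G] computes the integral, and its vanishing from [tau] on
    reduces the time axis to [[0, tau)]. *)
Lemma Rintegral_stdom (tau : R) (F G : R * pt -> R) : bounded_meas G ->
  (forall t x, tau <= t -> G (t, x) = 0) ->
  {ae mu4, forall z, stdom z -> F z = G z} ->
  Rintegral mu4 stdom F = tint 0 tau (fun t => cint (fun x => G (t, x))).
Proof.
move=> bG G0 [N [mN N0 FG]].
have mst : measurable (stdom (R := R) : set (R * pt)).
  by apply: measurableX; [exact: measurable_itv|exact: measurable_cube].
rewrite (@nullset_Rintegral _ _ _ mu4 stdom F G N mst mN N0); last 2 first.
- by apply: measurable_funTS; case: bG.
- move=> z dz; apply: contra_notP => ne; apply: FG => /= h; apply: ne; exact: h.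
rewrite -(Rintegral_mu4 0 tau bG) Rintegral_mkcond [RHS]Rintegral_mkcond.
congr Rintegral; apply/funext => -[t x]; rewrite !patchE.
case: ifPn => [|nd]; case: ifPn => // nd'.
- rewrite inE => -[/= ht cx]; apply: G0.
  rewrite leNgt; apply/negP => tt; move: nd'; rewrite notin_setE; apply.
  by split => //=; move: ht; rewrite !in_itv/= andbT => ->.
- move: nd'; rewrite inE => -[/= ht cx]; move: nd; rewrite notin_setE; case.
  by split => //=; move: ht; rewrite !in_itv/= andbT => /andP[].
Qed.

End NullSetTransfer.

Section CleanData.
Context {R : realType}.
Local Notation pt := (@pt R).
Local Notation dir := ('I_3 * bool)%type.
Variables (c T M C K1 : R) (k : pt * pt * pt -> R) (u0 v0 : 'I_3 -> pt -> R)
  (u v : 'I_3 -> R -> pt -> R).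
Hypotheses (T0 : 0 < T) (C0 : 0 <= C) (M0 : 0 <= M).
Hypothesis rate : interaction_rate k.
Hypothesis kK1 : forall a b x, box C a -> box C b -> cube x -> k (a, b, x) <= K1.
Hypothesis weak : weak_solution c k u0 v0 u v.

Definition dir_sol (a : dir) : R -> pt -> R := if a.2 then u a.1 else v a.1.
Definition dir_ini (a : dir) : pt -> R := if a.2 then u0 a.1 else v0 a.1.

Hypothesis solC : forall a, {ae mu4, forall z : R * pt,
  (`[0%R, T[ `*` cube) z -> `|dir_sol a z.1 z.2| <= C}.
Hypothesis mini : forall a, measurable_fun cube (dir_ini a).
Hypothesis iniM : forall a, {ae mu3, forall x, cube x -> 0 <= dir_ini a x <= M}.

Let box4 : set (R * pt) := `[0%R, T[ `*` cube.

(* Representatives that are measurable, bounded, nonnegative and periodic on all of [R x R^3]. *)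
Definition clean_sol (a : dir) (z : R * pt) : R :=
  clamp C (((fun p : R * pt => dir_sol a p.1 p.2) \_ box4) (z.1, frac3 z.2)).
Definition clean_ini (a : dir) (x : pt) : R := clamp M ((dir_ini a \_ cube) (frac3 x)).
Definition clean_vec (e : bool) (z : R * pt) : pt :=
  (clean_sol (@Ordinal 3 0 isT, e) z,
   (clean_sol (@Ordinal 3 1 isT, e) z, clean_sol (@Ordinal 3 2 isT, e) z)).
Definition clean_rate (z : R * pt) : R := k (clean_vec true z, clean_vec false z, frac3 z.2).

Lemma clean_sol_itv a z : 0 <= clean_sol a z <= C.
Proof. exact: clamp_itv. Qed.

Lemma clean_ini_itv a x : 0 <= clean_ini a x <= M.
Proof. exact: clamp_itv. Qed.

Lemma clean_solE a t x : 0 <= t < T -> cube x -> clean_sol a (t, x) = clamp C (dir_sol a t x).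
Proof.
move=> tT cx; rewrite /clean_sol patchE /= frac3_id// ifT// inE.
by split => //=; rewrite in_itv.
Qed.

Let sol_sp a : sol_space (dir_sol a).
Proof. by rewrite /dir_sol; case: (weak.1 a.1) => hu hv; case: a.2. Qed.

Let mbox4 : measurable box4.
Proof. by apply: measurableX; [exact: measurable_itv|exact: measurable_cube]. Qed.

Lemma bm_clean_sol a : bounded_meas (clean_sol a).
Proof.
split; last first.
  by exists C => z; have /andP[h0 hC] := clean_sol_itv a z; rewrite ger0_norm.
apply: (measurableT_comp (@measurable_clamp _ C)).
have [/(_ T T0)[ms _] _ _] := sol_sp a.
have {}ms : measurable_fun setT ((fun p : R * pt => dir_sol a p.1 p.2) \_ box4).
  exact/(measurable_restrictT _ mbox4).
apply: (measurableT_comp ms); apply: measurable_fun_pair => //.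
exact: (measurableT_comp measurable_frac3).
Qed.

Lemma periodic_clean_sol a t : lattice_periodic (fun x => clean_sol a (t, x)).
Proof. by move=> i x; rewrite /clean_sol frac3_period. Qed.

Lemma bm_clean_ini a : bounded_meas (clean_ini a).
Proof.
split; last first.
  by exists M => x; have /andP[h0 hM] := clean_ini_itv a x; rewrite ger0_norm.
apply: (measurableT_comp (@measurable_clamp _ M)).
have ms : measurable_fun setT (dir_ini a \_ cube).
  exact/(measurable_restrictT _ measurable_cube).
exact: (measurableT_comp ms measurable_frac3).
Qed.

Lemma periodic_clean_ini a : lattice_periodic (clean_ini a).
Proof. by move=> i x; rewrite /clean_ini frac3_period. Qed.

Lemma clean_iniE a : {ae mu3, forall x, cube x -> dir_ini a x = clean_ini a x}.
Proof.
apply: ae_mu3S (iniM a) => x h cx.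
by rewrite /clean_ini frac3_id// patchE mem_set// clamp_id//; exact: h.
Qed.

Let vec_box e z : box C (clean_vec e z).
Proof.
by split; rewrite /= ?in_itv/= ?clean_sol_itv//; split; rewrite /= in_itv/= clean_sol_itv.
Qed.

Let vec_quadrant e z : quadrant (clean_vec e z).
Proof.
have h a : 0 <= clean_sol a z by case/andP: (clean_sol_itv a z).
by split; rewrite /= ?in_itv/= ?h//; split; rewrite /= in_itv/= h.
Qed.

Lemma clean_rate_ge0 z : 0 <= clean_rate z.
Proof.
apply: rate.2; split; last exact: frac3_cube.
by split; exact: vec_quadrant.
Qed.

Lemma bm_clean_rate : bounded_meas clean_rate.
Proof.
split; last first.
  exists K1 => z; rewrite ger0_norm ?clean_rate_ge0//.
  by apply: kK1; [exact: vec_box|exact: vec_box|exact: frac3_cube].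
have mv e : measurable_fun setT (clean_vec e).
  apply: measurable_fun_pair; first by case: (bm_clean_sol (@Ordinal 3 0 isT, e)).
  by apply: measurable_fun_pair; [case: (bm_clean_sol (@Ordinal 3 1 isT, e))|
    case: (bm_clean_sol (@Ordinal 3 2 isT, e))].
have mg : measurable_fun setT (fun z => (clean_vec true z, clean_vec false z, frac3 z.2)).
  apply: measurable_fun_pair; first exact: measurable_fun_pair.
  exact: (measurableT_comp measurable_frac3).
have mq : measurable (quadrant (R := R)).
  by apply: measurableX; [|apply: measurableX]; exact: measurable_itv.
have mkd : measurable (kdom (R := R)).
  by apply: measurableX; [exact: measurableX|exact: measurable_cube].
apply: (@measurable_comp _ _ _ _ _ _ kdom k) mg => //; last exact: rate.1.
move=> _ [z _ <-]; split; last exact: frac3_cube.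
by split; exact: vec_quadrant.
Qed.

Lemma periodic_clean_rate t : lattice_periodic (fun x => clean_rate (t, x)).
Proof.
move=> i x; rewrite /clean_rate /clean_vec frac3_period.
by rewrite !(periodic_clean_sol _ t).
Qed.

Let sol_itv a : {ae mu4, forall z : R * pt, box4 z -> 0 <= dir_sol a z.1 z.2 <= C}.
Proof.
have [_ pos _] := sol_sp a.
apply: ae_mu4S (ae_mu4I pos (solC a)) => z [h0 hC] [/= ht cx].
have z0 : stdom z by split => //=; move: ht; rewrite !in_itv/= andbT => /andP[].
have hz := h0 z0; rewrite hz/=.
exact: le_trans (ler_norm _) (hC (conj ht cx)).
Qed.

Lemma clean_sol_ae : {ae mu4, forall z : R * pt, forall a, box4 z ->
  dir_sol a z.1 z.2 = clean_sol a z}.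
Proof.
apply: ae_mu4_all => a; apply: ae_mu4S (sol_itv a) => -[t x] h bz.
have [ht cx] := bz; have tT : 0 <= t < T by move: ht; rewrite /= in_itv.
rewrite (clean_solE a tT cx).
by rewrite clamp_id//; exact: h.
Qed.

Let powR1E (x : R) : `|x| `^ 1 = `|x|. Proof. by rewrite powRr1. Qed.

Let measurable_gap a t t0 :
  measurable_fun cube (dir_sol a t) -> measurable_fun cube (dir_sol a t0) ->
  measurable_fun cube (fun x => (`|dir_sol a t x - dir_sol a t0 x| `^ 1)%:E).
Proof.
move=> h1 h2; apply/measurable_EFinP.
apply: (@eq_measurable_fun _ _ _ _ _ (fun x => `|dir_sol a t x - dir_sol a t0 x|)).
  by move=> x _; rewrite powR1E.
by apply: measurableT_comp => //; exact: measurable_funB.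
Qed.

(** The bounds are known only for almost every time. Choosing good times close to [t0], continuity
    in the mean makes the integrated distance of [dir_sol a t0] from [[0, C]] smaller than any
    positive number. *)
Lemma clean_sol_at a t0 : 0 <= t0 < T -> {ae mu3, forall x, cube x ->
  dir_sol a t0 x = clean_sol a (t0, x)}.
Proof.
move=> tT; have [t00 t0T] := andP tT.
have [_ _ /(_ 1 (lexx 1))[ms cs]] := sol_sp a.
have mc := @measurable_cube R.
pose f x := `|dir_sol a t0 x - clamp C (dir_sol a t0 x)|.
have mf : measurable_fun cube (EFin \o f).
  apply/measurable_EFinP; apply: measurableT_comp => //.
  apply: measurable_funB; first exact: (ms t0 t00).1.
  apply: measurableT_comp; first exact: measurable_clamp.
  exact: (ms t0 t00).1.
have f0 x : cube x -> (0 <= (EFin \o f) x)%E by move=> _; rewrite lee_fin; exact: normr_ge0.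
have fe (eps : R) : 0 < eps -> (\int[mu3]_(x in cube) (f x)%:E <= eps%:E)%E.
  move=> eps0; have [delta d0 hd] := cs t0 t00 eps eps0.
  pose t2 := Num.min T (t0 + delta).
  have t02 : t0 < t2 by rewrite lt_min t0T ltrDl.
  have good : {ae lebs, forall t : R, t0 <= t < t2 ->
      {ae mu3, forall x, cube x -> 0 <= dir_sol a t x <= C}}.
    apply: ae_lebS (ae_mu4_sections (sol_itv a)) => t h /andP[tt tt2].
    apply: ae_mu3S h => x h cx; apply: h; split => //=.
    by rewrite in_itv/= (le_trans t00 tt)/=; move: tt2; rewrite lt_min => /andP[].
  have [t /andP[tt tt2] ht] := ae_leb_exists t02 good.
  have t0' : 0 <= t by exact: le_trans tt.
  have tdelta : `|t - t0| < delta.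
    rewrite ger0_norm ?subr_ge0// ltrBlDl.
    by move: tt2; rewrite lt_min => /andP[].
  apply: (le_trans _ (ltW (hd t t0' tdelta))).
  apply: ae_ge0_le_integral => //.
  - exact: measurable_gap (ms t t0').1 (ms t0 t00).1.
  apply: ae_mu3S ht => x h cx; rewrite lee_fin powR1E distrC.
  by apply: clamp_dist; exact: h.
have i0 : (\int[mu3]_(x in cube) `|(EFin \o f) x| = 0)%E.
  transitivity (\int[mu3]_(x in cube) (f x)%:E)%E.
    by apply: eq_integral => x; rewrite inE => cx; rewrite gee0_abs// f0.
  apply/eqP; rewrite eq_le integral_ge0// andbT.
  by apply/lee_addgt0Pr => eps eps0; rewrite add0e; exact: fe.
have := (ae_eq_integral_abs mu3 mc mf).1 i0.
apply: ae_mu3S => x h cx; rewrite clean_solE//.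
have [/eqP] := h cx; rewrite normr_eq0 subr_eq0 => /eqP; exact.
Qed.

Lemma clean_sol_cont a t0 (eps : R) : 0 <= t0 < T -> 0 < eps -> exists2 delta : R, 0 < delta &
  forall t, 0 <= t < T -> `|t - t0| < delta ->
    cint (fun x => `|clean_sol a (t, x) - clean_sol a (t0, x)|) <= eps.
Proof.
move=> tT eps0; have [t00 t0T] := andP tT.
have [_ _ /(_ 1 (lexx 1))[ms cs]] := sol_sp a.
have [delta d0 hd] := cs t0 t00 eps eps0; exists delta => // t tt td.
have [t1 _] := andP tt.
have bt s : bounded_meas (fun x => clean_sol a (s, x)).
  by apply: (bm_comp (bm_clean_sol a)); exact: pair1_measurable.
have bD := bm_norm (bmB (bt t) (bt t0)).
rewrite -lee_fin -(bm_fine finite_domain_cube bD).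
apply: (le_trans _ (ltW (hd t t1 td))).
apply: ge0_le_integral.
- exact: measurable_cube.
- by move=> x _; rewrite lee_fin.
- by apply/measurable_EFinP/measurable_funTS; case: bD.
- exact: measurable_gap (ms t t1).1 (ms t0 t00).1.
- move=> x cx; rewrite lee_fin powR1E !clean_solE//; exact: clamp_lip.
Qed.

Let speed (a : dir) : R := if a.2 then c else - c.

Let speedE a s : shiftx a.1 (speed a * s) = flow a (c * s) :> (pt -> pt).
Proof. by rewrite /flow /speed; case: a.2 => //; rewrite mulNr. Qed.

Let rho t x := \sum_(i < 3) (u i t x + v i t x).

Let weak_dir a psi : test_fun psi ->
  Rintegral mu4 stdom (fun p : R * pt => dir_sol a p.1 p.2 *
     (dt psi p.1 p.2 + speed a * dx a.1 psi p.1 p.2)) +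
  Rintegral mu3 cube (fun x => psi 0 x * dir_ini a x) +
  Rintegral mu4 stdom (fun p : R * pt => k (vec3 u p.1 p.2, vec3 v p.1 p.2, p.2) *
     (rho p.1 p.2 - 6 * dir_sol a p.1 p.2) * psi p.1 p.2) = 0.
Proof.
move=> tpsi; have [hu hv] := weak.2 psi tpsi a.1.
rewrite /dir_sol /dir_ini /speed; case: a hu hv => i [] hu hv; first exact: hu.
rewrite -[RHS]hv; congr (_ + _ + _).
by congr Rintegral; apply/funext => p; rewrite /= mulNr.
Qed.

Let bm_box_at n p a : bounded_meas (fun z : R * pt =>
  box_cutoff n p (shiftx a.1 (- (speed a * z.1)) z.2)).
Proof.
have := bm_tev (transported_tbox n p a.1 (speed a)); congr bounded_meas.
by apply/funext => z; rewrite tev_tbox.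
Qed.

Let bm_flat_at n N tau : bounded_meas (fun z : R * pt => flat n (N * (tau - z.1))).
Proof. by apply: (bm_comp (bm_flat_comp n N tau)); exact: measurable_fst. Qed.

(** The test function vanishes from [tau < T] on, so the tested equation does not notice that the
    solution was altered outside [[0, T)] and on null sets. *)
Let weak_clean a tau n p (N : R) : 0 < tau -> tau < T -> 0 < N ->
  tint 0 tau (fun t => cint (fun x => clean_sol a (t, x) *
    (- (N * flat 2 (N * (tau - t))) * box_cutoff n p (shiftx a.1 (- (speed a * t)) x)))) +
  cint (fun x => flat 0 (N * (tau - 0)) *
    box_cutoff n p (shiftx a.1 (- (speed a * 0)) x) * clean_ini a x) +
  tint 0 tau (fun t => cint (fun x => source clean_sol clean_rate a (t, x) *
    (flat 0 (N * (tau - t)) * box_cutoff n p (shiftx a.1 (- (speed a * t)) x)))) = 0.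
Proof.
move=> tau0 tauT N0; have := weak_dir a (test_fun_box n p a.1 (speed a) tau N0).
have late t m : tau <= t -> flat m (N * (tau - t)) = 0.
  by move=> ht; rewrite flat_le0// pmulr_rle0// subr_le0.
have bsrc : bounded_meas (source clean_sol clean_rate a).
  exact: (bm_source bm_clean_sol bm_clean_rate).
have in_box (z : R * pt) : stdom z -> z.1 < tau -> box4 z.
  move=> [/= ht cx] tt; split => //=; move: ht; rewrite !in_itv/= andbT => -> /=.
  exact: lt_trans tauT.
rewrite (@Rintegral_stdom _ tau _ (fun z => clean_sol a z *
    (- (N * flat 2 (N * (tau - z.1))) * box_cutoff n p (shiftx a.1 (- (speed a * z.1)) z.2)))); last 3 first.
- apply: bmM; first exact: bm_clean_sol.
  by apply: bmM; [apply: bmN; apply: bmM; [exact: bm_cst|exact: bm_flat_at]|exact: bm_box_at].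
- by move=> t x ht; rewrite /= late// mulr0 oppr0 mul0r mulr0.
- apply: ae_mu4S clean_sol_ae => z h sz; rewrite transport_test_fun.
  have [ht|ht] := leP tau z.1; first by rewrite late// mulr0 oppr0 mul0r !mulr0.
  by rewrite (h a (in_box z sz ht)).
rewrite (@Rintegral_stdom _ tau _ (fun z => source clean_sol clean_rate a z *
    (flat 0 (N * (tau - z.1)) * box_cutoff n p (shiftx a.1 (- (speed a * z.1)) z.2)))); last 3 first.
- by apply: bmM => //; apply: bmM; [exact: bm_flat_at|exact: bm_box_at].
- by move=> t x ht; rewrite /= late// mul0r mulr0.
- apply: ae_mu4S clean_sol_ae => z h sz.
  have [ht|ht] := leP tau z.1; first by rewrite late// mul0r !mulr0.
  have bz := in_box z sz ht; have [_ cz] := sz.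
  congr (_ * _); rewrite /source (h a bz); congr (_ * (_ - _)).
    rewrite /clean_rate /vec3 /clean_vec frac3_id//.
    by rewrite -!(h _ bz).
  rewrite sum_dirE; apply: eq_bigr => i _.
  by rewrite -!(h _ bz).
have [N1 [mN1 N10 N1E]] := clean_iniE a.
rewrite (@nullset_Rintegral _ _ _ mu3 cube _ (fun x => flat 0 (N * (tau - 0)) *
    box_cutoff n p (shiftx a.1 (- (speed a * 0)) x) * clean_ini a x) N1 (@measurable_cube R) mN1 N10) => [//||].
- apply: measurable_funTS.
  have : bounded_meas (fun x => flat 0 (N * (tau - 0)) *
      box_cutoff n p (shiftx a.1 (- (speed a * 0)) x) * clean_ini a x).
    apply: bmM; last exact: bm_clean_ini.
    by apply: bmM; [exact: bm_cst|apply: bm_shiftx; exact: bm_box_cutoff].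
  by case.
- move=> x cx nN; congr (_ * _); apply: contra_notP nN => ne; apply: N1E => /= h.
  by apply: ne; exact: h.
Qed.

Lemma clean_sol_mild a tau : 0 < tau -> tau < T -> {ae mu3, forall x, cube x ->
  clean_sol a (tau, x) = mild_sol c T clean_ini clean_sol clean_rate a (tau, x)}.
Proof.
move=> tau0 tauT.
have psrc t : lattice_periodic (fun x => source clean_sol clean_rate a (t, x)).
  exact: (periodic_source periodic_clean_sol periodic_clean_rate).
have bsrc : bounded_meas (source clean_sol clean_rate a).
  exact: (bm_source bm_clean_sol bm_clean_rate).
have := @weak_mild _ a.1 (speed a) tau (clean_sol a) (source clean_sol clean_rate a) (clean_ini a)
  tau0 (bm_clean_sol a) bsrc (bm_clean_ini a) (periodic_clean_sol a) psrc (periodic_clean_ini a) _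
  (fun n p N N0 => weak_clean a n p tau0 tauT N0).
move=> /(_ _) h; apply: ae_mu3S (h _) => [x hx cx|eps eps0]; last first.
  have tt : 0 <= tau < T by rewrite (ltW tau0).
  have [delta d0 hd] := clean_sol_cont a tt eps0; exists delta => // t t0 ttau td.
  apply: hd; first by rewrite t0 (lt_trans ttau).
  by rewrite distrC gtr0_norm// subr_gt0.
rewrite (hx cx); pose y := flow a (- (c * tau)) x.
have inc := @char_sol_increment _ c T clean_ini clean_sol clean_rate bm_clean_sol bm_clean_rate
  a y 0 tau (lexx 0) (ltW tau0) (ltW tauT).
rewrite char_sol0 in inc.
have -> : mild_sol c T clean_ini clean_sol clean_rate a (tau, x) =
  clean_ini a y + tint 0 tau (fun r => char_source c clean_sol clean_rate a (r, y)).
  by rewrite -inc addrC subrK.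
have -> : shiftx a.1 (- (speed a * tau)) x = y.
  by rewrite -mulrN speedE /y mulrN.
congr (_ + _); apply: eq_tint => s _ _.
by rewrite speedE.
Qed.

End CleanData.

(** * Exponential decay *)

Section ExponentialDecay.
Context {R : realType}.
Implicit Types (E : R -> R) (L theta T t : R).

(** Up to time [t] there are [n > t / L - 1] complete windows; the incomplete one costs the
    prefactor [theta^-1]. *)
Lemma iterated_decay E L theta T : 0 < L -> 0 < theta < 1 -> 0 <= E 0 ->
  (forall s t : R, 0 <= s -> s <= t -> t <= T -> E t <= E s) ->
  (forall t : R, 0 <= t -> t + L <= T -> E (t + L) <= theta * E t) ->
  forall t : R, 0 <= t <= T -> E t <= theta^-1 * expR (ln theta * (t / L)) * E 0.
Proof.
move=> L0 /andP[th0 th1] E0 mono step t /andP[t0 tT].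
have iter n : n%:R * L <= T -> E (n%:R * L) <= theta ^+ n * E 0.
  elim: n => [|n IH] hn; first by rewrite mul0r expr0 mul1r.
  have e : n.+1%:R * L = n%:R * L + L by rewrite -natr1 mulrDl mul1r.
  rewrite e in hn *; have hn' : n%:R * L <= T.
    by apply: le_trans hn; rewrite lerDl ltW.
  apply: (le_trans (step _ _ hn)); first by rewrite mulr_ge0// ltW.
  by rewrite exprS -mulrA ler_pM2l//; exact: IH.
have tL : 0 <= t / L by rewrite divr_ge0// ltW.
have /andP[h1 h2] := truncn_itv tL; set n := Num.truncn _ in h1 h2.
have nt : n%:R * L <= t by rewrite -ler_pdivlMr.
apply: (le_trans (mono _ _ _ nt tT)); first by rewrite mulr_ge0// ltW.
apply: (le_trans (iter n (le_trans nt tT))); apply: ler_wpM2r => //.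
have lnth : ln theta < 0 by rewrite ln_lt0// th0.
rewrite -{1 2}(lnK th0) -expRN -expRM_natl -expRD ler_expR.
rewrite -{1}[- ln theta]mulrN1 -mulrDr (mulrC n%:R) ler_nM2l//.
by rewrite addrC lerBlDr ltW// natr1.
Qed.

Lemma window_contraction (A N X e1 e2 : R) : 0 < A -> 0 < N * X / A ->
  A * e1 <= N * (X * (e1 - e2)) -> e2 <= (1 - (N * X / A)^-1) * e1.
Proof.
move=> A0 W0; rewrite mulrA mulrC -ler_pdivlMr// (mulrAC (N * X)).
move: (N * X / A) W0 => W W0; rewrite mulrC -ler_pdivrMr// => h.
rewrite mulrBl mul1r; have : W^-1 * e1 = e1 / W by rewrite mulrC.
by move=> ->; lra.
Qed.

(** For [r < 1] already [r <= r ^ alpha]; for [r >= 1] the power is at least [1] and the left side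
    at most [1]. This exchanges the exponent [alpha] for a linear lower bound on a bounded range. *)
Lemma linear_le_powR (B alpha r : R) : 0 <= alpha <= 1 -> 0 <= r <= B ->
  r / (1 + B) <= r `^ alpha.
Proof.
move=> /andP[a0 a1] /andP[r0 rB]; have B0 := le_trans r0 rB.
have B1 : 0 < 1 + B by rewrite ltr_pwDl.
have [r1|r1] := leP 1 r.
  apply: (@le_trans _ _ 1); first by rewrite ler_pdivrMr// mul1r; lra.
  by rewrite -(powRr0 r) ler_powR.
have [->|rn0] := eqVneq r 0; first by rewrite mul0r powR_ge0.
have rp : 0 < r by rewrite lt_neqAle eq_sym rn0.
apply: (@le_trans _ _ r); first by rewrite ler_pdivrMr// ler_peMr//; lra.
by rewrite -{1}(powRr1 r0) ger_powR// rp ltW.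
Qed.

End ExponentialDecay.

Section MildDecay.
Context {R : realType}.
Local Notation pt := (@pt R).
Local Notation dir := ('I_3 * bool)%type.

(* [window_const] comes from [energy_window] in the form
   [E t <= window_const * (E t - E (t + (2 c)^-1))]; the maximum with [4^-1] in [contraction]
   bounds the prefactor [contraction^-1] of the decay by [4], whatever the other parameters. *)
Definition window_const (c M m K d : R) : R :=
  36 * 2196 * (3 * (48 * (2 * c)^-1 ^+ 2 * M ^+ 2 * K + 2 * M / d)) / (6 * m ^+ 2 / (2 * c)).
Definition contraction (c M m K d : R) : R := Num.max (1 - (window_const c M m K d)^-1) 4^-1.
(** With windows of length [(2 * c)^-1], decay by the factor [contraction] per window is
    [exp (2 c t ln contraction)]; the rate is half of the exponent, because the estimate is written
    with [- 2 lam t]. *)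
Definition decay_rate (c M m K d : R) : R := - (c * ln (contraction c M m K d)).

Variables (c M m K d : R).
Hypotheses (c0 : 0 < c) (M0 : 0 < M) (K0 : 0 < K) (d0 : 0 < d) (m0 : 0 < m).

Let L0 : 0 < (2 * c)^-1. Proof. by rewrite invr_gt0 mulr_gt0. Qed.

Let num0 : 0 < 36 * 2196 * (3 * (48 * (2 * c)^-1 ^+ 2 * M ^+ 2 * K + 2 * M / d)).
Proof.
have h1 : 0 < 36 * 2196 :> R by apply: mulr_gt0; rewrite ltr0n.
have h2 : 0 < 3 * (48 * (2 * c)^-1 ^+ 2 * M ^+ 2 * K + 2 * M / d).
  have hM : 0 < 48 * (2 * c)^-1 ^+ 2 * M ^+ 2 * K.
    by rewrite !mulr_gt0 ?exprn_gt0 ?ltr0n.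
  by rewrite mulr_gt0 ?ltr0n// addr_gt0// divr_gt0// mulr_gt0.
exact: mulr_gt0 h1 h2.
Qed.

Let den0 : 0 < 6 * m ^+ 2 / (2 * c).
Proof. by apply: mulr_gt0 => //; rewrite mulr_gt0// exprn_gt0. Qed.

Lemma window_const_gt0 : 0 < window_const c M m K d.
Proof. exact: divr_gt0 num0 den0. Qed.

Lemma contraction_itv : 4^-1 <= contraction c M m K d < 1.
Proof.
rewrite le_max lexx orbT/= gt_max ltrBlDr ltrDl invr_gt0 window_const_gt0/=.
by rewrite invf_lt1// ltr1n.
Qed.

Let contraction_gt0 : 0 < contraction c M m K d.
Proof. by have /andP[h _] := contraction_itv; apply: lt_le_trans h; rewrite invr_gt0. Qed.

Lemma decay_rate_gt0 : 0 < decay_rate c M m K d.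
Proof.
have /andP[_ h] := contraction_itv.
by rewrite oppr_gt0 pmulr_rlt0// ln_lt0// contraction_gt0.
Qed.

Variables (T : R) (w0 : dir -> pt -> R) (w : dir -> R * pt -> R) (ka : R * pt -> R).
Hypotheses (bw0 : forall a, bounded_meas (w0 a)) (pw0 : forall a, lattice_periodic (w0 a)).
Hypotheses (bw : forall a, bounded_meas (w a)) (pw : forall a t, lattice_periodic (fun x => w a (t, x))).
Hypotheses (bka : bounded_meas ka) (pka : forall t, lattice_periodic (fun x => ka (t, x))).
Hypothesis w0M : forall a x, 0 <= w0 a x <= M.
Hypothesis w_ge0 : forall a z, 0 <= w a z.
Hypothesis ka_ge0 : forall z, 0 <= ka z.
Hypothesis ka_bounds : {ae mu3, forall x, cube x -> forall t, (forall b, w b (t, x) <= M) ->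
  d * (\sum_b w b (t, x)) <= ka (t, x) <= K}.
Hypothesis mild : forall a, {ae lebs, forall t : R, 0 <= t < T -> {ae mu3, forall x, cube x ->
  w a (t, x) = mild_sol c T w0 w ka a (t, x)}}.
Hypothesis mass0 : \sum_a cint (w0 a) = 6 * m.

Let E (t : R) := \sum_a cint (fun x => (mild_sol c T w0 w ka a (t, x) - m) ^+ 2).

Lemma energy_contraction (t : R) : 0 <= t -> t + (2 * c)^-1 <= T ->
  E (t + (2 * c)^-1) <= contraction c M m K d * E t.
Proof.
move=> t0 tT.
have E0 : 0 <= E t by apply: sumr_ge0 => a _; apply: cint_ge0 => x; exact: sqr_ge0.
have h := energy_window c0 M0 d0 bw0 pw0 bw pw bka pka w0M w_ge0 ka_ge0 ka_bounds mild mass0 t0 tT.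
have h' := window_contraction den0 window_const_gt0 h.
by apply: (le_trans h'); apply: ler_wpM2r => //; rewrite le_max lexx.
Qed.

Lemma mild_energy_decay (t : R) : 0 <= t <= T ->
  E t <= 4 * expR (- (2 * decay_rate c M m K d * t)) * \sum_a cint (fun x => (w0 a x - m) ^+ 2).
Proof.
move=> tT; have /andP[th4 th1] := contraction_itv.
have E0 : 0 <= E 0 by apply: sumr_ge0 => a _; apply: cint_ge0 => x; exact: sqr_ge0.
have e0 : E 0 = \sum_a cint (fun x => (w0 a x - m) ^+ 2).
  apply: eq_bigr => a _; congr cint; apply/funext => x.
  by rewrite /mild_sol char_sol0 /= mulr0 oppr0 flow0.
have th : 0 < contraction c M m K d < 1 by rewrite contraction_gt0.
have := @iterated_decay _ E _ _ T L0 th E0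
  (fun s t s0 st tT => energy_nonincreasing m bw0 pw0 bw pw bka pka ka_ge0 mild s0 st tT)
  energy_contraction t tT.
move=> h; apply: (le_trans h); rewrite -e0; apply: ler_wpM2r => //.
have -> : ln (contraction c M m K d) * (t / (2 * c)^-1) = - (2 * decay_rate c M m K d * t).
  by rewrite /decay_rate invrK; ring.
by apply: ler_wpM2r; [exact: expR_ge0|rewrite invf_ple// ?posrE].
Qed.

End MildDecay.

Section EnergyIntegral.
Context {R : realType}.
Local Notation pt := (@pt R).
Local Notation dir := ('I_3 * bool)%type.
Variables (p q : 'I_3 -> pt -> R) (g : dir -> pt -> R) (m : R).
Hypothesis mpq : forall a, measurable_fun cube (dir_ini p q a).
Hypothesis bg : forall a, bounded_meas (g a).
Hypothesis pqg : forall a, {ae mu3, forall x, cube x -> dir_ini p q a x = g a x}.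

Lemma energy_integral :
  (\sum_(i < 3) \int[mu3]_(x in cube) ((p i x - m) ^+ 2 + (q i x - m) ^+ 2)%:E =
   (\sum_a cint (fun x => (g a x - m) ^+ 2))%:E)%E.
Proof.
have bgm a : bounded_meas (fun x => (g a x - m) ^+ 2).
  by apply: bmX; apply: bmB; [exact: bg|exact: bm_cst].
rewrite sum_dirE -sumEFin; apply: eq_bigr => i _.
have bi := bmD (bgm (i, true)) (bgm (i, false)).
rewrite -cintD//; apply: etrans (bm_fine finite_domain_cube bi).
apply: ae_eq_integral.
- exact: measurable_cube.
- apply/measurable_EFinP; apply: measurable_funD; apply: measurable_funX; apply: measurable_funB => //.
    exact: (mpq (i, true)).
  exact: (mpq (i, false)).
- by apply/measurable_EFinP/measurable_funTS; case: bi.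
- apply: ae_mu3S (ae_mu3I (pqg (i, true)) (pqg (i, false))) => x [h1 h2] cx /=.
  by rewrite -h1// -h2.
Qed.

Lemma mass_integral :
  Rintegral mu3 cube (fun x => \sum_(i < 3) (p i x + q i x)) = \sum_a cint (g a).
Proof.
rewrite -cint_sum//.
have [N [mN N0 NE]] := ae_mu3_all pqg.
apply: (@nullset_Rintegral _ _ _ mu3 cube _ (fun x => \sum_a g a x) N (@measurable_cube R) mN N0).
  by apply: measurable_funTS; case: (bm_sum (index_enum _) bg).
move=> x cx nN; rewrite sum_dirE.
have h : forall a, dir_ini p q a x = g a x.
  move=> a; apply: contra_notP nN => ne; apply: NE => /= hN.
  by apply: ne; exact: hN.
by apply: eq_bigr => i _; rewrite -!h.
Qed.

End EnergyIntegral.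

(** Continuity in time is available for first powers; this Lipschitz bound on a bounded range
    carries it over to the energy. *)
Lemma sqr_perturb {R : realType} (C m x y : R) : 0 <= m -> 0 <= x <= C -> 0 <= y <= C ->
  (x - m) ^+ 2 <= (y - m) ^+ 2 + (2 * C + 2 * m) * `|y - x|.
Proof.
move=> m0 /andP[x0 xC] /andP[y0 yC].
have -> : (x - m) ^+ 2 = (y - m) ^+ 2 + (x + y - 2 * m) * (x - y) by ring.
rewrite lerD2l; apply: (le_trans (ler_norm _)); rewrite normrM (distrC y).
by apply: ler_wpM2r; [exact: normr_ge0|rewrite ler_norml; apply/andP; split; lra].
Qed.

(** * The decay estimate for weak solutions *)

Section WeakDecay.
Context {R : realType}.
Local Notation pt := (@pt R).
Local Notation dir := ('I_3 * bool)%type.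
Variables (c M m alpha delta K : R) (k : pt * pt * pt -> R) (k1 : pt -> R)
  (u0 v0 : 'I_3 -> pt -> R) (u v : 'I_3 -> R -> pt -> R).
Hypotheses (c0 : 0 < c) (M0 : 0 < M) (m0 : 0 < m) (delta0 : 0 < delta) (K0 : 0 < K).
Hypothesis alpha01 : 0 <= alpha <= 1.
Hypotheses (rate : interaction_rate k) (rate1 : type1 k).
Hypothesis kK : forall a b x, box M a -> box M b -> cube x -> k (a, b, x) <= K.
Hypothesis k_ge : forall a b x, kdom (a, b, x) ->
  k1 x * (sum3 a + sum3 b) `^ alpha <= k (a, b, x).
Hypothesis k1_ge : {ae mu3, forall x, cube x -> delta <= k1 x}.
Hypothesis mini : forall a, measurable_fun cube (dir_ini u0 v0 a).
Hypothesis iniM : forall a, {ae mu3, forall x, cube x -> 0 <= dir_ini u0 v0 a x <= M}.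
Hypothesis mE : m = 6^-1 * Rintegral mu3 cube (fun x => \sum_(i < 3) (u0 i x + v0 i x)).
Hypothesis weak : weak_solution c k u0 v0 u v.

Lemma sol_bound (T : R) : 0 < T -> exists2 C : R, 0 < C & forall a,
  {ae mu4, forall z : R * pt, (`[0%R, T[ `*` cube) z -> `|dir_sol u v a z.1 z.2| <= C}.
Proof.
move=> T0.
have /choice[f fP] (a : dir) : exists C : R,
    {ae mu4, forall z : R * pt, (`[0%R, T[ `*` cube) z -> `|dir_sol u v a z.1 z.2| <= C}.
  have [[/(_ T T0)[_ hu] _ _] [/(_ T T0)[_ hv] _ _]] := weak.1 a.1.
  by rewrite /dir_sol; case: a.2.
exists (1 + \sum_a `|f a|).
  by rewrite ltr_pwDl// sumr_ge0.
move=> a; apply: ae_mu4S (fP a) => z h cz; apply: (le_trans (h cz)).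
apply: (le_trans (ler_norm _)); rewrite (bigD1 a)//= addrCA lerDl.
by rewrite addr_ge0// sumr_ge0.
Qed.

Section Horizon.
Variables (T C K1 : R).
Hypotheses (T0 : 0 < T) (C0 : 0 < C).
Hypothesis kK1 : forall a b x, box C a -> box C b -> cube x -> k (a, b, x) <= K1.
Hypothesis solC : forall a, {ae mu4, forall z : R * pt,
  (`[0%R, T[ `*` cube) z -> `|dir_sol u v a z.1 z.2| <= C}.

Let w a z := clean_sol T C u v a z.
Let w0 a x := clean_ini M u0 v0 a x.
Let ka z := clean_rate T C k u v z.

Let w_itv a z : 0 <= w a z <= C. Proof. by apply: clean_sol_itv; exact: ltW. Qed.

Let w_at a t : bounded_meas (fun x => w a (t, x)).
Proof.
apply: (bm_comp (bm_clean_sol T0 (ltW C0) weak a)); exact: pair1_measurable.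
Qed.

(** Below [M] the total density is at most [6 * M], where [linear_le_powR] yields the coefficient
    [delta / (1 + 6 * M)]. The exceptional set is that of the lower bound on [k1], hence the same
    for all times. *)
Let clean_rate_bounds : {ae mu3, forall x, cube x -> forall t, (forall b, w b (t, x) <= M) ->
  delta / (1 + 6 * M) * (\sum_b w b (t, x)) <= ka (t, x) <= K}.
Proof.
apply: ae_mu3S k1_ge => x k1x cx t wM.
have w0' a : 0 <= w a (t, x) by case/andP: (w_itv a (t, x)).
have wb a : w a (t, x) \in `[0, M] by rewrite in_itv/= w0' wM.
have wq a : w a (t, x) \in `[0, +oo[ by rewrite in_itv/= w0'.
apply/andP; split; last first.
  by rewrite /ka /clean_rate frac3_id//; apply: kK => //;
    (split; [exact: wb|split; exact: wb]).
have q e : quadrant (clean_vec T C u v e (t, x)).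
  by split; [exact: wq|split; exact: wq].
have sumE : \sum_b w b (t, x) =
    sum3 (clean_vec T C u v true (t, x)) + sum3 (clean_vec T C u v false (t, x)).
  rewrite sum_dirE !big_ord_recl big_ord0 /sum3 /clean_vec /=.
  have -> : lift ord0 (lift ord0 ord0) = @Ordinal 3 2 isT by exact: val_inj.
  have -> : lift ord0 ord0 = @Ordinal 3 1 isT by exact: val_inj.
  have -> : ord0 = @Ordinal 3 0 isT by exact: val_inj.
  by rewrite /w; ring.
have r0 : 0 <= \sum_b w b (t, x) by apply: sumr_ge0 => a _; exact: w0'.
have rM : \sum_b w b (t, x) <= 6 * M.
  by rewrite -(sum_dir_cst M); apply: ler_sum => a _; exact: wM.
have kd : kdom (clean_vec T C u v true (t, x), clean_vec T C u v false (t, x), x).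
  by split; [split; exact: q|].
rewrite /ka /clean_rate frac3_id//; apply: le_trans (k_ge kd).
rewrite -sumE; move: (\sum_b w b (t, x)) r0 rM => r r0 rM.
have h : r / (1 + 6 * M) <= r `^ alpha by apply: linear_le_powR; rewrite ?r0.
rewrite mulrAC -mulrA; apply: ler_pM => //; last exact: k1x.
- exact: ltW.
- by rewrite divr_ge0// addr_ge0// mulr_ge0// ltW.
Qed.

Let p a z := mild_sol c T w0 w ka a z.

Let w_mild a tau : 0 < tau -> tau < T -> {ae mu3, forall x, cube x -> w a (tau, x) = p a (tau, x)}.
Proof.
exact: (clean_sol_mild T0 (ltW C0) (ltW M0) rate kK1 weak solC mini iniM).
Qed.

Let mild a : {ae lebs, forall t : R, 0 <= t < T -> {ae mu3, forall x, cube x ->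
  w a (t, x) = p a (t, x)}}.
Proof.
(* Duhamel's formula was established for positive times; the single time [0] is a null set. *)
exists [set 0]; split; [exact: measurable_set1|exact: lebesgue_measure_set1|].
move=> t /= h; apply: contra_notP h => tn0 /andP[t0 tT].
by apply: w_mild => //; rewrite lt_neqAle t0 andbT eq_sym; apply/eqP.
Qed.

Let bw0 a : bounded_meas (w0 a). Proof. exact: (bm_clean_ini (ltW M0) mini a). Qed.

Let mass0 : \sum_a cint (w0 a) = 6 * m.
Proof.
by rewrite mE mulVKf// -(mass_integral bw0 (clean_iniE iniM)).
Qed.

Let E (t : R) := \sum_a cint (fun x => (p a (t, x) - m) ^+ 2).
Let F (t : R) := \sum_a cint (fun x => (w a (t, x) - m) ^+ 2).

Let bka : bounded_meas ka.
Proof. exact: (bm_clean_rate T0 (ltW C0) rate kK1 weak). Qed.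

Let bw a : bounded_meas (w a).
Proof. exact: (bm_clean_sol T0 (ltW C0) weak a). Qed.

Let F_pos t : 0 < t -> t < T -> F t = E t.
Proof.
move=> t0 tT; apply: eq_bigr => a _; apply: eq_cint_ae.
- by apply: bmX; apply: bmB; [exact: w_at|exact: bm_cst].
- by apply: bmX; apply: bmB; [exact: bm_mild_sol_at|exact: bm_cst].
- by apply: ae_mu3S (w_mild a t0 tT) => x h cx; rewrite h.
Qed.

Let E_decay t : 0 <= t -> t <= T ->
  E t <= 4 * expR (- (2 * decay_rate c M m K (delta / (1 + 6 * M)) * t)) *
         \sum_a cint (fun x => (w0 a x - m) ^+ 2).
Proof.
move=> t0 tT; apply: (mild_energy_decay c0 M0 K0 _ m0 bw0 _ bw _ bka) => //.
- by rewrite divr_gt0// addr_gt0// mulr_gt0.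
- exact: periodic_clean_ini.
- exact: periodic_clean_sol.
- exact: periodic_clean_rate.
- by move=> a x; exact: (clean_ini_itv _ _ (ltW M0)).
- by move=> a z; case/andP: (w_itv a z).
- by move=> z; apply: clean_rate_ge0 => //; exact: ltW.
- by rewrite t0.
Qed.

(* At time [0] the mild formula is not available, but [F] is lower semicontinuous there. *)
Let F_le t : 0 <= t -> t < T ->
  F t <= 4 * expR (- (2 * decay_rate c M m K (delta / (1 + 6 * M)) * t)) *
         \sum_a cint (fun x => (w0 a x - m) ^+ 2).
Proof.
rewrite le_eqVlt => /predU1P[<-|t0] tT; last by rewrite F_pos//; exact: E_decay (ltW t0) (ltW tT).
rewrite mulr0 oppr0 expR0 mulr1; apply/ler_addgt0Pr => eps eps0.
have B0 : 0 < 6 * (2 * C + 2 * m) by rewrite mulr_gt0// addr_gt0// mulr_gt0.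
have tT0 : 0 <= (0 : R) < T by rewrite lexx.
have cont a := clean_sol_cont T0 (ltW C0) weak a tT0 (divr_gt0 eps0 B0).
have /choice[f fP] a : exists dl : R, 0 < dl /\ forall t, 0 <= t < T -> `|t - 0| < dl ->
    cint (fun x => `|w a (t, x) - w a (0, x)|) <= eps / (6 * (2 * C + 2 * m)).
  by have [dl h1 h2] := cont a; exists dl; split => // s sT; exact: h2.
(* One time [s] must meet six moduli of continuity at once; starting the minimum from [T] keeps it
   below the horizon. *)
pose mn := \big[Num.min/T]_a f a.
have mn0 : 0 < mn by rewrite /mn; elim/big_rec: _ => // a x _ hx; rewrite lt_min hx (fP a).1.
pose s := mn / 2; have s0 : 0 < s by rewrite divr_gt0.
have smn : s < mn by rewrite ltr_pdivrMr// mulr_natr mulr2n ltrDl.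
have sT : s < T by apply: (lt_le_trans smn); exact: bigmin_le_id.
have hs a : cint (fun x => (w a (0, x) - m) ^+ 2) <=
    cint (fun x => (w a (s, x) - m) ^+ 2) + eps / 6.
  have sf : `|s - 0| < f a.
    by rewrite subr0 gtr0_norm//; apply: (lt_le_trans smn); exact: bigmin_le.
  have sT' : 0 <= s < T by rewrite ltW.
  have h := (fP a).2 s sT' sf.
  have bs r : bounded_meas (fun x => (w a (r, x) - m) ^+ 2).
    by apply: bmX; apply: bmB; [exact: w_at|exact: bm_cst].
  have bd : bounded_meas (fun x => `|w a (s, x) - w a (0, x)|).
    by apply: bm_norm; apply: bmB; exact: w_at.
  have bd' := bmM (bm_cst (2 * C + 2 * m)) bd.
  have h1 := le_cint (bs 0) (bmD (bs s) bd')
    (fun x => sqr_perturb (ltW m0) (w_itv a (0, x)) (w_itv a (s, x))).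
  apply: (le_trans h1); rewrite (cintD (bs s) bd') (cintZ _ bd) lerD2l.
  apply: (@le_trans _ _ ((2 * C + 2 * m) * (eps / (6 * (2 * C + 2 * m))))).
    by apply: ler_wpM2l h; rewrite addr_ge0// mulr_ge0// ltW.
  have B2 : 0 < 2 * C + 2 * m by rewrite addr_gt0// mulr_gt0.
  rewrite le_eqVlt; apply/orP; left; apply/eqP; move: (2 * C + 2 * m) B2 => B B2.
  by field; exact: lt0r_neq0.
apply: (@le_trans _ _ (F s + eps)); last first.
  rewrite lerD2r F_pos//; apply: (le_trans (E_decay (ltW s0) (ltW sT))).
  apply: ler_wpM2r; first by apply: sumr_ge0 => a _; apply: cint_ge0 => x; exact: sqr_ge0.
  rewrite ler_piMr// expR_le1 oppr_le0.
  apply: mulr_ge0; last exact: ltW.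
  apply: mulr_ge0 => //; apply: ltW; apply: decay_rate_gt0 => //.
  by rewrite divr_gt0// addr_gt0// mulr_gt0.
have -> : F s + eps = \sum_a (cint (fun x => (w a (s, x) - m) ^+ 2) + eps / 6).
  by rewrite big_split/= sum_dir_cst mulrC divfK.
by apply: ler_sum => a _; exact: hs.
Qed.

Lemma weak_decay_before t : 0 <= t -> t < T ->
  (\sum_(i < 3) \int[mu3]_(x in cube) ((u i t x - m) ^+ 2 + (v i t x - m) ^+ 2)%:E
   <= (4 * expR (- (2 * decay_rate c M m K (delta / (1 + 6 * M)) * t)))%:E *
      \sum_(i < 3) \int[mu3]_(x in cube) ((u0 i x - m) ^+ 2 + (v0 i x - m) ^+ 2)%:E)%E.
Proof.
move=> t0 tT.
have dE a : dir_ini (fun i => u i t) (fun i => v i t) a = dir_sol u v a t.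
  by rewrite /dir_ini /dir_sol; case: a.2.
rewrite (energy_integral m mini bw0 (clean_iniE iniM)).
rewrite (@energy_integral _ _ _ (fun a x => w a (t, x)) m); last 3 first.
- move=> a; rewrite dE /dir_sol.
  have [[_ _ /(_ 1 (lexx 1))[hu _]] [_ _ /(_ 1 (lexx 1))[hv _]]] := weak.1 a.1.
  by case: a.2; [exact: (hu t t0).1|exact: (hv t t0).1].
- by move=> a; exact: w_at.
- move=> a; rewrite dE; apply: (clean_sol_at weak solC); by rewrite t0.
by rewrite -EFinM lee_fin; exact: F_le.
Qed.

End Horizon.

(** The bound [C] on the solution and the bound [K1] on the rate depend on the horizon [t + 1], but
    neither appears in the final estimate: the maximum principle has replaced them by [M] and
    [K]. *)
Lemma weak_decay t : 0 <= t ->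
  (\sum_(i < 3) \int[mu3]_(x in cube) ((u i t x - m) ^+ 2 + (v i t x - m) ^+ 2)%:E
   <= (4 * expR (- (2 * decay_rate c M m K (delta / (1 + 6 * M)) * t)))%:E *
      \sum_(i < 3) \int[mu3]_(x in cube) ((u0 i x - m) ^+ 2 + (v0 i x - m) ^+ 2)%:E)%E.
Proof.
move=> t0; have T0 : 0 < t + 1 by rewrite ltr_wpDl.
have [C C0 hC] := sol_bound T0; have [K1 _ hK1] := rate1 C0.
by apply: (weak_decay_before T0 C0 hK1 hC t0); rewrite ltrDl.
Qed.

End WeakDecay.

Unset Implicit Arguments.
Set Strict Implicit.

Theorem theorem2p7 (R : realType) (c M m : R) :
  0 < c ->
  exists2 Lam : R, 0 < Lam &
  forall alpha delta K : R,
    0 <= alpha <= 1 -> 0 < delta -> 0 < K ->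
    exists2 lam : R, 0 < lam &
    forall (k : pt * pt * pt -> R) (k1 : pt -> R)
           (u0 v0 : 'I_3 -> pt -> R) (u v : 'I_3 -> R -> pt -> R),
      (* k is an interaction rate of type 1 *)
      interaction_rate k -> type1 k ->
      (* K is the bound kappa_1(M) of k *)
      (forall a b x, box M a -> box M b -> cube x -> k (a, b, x) <= K) ->
      (* lower bound k >= k1(x) (u1+...+v3)^alpha, k1 in L^oo, ess inf k1 = delta *)
      (forall a b x, kdom (a, b, x) ->
          k1 x * (sum3 a + sum3 b) `^ alpha <= k (a, b, x)) ->
      Linf k1 -> essinf k1 = delta%:E ->
      (* nonnegative L^oo initial data *)
      (forall i, Linf (u0 i) /\ Linf (v0 i)) ->
      (forall i, {ae mu3, forall x, cube x -> 0 <= u0 i x} /\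
                 {ae mu3, forall x, cube x -> 0 <= v0 i x}) ->
      (* M = max_i (||u0_i||_oo, ||v0_i||_oo) *)
      (forall i, (esssup_abs (u0 i) <= M%:E)%E /\ (esssup_abs (v0 i) <= M%:E)%E) ->
      (exists i, esssup_abs (u0 i) = M%:E \/ esssup_abs (v0 i) = M%:E) ->
      (* m_oo = 1/6 int sum_i (u0_i + v0_i) > 0 *)
      m = 6^-1 * Rintegral mu3 cube (fun x => \sum_(i < 3) (u0 i x + v0 i x)) ->
      0 < m ->
      weak_solution c k u0 v0 u v ->
      forall t : R, 0 <= t ->
        (\sum_(i < 3) \int[mu3]_(x in cube) ((u i t x - m) ^+ 2 + (v i t x - m) ^+ 2)%:E
         <= (Lam * expR (- (2 * lam * t)))%:E *
            \sum_(i < 3) \int[mu3]_(x in cube) ((u0 i x - m) ^+ 2 + (v0 i x - m) ^+ 2)%:E)%E.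
Proof.
move=> c0; exists 4 => // alpha delta K alpha01 delta0 K0.
pose lam := decay_rate c M m K (delta / (1 + 6 * M)).
(* A positive rate has to be named before the data that force [M] and [m] to be positive; the value
   [1] fills the remaining cases. *)
exists (if (0 < M) && (0 < m) then lam else 1).
  case: ifP => // /andP[M0 m0]; apply: decay_rate_gt0 => //.
  by rewrite divr_gt0// addr_gt0// mulr_gt0.
move=> k k1 u0 v0 u v rate rate1 kK k_ge _ k1inf iniLinf ini_ge0 ini_leM _ mE m0 weak t t0.
have mini a : measurable_fun cube (dir_ini u0 v0 a).
  by have [[hu _] [hv _]] := iniLinf a.1; rewrite /dir_ini; case: a.2.
have iniM a : {ae mu3, forall x, cube x -> 0 <= dir_ini u0 v0 a x <= M}.
  have h0 : {ae mu3, forall x, cube x -> 0 <= dir_ini u0 v0 a x}.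
    by have [hu hv] := ini_ge0 a.1; rewrite /dir_ini; case: a.2.
  have hM : (esssup_abs (dir_ini u0 v0 a) <= M%:E)%E.
    by have [hu hv] := ini_leM a.1; rewrite /dir_ini; case: a.2.
  have {}hM := ae_muT (elimT ess_supP hM).
  apply: ae_mu3S (ae_mu3I h0 hM) => x [h1 h2] cx; rewrite h1//=.
  by apply: (le_trans (ler_norm _)); rewrite -lee_fin; exact: h2.
have k1_ge : {ae mu3, forall x, cube x -> delta <= k1 x}.
  have h : (delta%:E <= essinf k1)%E by rewrite k1inf.
  by apply: ae_mu3S (ae_muT (elimT ess_infP h)) => x hx cx; rewrite -lee_fin; exact: hx.
(* For [M <= 0] the data would vanish almost everywhere and the mass with them. *)
have M0 : 0 < M.
  rewrite ltNge; apply/negP => M0; suff : m = 0 by move=> m00; rewrite m00 ltxx in m0.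
  rewrite mE (@mass_integral _ u0 v0 (fun _ _ => 0)).
  - by rewrite big1 ?mulr0// => a _; exact: cint_cst.
  - by move=> a; exact: bm_cst.
  - move=> a; apply: ae_mu3S (iniM a) => x h cx; have /andP[h0 hM] := h cx.
    by apply/eqP; rewrite eq_le h0 (le_trans hM).
rewrite M0 m0 /=.
exact: (weak_decay c0 M0 m0 delta0 K0 alpha01 rate rate1 kK k_ge k1_ge mini iniM mE weak t0).
Qed.
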